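(* Every cactus has a planar Lombardi drawing for its natural embedding.
   Context: A cactus is a graph in which each edge belongs to at most one cycle. The natural embedding of a cactus is the planar embedding in which every cycle bounds a face, with all other edges incident to the cycle's vertices placed outside the cycle. A Lombardi drawing maps each vertex to a point and each edge to a circular arc or line segment joining the points of its endpoints, such that at each vertex $v$ the incident arcs are equally spaced around $v$, consecutive arcs forming angles $2\pi/\deg(v)$. It is planar if the only intersection points of its arcs are shared endpoints; a Lombardi drawing for a given embedding is one whose rotation of arcs around each vertex and whose faces agree with that embedding. *)

(* Defs.v *)
From HB Require Import structures.
From mathcomp Require Import all_boot all_order all_algebra.
From mathcomp Require Import all_classical all_reals all_analysis.
Set Implicit Arguments.
Unset Strict Implicit.
Unset Printing Implicit Defensive.
Import Order.TTheory GRing.Theory Num.Theory.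
Import numFieldNormedType.Exports.
Local Open Scope ring_scope.

Definition simple_graph (V : finType) (adj : rel V) : Prop :=
  (forall x y, adj x y = adj y x) /\ (forall x, ~~ adj x x).

Definition is_cycle (V : finType) (adj : rel V) (s : seq V) : bool :=
  [&& uniq s, (2 < size s)%N & cycle adj s].

Definition cycle_edges (V : finType) (s : seq V) : {set {set V}} :=
  [set [set x; next s x] | x in s].

Definition cactus (V : finType) (adj : rel V) : Prop :=
  forall s1 s2 : seq V, is_cycle adj s1 -> is_cycle adj s2 ->
  forall x y : V, adj x y ->
    [set x; y] \in cycle_edges s1 -> [set x; y] \in cycle_edges s2 ->
    cycle_edges s1 = cycle_edges s2.

Definition deg (V : finType) (adj : rel V) (v : V) : nat := #|[set w | adj v w]|.

(* Rotation system: rot v is a cyclic permutation of the neighbours of v,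
   rot v w = the neighbour following w in counterclockwise order around v. *)
Definition rotation_system (V : finType) (adj : rel V) (rot : V -> V -> V) : Prop :=
  forall v,
    (forall w, adj v w -> adj v (rot v w)) /\
    (forall w w', adj v w -> adj v w' -> rot v w = rot v w' -> w = w') /\
    (forall w w', adj v w -> adj v w' -> exists k, iter k (rot v) w = w').

(* Natural embedding (combinatorial part): every cycle bounds a face, i.e. for
   some orientation of the cycle (the one that will be counterclockwise, with
   the face on its left), at every vertex x of the cycle the two cycle edges
   are consecutive in the rotation, with the face between them:
   rot x (next s x) = prev s x.  The geometric part ("all other edges placed
   outside the cycle", i.e. the face bounded by the cycle is its interior) is
   imposed on the drawing, see [faces_natural] below. *)
Definition natural_embedding (V : finType) (adj : rel V) (rot : V -> V -> V) : Prop :=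
  rotation_system adj rot /\
  forall s, is_cycle adj s ->
    (forall x, x \in s -> rot x (next s x) = prev s x) \/
    (forall x, x \in s -> rot x (prev s x) = next s x).

Local Open Scope classical_set_scope.

Section Geometry.
Variable R : realType.
Local Notation pt := (R * R)%type.

Definition psub (a b : pt) : pt := (a.1 - b.1, a.2 - b.2).
Definition pscale (r : R) (a : pt) : pt := (r * a.1, r * a.2).
(* complex product w1 * conj w2, identifying (x,y) with x + iy *)
Definition pmulconj (w1 w2 : pt) : pt :=
  (w1.1 * w2.1 + w1.2 * w2.2, w1.2 * w2.1 - w1.1 * w2.2).
Definition pdir (t : R) : pt := (cos t, sin t).

(* The arc leaving a in direction t towards b is a genuine circular arc or
   segment (its relative angle to the chord is not pi). *)
Definition good_dir (a b : pt) (t : R) : Prop :=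
  let c := pmulconj (pdir t) (psub b a) in ~ (c.2 = 0 /\ c.1 <= 0).

(* The (closed) circular arc or segment from a to b whose tangent at a has
   direction angle t: besides a and b, the points z with
   arg((z-a)/(b-z)) = arg(e^{it} / (b-a)) (inscribed angle characterization). *)
Definition arc (a b : pt) (t : R) : set pt :=
  [set z | z = a \/ z = b \/
    (z <> a /\ z <> b /\ exists r : R, 0 < r /\
       pmulconj (psub z a) (psub b z) = pscale r (pmulconj (pdir t) (psub b a)))].

Definition unbounded_set (K : set pt) : Prop :=
  forall M : R, exists q, K q /\ M < Num.max `|q.1| `|q.2|.
End Geometry.
Notation pt R := (R * R)%type (only parsing).

(* A drawing: p places vertices; t u v is the direction angle in which the arc
   of edge uv leaves p u. *)
Definition edge_arc (R : realType) (V : finType) (p : V -> pt R) (t : V -> V -> R)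
  (u v : V) : set (pt R) := arc (p u) (p v) (t u v).

Definition drawing_points (R : realType) (V : finType) (adj : rel V)
  (p : V -> pt R) (t : V -> V -> R) : set (pt R) :=
  [set z | (exists u v, adj u v /\ edge_arc p t u v z) \/ exists w, z = p w].

(* Well-defined arc drawing: distinct vertex points, each edge drawn as one
   circular arc or segment between its endpoints, with tangent t u v at p u
   and t v u at p v. *)
Definition arc_drawing (R : realType) (V : finType) (adj : rel V)
  (p : V -> pt R) (t : V -> V -> R) : Prop :=
  injective p /\
  forall u v, adj u v ->
    good_dir (p u) (p v) (t u v) /\ edge_arc p t u v = edge_arc p t v u.

Definition lombardi_for (R : realType) (V : finType) (adj : rel V) (rot : V -> V -> V)
  (t : V -> V -> R) : Prop :=
  forall v w, adj v w ->
    let a := t v w + 2 * pi / (deg adj v)%:R in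
    cos (t v (rot v w)) = cos a /\ sin (t v (rot v w)) = sin a.

Definition planar_drawing (R : realType) (V : finType) (adj : rel V)
  (p : V -> pt R) (t : V -> V -> R) : Prop :=
  (forall u v x y z, adj u v -> adj x y ->
     edge_arc p t u v z -> edge_arc p t x y z ->
     [set u; v]%SET = [set x; y]%SET \/
     exists w, w \in ([set u; v] :&: [set x; y])%SET /\ z = p w) /\
  (forall u v w, adj u v -> edge_arc p t u v (p w) -> w = u \/ w = v).

(* Faces of the natural embedding: the face bounded by each cycle is the
   interior of the cycle, i.e. every point of the drawing off the cycle lies in
   the unbounded connected component of the complement of the cycle. *)
Definition cycle_curve (R : realType) (V : finType) (p : V -> pt R) (t : V -> V -> R)
  (s : seq V) : set (pt R) :=
  [set z | exists x, x \in s /\ edge_arc p t x (next s x) z].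

Definition faces_natural (R : realType) (V : finType) (adj : rel V)
  (p : V -> pt R) (t : V -> V -> R) : Prop :=
  forall s, is_cycle adj s ->
  forall z, drawing_points adj p t z -> ~ cycle_curve p t s z ->
    exists K : set (pt R), K z /\ K `<=` ~` cycle_curve p t s /\
      connected K /\ unbounded_set K.

Definition planar_lombardi_drawing_for (R : realType) (V : finType) (adj : rel V)
  (rot : V -> V -> V) (p : V -> pt R) (t : V -> V -> R) : Prop :=
  [/\ arc_drawing adj p t, lombardi_for adj rot t, planar_drawing adj p t
    & faces_natural adj p t].

(* Main.v *)
(** Draw the cactus block by block.  The rotation at a vertex fixes its tangent directions up to one
    base angle, so positions and base angles are all that has to be found.  Near a drawn vertex v each
    edge stays in a thin cone around its tangent; hence a new block at v that is small and lies in the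
    wedge spanned by its own edges at v (slightly widened) meets the old drawing only in v.

    A bridge is a short segment.  A cycle is drawn by sending v to infinity: it becomes a chain of arcs
    between two rays, for which no closing condition remains, so that all headings can be chosen freely
    and in such a way that inner arcs lie in disjoint vertical strips.  The map w |-> c / (w - o), with o
    far below the chain and c small, brings infinity to v and the chain into its wedge.

    That everything else lies outside the cycle is shown by paths to infinity: radially away from v for
    what is older than the cycle; for blocks attached later at a cycle vertex, around that vertex into
    the image of the vertical half-line below it, and along this image. *)

Require Import Defs.
From mathcomp Require Import all_boot all_order all_algebra.
From mathcomp Require Import all_classical all_reals all_analysis.
From mathcomp Require Import complex.
From mathcomp Require Import ring lra.
Set Implicit Arguments.
Unset Strict Implicit.
Unset Printing Implicit Defensive.
Import Order.TTheory GRing.Theory Num.Theory.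
Import numFieldNormedType.Exports.
Local Open Scope ring_scope.
Local Open Scope complex_scope.

(** * Circular arcs in the complex plane *)

Section ComplexBasics.
Variable R : realType.
Local Notation C := R[i].
Local Notation re := (@complex.Re R).
Local Notation im := (@complex.Im R).

(** Gluing can ignore the global shape of the drawing because of the invariant [attached]: an
    undrawn component hangs on one drawn vertex. Tangent directions at v are multiples of [theta v]
    apart, and a tolerance of a quarter of [theta v] on either side keeps the zones of consecutive
    edges disjoint; the constants 1/4 and 5/4 come from this.

    The obstacle is a cycle with prescribed angles: its arcs have to close up, avoid each other and
    fit into a wedge at v. Moebius maps preserve arcs and angles, so they may be applied to a curve
    that is easy to control. At each vertex the derivative turns all tangents alike, which the free
    base angle there absorbs; only the base angle at v is fixed already, and the phase of the map is
    matched to it.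

    Arcs are studied by inversion at an endpoint: u / (z - a) runs on the horizontal ray u / (b - a)
    + s with s >= 0. Bounds, thin cones, half-planes and angles of view are all read off from this
    ray. *)

Definition expi (t : R) : C := cos t +i* sin t.
Definition toC (a : R * R) : C := a.1 +i* a.2.
Definition ofC (z : C) : R * R := (re z, im z).

Lemma toCK : cancel toC ofC. Proof. by case. Qed.
Lemma ofCK : cancel ofC toC. Proof. by case. Qed.

Lemma reM (a b : C) : re (a * b) = re a * re b - im a * im b.
Proof. by case: a b => [a1 a2] [b1 b2]. Qed.
Lemma imM (a b : C) : im (a * b) = re a * im b + im a * re b.
Proof. by case: a b => [a1 a2] [b1 b2]. Qed.
Lemma reD (a b : C) : re (a + b) = re a + re b.
Proof. by case: a b => [a1 a2] [b1 b2]. Qed.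
Lemma imD (a b : C) : im (a + b) = im a + im b.
Proof. by case: a b => [a1 a2] [b1 b2]. Qed.
Lemma reN (a : C) : re (- a) = - re a. Proof. by case: a. Qed.
Lemma imN (a : C) : im (- a) = - im a. Proof. by case: a. Qed.
Lemma reB (a b : C) : re (a - b) = re a - re b.
Proof. by rewrite reD reN. Qed.
Lemma imB (a b : C) : im (a - b) = im a - im b.
Proof. by rewrite imD imN. Qed.
Definition reimE := (reB, imB, reM, imM, reD, imD, reN, imN).

Lemma complex_eq (a b : C) : re a = re b -> im a = im b -> a = b.
Proof. by case: a b => [a1 a2] [b1 b2] /= -> ->. Qed.

Lemma realC_neq0 (r : R) : (r%:C != 0 :> C) = (r != 0).
Proof. by rewrite eq_complex /= eqxx andbT. Qed.

Lemma gt0_realC (z : C) : 0 < z -> z = (re z)%:C /\ 0 < re z.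
Proof.
by case: z => a b; rewrite ltcE /= => /andP[/eqP -> ->].
Qed.

Lemma le0_realC (z : C) : z <= 0 -> z = (re z)%:C /\ re z <= 0.
Proof.
by case: z => a b; rewrite lecE /= => /andP[/eqP <- ->].
Qed.

Lemma expiD (s t : R) : expi (s + t) = expi s * expi t.
Proof.
apply: complex_eq; rewrite ?reimE /= ?cosD ?sinD //.
by rewrite addrC; congr (_ + _); rewrite mulrC.
Qed.

Lemma expi0 : expi 0 = 1 :> C.
Proof. by rewrite /expi cos0 sin0. Qed.

Lemma expi_neq0 (t : R) : expi t != 0.
Proof.
apply/eqP => e; have /esym/eqP := expi0; rewrite -(subrr t) expiD e mul0r.
by rewrite oner_eq0.
Qed.

Lemma expiN (t : R) : expi (- t) = (expi t)^-1.
Proof.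
apply: (mulfI (expi_neq0 t)).
by rewrite -expiD subrr expi0 divff // expi_neq0.
Qed.

Lemma expiB (s t : R) : expi (s - t) = expi s / expi t.
Proof. by rewrite expiD expiN. Qed.

Lemma expipi : expi pi = -1.
Proof. by rewrite /expi cospi sinpi; apply: complex_eq; rewrite /= ?oppr0. Qed.

Lemma expiDpi (t : R) : expi (t + pi) = - expi t.
Proof. by rewrite expiD expipi mulrN1. Qed.

Lemma expi2pi : expi (2 * pi) = 1.
Proof.
by rewrite mulr_natl mulr2n expiD expipi mulrNN mulr1.
Qed.

Lemma expiD2pi (t : R) : expi (t + 2 * pi) = expi t.
Proof. by rewrite expiD expi2pi mulr1. Qed.

Lemma norm_expi (t : R) : `|expi t| = 1.
Proof. by rewrite normc_def /= cos2Dsin2 sqrtr1. Qed.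

Lemma norm_realC (r : R) : `|r%:C| = `|r|%:C :> C.
Proof. by rewrite normc_def /= expr0n addr0 sqrtr_sqr. Qed.

Lemma expi_inj_period (s t : R) :
  expi s = expi t -> t < s < t + 2 * pi -> False.
Proof.
move=> e /andP[h1 h2].
have e1 : expi (s - t) = 1 by rewrite expiB e divff // expi_neq0.
have h0 : 0 < sin ((s - t) / 2) by apply: sin_gt0_pi; lra.
have : cos (s - t) = 1 by case: e1.
have -> : s - t = ((s - t) / 2) *+ 2 by rewrite -mulr_natr; field.
rewrite cos_mulr2n cos2sin2 => e2.
have : sin ((s - t) / 2) ^+ 2 = 0 by rewrite -mulr_natr in e2; lra.
by move/eqP; rewrite sqrf_eq0 gt_eqF.
Qed.

Lemma unit_vector_angle (x y : R) : x ^+ 2 + y ^+ 2 = 1 ->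
  exists t : R, [/\ - pi <= t <= pi, cos t = x, sin t = y & (0 < y -> 0 < t < pi)].
Proof.
move=> e; have hx : -1 <= x <= 1.
  by apply/andP; split; have := sqr_ge0 y; nra.
have hc : cos (acos x) = x by rewrite acosK // in_itv.
have hs : sin (acos x) = `|y|.
  rewrite sin_acos // -sqrtr_sqr; congr Num.sqrt; lra.
have [h1 h2] := (acos_ge0 hx, acos_lepi hx).
have pi0 := pi_gt0 R.
have [y0|y0] := ltP y 0.
  exists (- acos x); split; [lra | by rewrite cosN | | lra].
  by rewrite sinN hs ltr0_norm // opprK.
exists (acos x); split => //; [lra | by rewrite hs ger0_norm | move=> y1].
have : acos x != 0 by apply/eqP => h; move: hs; rewrite h sin0 ger0_norm //; lra.
have : acos x != pi.
  by apply/eqP => h; move: hs; rewrite h sinpi ger0_norm //; lra.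
by lra.
Qed.

Lemma polarP (z : C) : z != 0 ->
  exists r t : R, [/\ 0 < r, - pi <= t <= pi, z = r%:C * expi t
                  & (0 < im z -> 0 < t < pi)].
Proof.
move=> z0; case: z z0 => x y z0; set r := Num.sqrt (x ^+ 2 + y ^+ 2).
have n0 : 0 < x ^+ 2 + y ^+ 2.
  rewrite lt0r addr_ge0 ?sqr_ge0 // andbT paddr_eq0 ?sqr_ge0 // !sqrf_eq0.
  by apply: contra z0 => /andP[/eqP -> /eqP ->].
have r0 : 0 < r by rewrite sqrtr_gt0.
have r2 : r ^+ 2 = x ^+ 2 + y ^+ 2 by rewrite sqr_sqrtr // ltW.
have [|t [h1 h2 h3 h4]] := @unit_vector_angle (x / r) (y / r).
  by rewrite !expr_div_n -mulrDl -r2 divff // expf_neq0 // gt_eqF.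
exists r, t; split => //.
  by apply: complex_eq; rewrite ?reimE /= ?h2 ?h3 mul0r ?subr0 ?addr0 mulrC divfK ?gt_eqF.
by move=> /= y0; apply: h4; rewrite divr_gt0.
Qed.

(** The wedge condition is written with [cos h] and [sin h] instead of a tangent so that h may
    exceed pi / 2; there it holds automatically in the upper half-plane. Such h arise from vertices
    of degree two. *)
Lemma upper_polarP (x y h : R) : 0 < y -> 0 <= h <= pi ->
  `|x| * cos h <= y * sin h ->
  exists r t : R, [/\ 0 < r, - h <= t <= h & x +i* y = r%:C * expi (pi / 2 + t)].
Proof.
move=> y0 h0 hxy.
have [|r [t [r0 _ e /(_ y0) tb]]] := @polarP (x +i* y).
  by rewrite eq_complex /= (gt_eqF y0) andbF.
exists r, (t - pi / 2); split => //; last by rewrite addrCA subrr addr0.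
have [ex ey] : x = r * cos t /\ y = r * sin t.
  by case: e; rewrite !mul0r subr0 addr0.
have [hb|hb] := ltP (pi / 2) h; first by lra.
have ch : 0 <= cos h by apply: cos_ge0_pihalf; lra.
have pi0 := pi_gt0 R.
have key (u : R) : (u = x) \/ (u = - x) -> u / r * cos h <= sin t * sin h.
  have rn0 : r != 0 by rewrite gt_eqF.
  move=> hu; rewrite -(ler_pM2l r0) (mulrA r (sin t)) -ey.
  have -> : r * (u / r * cos h) = u * cos h by field.
  by apply: le_trans hxy; rewrite ler_wpM2r //; case: hu => ->; rewrite ?ler_norm // -normrN ler_norm.
(* Divided by r, the hypothesis for x and for - x says cos (t + h) <= 0 <= cos (t - h), which traps
   t within h of pi / 2. *)
have k1 := key _ (or_introl erefl); have k2 := key _ (or_intror erefl).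
move: k1 k2; rewrite ex mulNr (mulrC r) mulfK ?gt_eqF // => k1 k2.
have l1 : cos (t + h) <= 0 by rewrite cosD; lra.
have l2 : 0 <= cos (t - h) by rewrite cosB; lra.
apply/andP; split; rewrite leNgt; apply/negP => lt.
  by have : 0 < cos (t + h); [apply: cos_gt0_pihalf; lra | lra].
have : 0 < sin (t - h - pi / 2) by apply: sin_gt0_pi; lra.
by rewrite sinBpihalf; lra.
Qed.

(* [0 < w] in [R[i]] forces w to be real, so this says that (z - a) / (b - z) and u / (b - a) have the
   same argument; at z = b the junk value 0 of the quotient makes it false. *)
Definition arcC (a b u z : C) : bool :=
  [|| z == a, z == b | 0 < (z - a) * (b - a) / ((b - z) * u)].

Lemma toC_inj : injective toC. Proof. exact: can_inj toCK. Qed.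

Lemma toC_pmulconj (a b : R * R) : toC (pmulconj a b) = toC a * (toC b)^*.
Proof.
case: a b => [a1 a2] [b1 b2]; apply: complex_eq; rewrite /pmulconj /toC /= .
  by rewrite mulrN opprK.
by rewrite mulrN addrC.
Qed.

Lemma toC_psub (a b : R * R) : toC (psub a b) = toC a - toC b.
Proof. by []. Qed.

Lemma toC_pscale (r : R) (a : R * R) : toC (pscale r a) = r%:C * toC a.
Proof. by apply: complex_eq; rewrite ?reimE /= !mul0r ?subr0 ?addr0. Qed.

Lemma mulcJ_gt0 (a : C) : a != 0 -> 0 < a * a^*.
Proof. by move=> a0; rewrite lt0r mulcJ_ge0 andbT mulf_neq0 // conjc_eq0. Qed.

(** Multiplying by the positive numbers [B * B^*] and [D * D^*] removes the conjugates. What remains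
    is rational, so that Moebius maps act on it algebraically. *)
Lemma pos_quotP (A B U D : C) : A != 0 -> B != 0 -> U != 0 -> D != 0 ->
  (exists r : R, 0 < r /\ A * B^* = r%:C * (U * D^*)) <-> 0 < A * D / (B * U).
Proof.
move=> A0 B0 U0 D0.
have [nB nD] := (mulcJ_gt0 B0, mulcJ_gt0 D0).
have [jB jD] : B^* != 0 /\ D^* != 0 by rewrite !conjc_eq0.
split=> [[r [r0 e]]|/[dup] X0].
  have -> : A * D / (B * U) = r%:C * (D * D^*) / (B * B^*).
    have -> : A = r%:C * (U * D^*) / B^* by rewrite -e mulfK.
    by field; rewrite jB U0 B0.
  by rewrite divr_gt0 // mulr_gt0 // ltcR.
set X := A * D / (B * U) in X0 *.
move=> _; have : 0 < X * (B * B^*) / (D * D^*) by rewrite divr_gt0 // mulr_gt0.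
move=> /gt0_realC[e r0]; exists (re (X * (B * B^*) / (D * D^*))); split => //.
rewrite -e /X; field; by rewrite jD D0 U0 B0.
Qed.

Lemma arcP (a b : R * R) (t : R) (z : R * R) :
  Defs.arc a b t z <-> arcC (toC a) (toC b) (expi t) (toC z).
Proof.
have u0 := expi_neq0 t.
have key : z <> a -> z <> b -> a <> b -> (exists r : R, 0 < r /\
  pmulconj (psub z a) (psub b z) = pscale r (pmulconj (pdir t) (psub b a))) <->
  0 < (toC z - toC a) * (toC b - toC a) / ((toC b - toC z) * expi t).
  move=> za zb ab; rewrite -pos_quotP //; last first.
  - by rewrite subr_eq0; apply/eqP => /toC_inj /esym.
  - by rewrite subr_eq0; apply/eqP => /toC_inj /esym.
  - by rewrite subr_eq0; apply/eqP => /toC_inj.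
  by split=> -[r [r0 e]]; exists r; split => //;
    [rewrite -!toC_psub -toC_pmulconj e toC_pscale toC_pmulconj
    |apply: toC_inj; rewrite toC_pscale !toC_pmulconj].
have [za|za] := pselect (z = a); first by rewrite /arcC za eqxx; split=> // _; left.
have [zb|zb] := pselect (z = b).
  by rewrite /arcC zb eqxx orbT; split=> // _; right; left.
have e1 : (toC z == toC a) = false by apply/eqP => /toC_inj.
have e2 : (toC z == toC b) = false by apply/eqP => /toC_inj.
rewrite /arcC e1 e2 /=.
have [ab|ab] := pselect (a = b); last first.
  rewrite -key //; split=> [[//|[//|[_ [_ //]]]]|h].
  by right; right.
(* Coinciding endpoints: the right side of the inscribed-angle equation vanishes, the left side does
   not. *)
rewrite -ab subrr mulr0 mul0r ltxx; split=> // -[//|[//|[_ [_ [r [r0 e]]]]]].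
move/(congr1 toC): e; rewrite toC_pscale !toC_pmulconj !toC_psub subrr.
rewrite rmorph0 !mulr0 => /eqP; rewrite mulf_eq0 conjc_eq0 !subr_eq0 e1 /=.
by rewrite eq_sym e1.
Qed.

(** Excludes the tangent pointing straight away from b, for which [arcC] would be the part of the
    line through infinity. *)
Definition goodC (a b u : C) : bool := ~~ (u / (b - a) <= 0).

Lemma good_dirP (a b : R * R) (t : R) : a <> b ->
  goodC (toC a) (toC b) (expi t) -> good_dir a b t.
Proof.
move=> ab g; rewrite /good_dir => -[h1 h2]; move/negP: g; apply.
set X := pmulconj _ _ in h1 h2.
have D0 : toC b - toC a != 0 by rewrite subr_eq0; apply/eqP => /toC_inj /esym.
have jD : (toC b - toC a)^* != 0 by rewrite conjc_eq0.
have -> : expi t / (toC b - toC a) = toC X / ((toC b - toC a) * (toC b - toC a)^*).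
  by rewrite /X toC_pmulconj toC_psub -[toC (pdir t)]/(expi t); field; rewrite -rmorphB D0 jD.
rewrite pmulr_lle0 ?invr_gt0 ?mulcJ_gt0 //.
by rewrite lecE; apply/andP; split; [apply/eqP; exact: esym h1|exact: h2].
Qed.

End ComplexBasics.

Ltac nz := repeat (apply/andP; split); try done; rewrite ?oppr_eq0 ?subr_eq0 //;
  try (by rewrite eq_sym).

(** * Arcs under inversion and Moebius maps *)

Section Arcs.
Variable R : realType.
Local Notation C := R[i].
Local Notation re := (@complex.Re R).
Local Notation im := (@complex.Im R).

Definition nrm (z : C) : R := Num.sqrt (re z ^+ 2 + im z ^+ 2).

Lemma normE (z : C) : `|z| = (nrm z)%:C. Proof. by case: z. Qed.

Lemma nrm_ge0 z : 0 <= nrm z. Proof. exact: sqrtr_ge0. Qed.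
Lemma nrmM a b : nrm (a * b) = nrm a * nrm b.
Proof. by apply: (@complexI R); rewrite rmorphM /= -!normE normrM. Qed.
Lemma nrmN a : nrm (- a) = nrm a.
Proof. by apply: (@complexI R); rewrite -!normE normrN. Qed.
Lemma nrmV a : nrm a^-1 = (nrm a)^-1.
Proof. by apply: (@complexI R); rewrite fmorphV /= -!normE normfV. Qed.
Lemma nrmD a b : nrm (a + b) <= nrm a + nrm b.
Proof. by rewrite -lecR rmorphD /= -!normE ler_normD. Qed.
Lemma nrm_dist a b : nrm (a - b) = nrm (b - a).
Proof. by rewrite -nrmN opprB. Qed.
Lemma nrm_sub a b : nrm a - nrm b <= nrm (a - b).
Proof. by have := nrmD (a - b) b; rewrite subrK; lra. Qed.
Lemma nrm_eq0 a : (nrm a == 0) = (a == 0).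
Proof. by rewrite -(inj_eq (@complexI R)) -normE normr_eq0. Qed.
Lemma nrm_gt0 a : (0 < nrm a) = (a != 0).
Proof. by rewrite lt0r nrm_ge0 andbT nrm_eq0. Qed.
Lemma nrm0 : nrm 0 = 0. Proof. by apply/eqP; rewrite nrm_eq0. Qed.
Lemma nrm_expi t : nrm (expi t) = 1.
Proof. by apply: (@complexI R); rewrite -normE norm_expi. Qed.
Lemma nrm_real (r : R) : nrm r%:C = `|r|.
Proof. by apply: (@complexI R); rewrite -normE norm_realC. Qed.
Lemma re_nrm a : `|re a| <= nrm a.
Proof. by rewrite -sqrtr_sqr ler_wsqrtr // lerDl sqr_ge0. Qed.
Lemma im_nrm a : `|im a| <= nrm a.
Proof. by rewrite -sqrtr_sqr ler_wsqrtr // lerDr sqr_ge0. Qed.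
Lemma nrm_le a : nrm a <= `|re a| + `|im a|.
Proof.
rewrite -[leRHS]ger0_norm ?addr_ge0 // -sqrtr_sqr ler_wsqrtr //.
rewrite -(real_normK (num_real (re a))) -(real_normK (num_real (im a))).
by have := mulr_ge0 (normr_ge0 (re a)) (normr_ge0 (im a)); lra.
Qed.

Lemma dist_nonneg (w : C) : ~~ (0 <= w) ->
  exists2 d : R, 0 < d & forall s : R, 0 <= s -> d <= nrm (w - s%:C).
Proof.
move=> hw; have [i0|i0] := eqVneq (im w) 0; last first.
  exists `|im w|; first by rewrite normr_gt0.
  by move=> s _; apply: le_trans (im_nrm _); rewrite imB subr0.
have rw : re w < 0.
  by rewrite ltNge; apply: contra hw => h; rewrite lecE /= i0 eqxx.
exists (- re w); first by lra.
move=> s s0; apply: le_trans (re_nrm _); rewrite reB /= ler0_norm; lra.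
Qed.

Variables (a b u : C).
Hypothesis (ab : a != b) (u0 : u != 0).

Let ba0 : b - a != 0. Proof. by rewrite subr_eq0 eq_sym. Qed.

Lemma arcC_left : arcC a b u a. Proof. by rewrite /arcC eqxx. Qed.
Lemma arcC_right : arcC a b u b. Proof. by rewrite /arcC eqxx orbT. Qed.

Lemma arcC_scale (k z : C) : 0 < k -> arcC a b (k * u) z = arcC a b u z.
Proof.
move=> k0; rewrite /arcC; congr [|| _, _ | _].
have kn : k != 0 by rewrite gt_eqF.
have [->|zb] := eqVneq z b; first by rewrite subrr !mul0r.
rewrite mulrCA invfM (mulrCA _ k^-1) pmulr_rgt0 ?invr_gt0 //.
Qed.

(** The hypothesis says arg u + arg v = 2 arg (b - a) + pi modulo 2 pi: the tangents at the two ends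
    of a circular arc are mirror images in the perpendicular bisector of its chord. *)
Lemma arcC_sym (v z : C) : v != 0 -> 0 < - ((b - a) ^+ 2 / (u * v)) ->
  arcC a b u z -> arcC b a v z.
Proof.
move=> v0 h; rewrite /arcC => /or3P[->|->|h2]; rewrite ?orbT //.
apply/or3P; apply: Or33.
have zb : z != b.
  by apply/eqP => e; move: h2; rewrite e subrr mul0r invr0 mulr0 ltxx.
have za : z != a.
  by apply/eqP => e; move: h2; rewrite e subrr !mul0r ltxx.
rewrite -(pmulr_rgt0 _ h2); congr (0 < _) : h.
by field; nz.
Qed.

(* Inversion at an endpoint turns the arc into a ray. *)
Lemma arcC_invP (z : C) : z != a -> arcC a b u z <->
  exists2 s : R, 0 <= s & (z - a)^-1 = (b - a)^-1 + s%:C / u.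
Proof.
move=> za; have za0 : z - a != 0 by rewrite subr_eq0.
split; rewrite /arcC (negPf za) /=.
  case/orP=> [/eqP->|X0]; first by exists 0 => //; rewrite mul0r addr0.
  have /gt0_realC[e r0] : 0 < ((z - a) * (b - a) / ((b - z) * u))^-1.
    by rewrite invr_gt0.
  have zb : b - z != 0.
    by apply/eqP => e2; move: X0; rewrite e2 mul0r invr0 mulr0 ltxx.
  exists (re ((z - a) * (b - a) / ((b - z) * u))^-1); first exact: ltW.
  by rewrite -e; field; rewrite zb u0 za0 ba0.
move=> [s s0 e]; have [//|zb /=] := eqVneq z b.
have zb0 : b - z != 0 by rewrite subr_eq0 eq_sym.
have es : s%:C = u * (b - z) / ((z - a) * (b - a)).
  have -> : s%:C = u * ((z - a)^-1 - (b - a)^-1).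
    by rewrite e (addrC _^-1) addrK mulrC divfK.
  by field; rewrite ba0 za0.
have sn : s%:C != 0 :> C.
  by rewrite es mulf_neq0 ?invr_neq0 ?mulf_neq0.
have -> : (z - a) * (b - a) / ((b - z) * u) = (s%:C)^-1.
  by rewrite es; field; rewrite u0 za0 zb0 ba0.
by rewrite invr_gt0 ltcR lt0r s0 andbT -realC_neq0.
Qed.

Lemma arcC_translate (p z : C) : arcC (p + a) (p + b) u (p + z) = arcC a b u z.
Proof.
have e x y : (p + x) - (p + y) = x - y by ring.
by rewrite /arcC !(inj_eq (addrI p)) !e.
Qed.

(** The quotient in [arcC] is a cross-ratio two of whose points have merged at a along u, hence
    Moebius invariant. The factor [- c / (a - o) ^+ 2] is the derivative of w |-> c / (w - o) at
    a. *)
Lemma arcC_mobius (c o z : C) : c != 0 -> a != o -> b != o -> z != o ->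
  arcC (c / (a - o)) (c / (b - o)) (- c / (a - o) ^+ 2 * u) (c / (z - o))
  = arcC a b u z.
Proof.
rewrite -(subr_eq0 a) -(subr_eq0 b) -(subr_eq0 z) => c0 ao bo zo.
have inj x : x - o != 0 -> (c / (z - o) == c / (x - o)) = (z == x).
  move=> xo; apply/eqP/eqP => [/(mulfI c0)/invr_inj/addIr //|-> //].
rewrite /arcC !inj //; have [//|za /=] := eqVneq z a.
have [//|zb /=] := eqVneq z b; congr (0 < _).
rewrite -subr_eq0 in za; rewrite eq_sym -subr_eq0 in zb.
field; rewrite u0 zb ao bo zo c0 /=.
have -> : c * (z - o) + - c * (b - o) = - (c * (b - z)) by ring.
by rewrite oppr_eq0 mulf_neq0.
Qed.

(** By [goodC] the ray on which u / (z - a) runs misses 0, so it keeps a distance d from 0, and z -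
    a has length at most |u| / d. *)
Lemma arcC_bounded : goodC a b u -> exists M : R, forall z, arcC a b u z -> nrm z <= M.
Proof.
move=> g; have : ~~ (0 <= - (u / (b - a))) by rewrite oppr_ge0.
case/dist_nonneg => d d0 hd.
have nu : 0 < nrm u by rewrite nrm_gt0.
exists (nrm a + nrm u / d) => z; have [->|za] := eqVneq z a.
  by move=> _; rewrite lerDl divr_ge0 ?nrm_ge0 // ltW.
move=> /arcC_invP - /(_ za) [s s0 e].
have za0 : z - a != 0 by rewrite subr_eq0.
have e1 : u / (z - a) = u / (b - a) + s%:C by rewrite e mulrDr mulrCA divff // mulr1.
have := hd s s0; rewrite -opprD nrmN -e1 nrmM nrmV => h.
have : nrm (z - a) <= nrm u / d.
  rewrite ler_pdivlMr // mulrC -ler_pdivlMr ?nrm_gt0 //.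
by move=> h1; have := nrmD a (z - a); rewrite addrCA subrr addr0; lra.
Qed.

Lemma arcC_away (p : C) : ~~ arcC a b u p ->
  exists2 r : R, 0 < r & forall z, arcC a b u z -> r <= nrm (z - p).
Proof.
move=> hp; have pa : p != a by apply: contraNN hp => /eqP ->; exact: arcC_left.
have pa0 : p - a != 0 by rewrite subr_eq0.
have : ~~ (0 <= u / (p - a) - u / (b - a)).
  apply: contraNN hp => h; apply/arcC_invP => //.
  exists (re (u / (p - a) - u / (b - a))); first by move: h; rewrite lecE => /andP[].
  have {1}-> : (re (u / (p - a) - u / (b - a)))%:C = u / (p - a) - u / (b - a).
    by apply: complex_eq => //=; move: h; rewrite lecE => /andP[/eqP ->].
  by field; rewrite u0 pa0 ba0.
case/dist_nonneg => d d0 hd.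
have [nu np] : 0 < nrm u /\ 0 < nrm (p - a) by rewrite !nrm_gt0.
pose D := nrm (p - a).
(* [D / 2] keeps z away from the pole a. The second bound carries d, the distance from u / (p - a)
   to the ray, back through u (z - p) / ((z - a) (p - a)). *)
exists (Num.min (D / 2) (d * D ^+ 2 / (2 * nrm u))).
  by rewrite lt_min divr_gt0 //= divr_gt0 // mulr_gt0 // exprn_gt0.
move=> z hz; rewrite leNgt lt_min; apply/negP => /andP[z1 z2].
have h1 : D / 2 <= nrm (z - a).
  have := nrm_sub (p - a) (p - z); rewrite (nrm_dist p z) -/D.
  by have -> : p - a - (p - z) = z - a by [ring]; lra.
have za : z != a by apply: contraTneq h1 => ->; rewrite subrr nrm0 -ltNge divr_gt0.
have za0 : z - a != 0 by rewrite subr_eq0.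
case/arcC_invP: hz => // s s0 e.
have := hd s s0.
have -> : u / (p - a) - u / (b - a) - s%:C = u * (z - p) / ((z - a) * (p - a)).
  have -> : s%:C = u * ((z - a)^-1 - (b - a)^-1).
    by rewrite e (addrC _^-1) addrK mulrC divfK.
  by field; rewrite za0 pa0 ba0.
rewrite !(nrmM, nrmV) -/D ler_pdivlMr ?mulr_gt0 ?nrm_gt0 //.
move: z2; rewrite ltr_pdivlMr ?mulr_gt0 // => z2 h2.
have : d * (D / 2 * D) <= d * (nrm (z - a) * D).
  by rewrite ler_pM2l // ler_pM2r.
by rewrite expr2 in z2; lra.
Qed.

End Arcs.

Section ThinCone.
Variable R : realType.
Local Notation C := R[i].
Local Notation re := (@complex.Re R).
Local Notation im := (@complex.Im R).

(** In the coordinate w = e^(it) / (z - a) the arc is a horizontal ray to the right; z near a means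
    w far out on it, where the argument of w is small. *)
Lemma arcC_thin_cone (a b : C) (t h : R) : a != b -> 0 < h <= pi ->
  exists2 rho : R, 0 < rho & forall z, arcC a b (expi t) z -> z != a ->
    nrm (z - a) < rho ->
    exists r phi : R, [/\ 0 < r, - h < phi < h & z = a + r%:C * expi (t + phi)].
Proof.
move=> ab /andP[h0 hpi]; pose k := h / 2; pose g : C := expi t / (b - a).
have pi0 := pi_gt0 R.
have sk : 0 < sin k by apply: sin_gt0_pi; rewrite /k; lra.
(* The summand 2 |g| excludes negative real parts of w, and |g| / sin k makes the real part dominate
   the imaginary part, which is at most |g|. *)
pose N := nrm g * 2 + nrm g / sin k + 1.
have g0 := nrm_ge0 g.
have gs0 : 0 <= nrm g / sin k by rewrite divr_ge0 // ltW.
have N0 : 0 < N by rewrite /N; lra.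
exists N^-1 => [|z hz za hn]; first by rewrite invr_gt0.
have za0 : z - a != 0 by rewrite subr_eq0.
have u0 : expi t != 0 by exact: expi_neq0.
case/(arcC_invP ab u0 za): hz => s s0 e.
pose w : C := expi t / (z - a).
have wE : w = g + s%:C by rewrite /w /g e mulrDr mulrCA divff // mulr1.
have nw : N < nrm w.
  rewrite nrmM nrm_expi mul1r nrmV -(invrK N) ltf_pV2 ?posrE ?nrm_gt0 //.
  by rewrite invr_gt0.
have iw : `|im w| <= nrm g by rewrite wE imD /= addr0 im_nrm.
have rw : - nrm g <= re w.
  by have := re_nrm g; rewrite wE reD /= ler_norml; lra.
have nle := nrm_le w.
have rw1 : nrm g / sin k <= re w.
  have := nle; have [r1|r1] := ger0P (re w); rewrite /N in nw; lra.
have rw0 : 0 < re w.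
  have := nle; have [r1|r1] := ger0P (re w); rewrite /N in nw; lra.
have [||r [phi [r0 hphi ep]]] := @upper_polarP R (- im w) (re w) k rw0.
- by rewrite /k; lra.
- rewrite normrN; apply: (@le_trans _ _ (nrm g)); last by rewrite -ler_pdivrMr.
  apply: le_trans iw; rewrite -[leRHS]mulr1 ler_wpM2l // cos_le1 //.
have ew : w = r%:C * expi phi.
  apply: (mulIf (expi_neq0 (pi / 2))).
  rewrite -[RHS]mulrA -expiD (addrC phi) -ep.
  by apply: complex_eq; rewrite ?reimE /= cos_pihalf sin_pihalf; ring.
exists r^-1, (- phi); split; [by rewrite invr_gt0|rewrite /k in hphi; lra|].
have w0 : w != 0 by rewrite ew mulf_neq0 ?expi_neq0 // realC_neq0 gt_eqF.
have -> : z = a + expi t / w by rewrite /w; field; rewrite u0 za0.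
congr (_ + _); rewrite expiB ew fmorphV /= invfM mulrCA mulrA //.
Qed.
End ThinCone.

(** * Connections to infinity in the complement of a curve *)

Section Escape.
Variable R : realType.
Local Notation C := R[i].
Local Notation re := (@complex.Re R).
Local Notation im := (@complex.Im R).
Local Open Scope classical_set_scope.

(** A connected unbounded set in place of a path: this is the condition in [faces_natural], and it
    is extended backwards along a path by a union. *)
Definition escapes (X : C -> Prop) (z : C) : Prop :=
  exists K : set (R * R), [/\ K (ofC z), forall q, K q -> ~ X (toC q),
    connected K & unbounded_set K].

Definition ccont (g : R -> C) : Prop :=
  continuous (fun s => re (g s)) /\ continuous (fun s => im (g s)).

Lemma ccont_image_connected (g : R -> C) (A : set R) : ccont g -> is_interval A ->
  connected [set ofC (g s) | s in A].
Proof.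
move=> [c1 c2] hA; apply: connected_continuous_connected.
  by apply/connected_intervalP.
apply: continuous_subspaceT => s.
exact: (@cvg_pair _ _ _ _ _ _ _ _ _ _ _ (c1 s) (c2 s)).
Qed.

Lemma escapes_path (X : C -> Prop) (g : R -> C) (a b s0 s1 : R) :
  ccont g -> a <= s0 <= b -> a <= s1 <= b ->
  (forall s, a <= s <= b -> ~ X (g s)) -> escapes X (g s1) -> escapes X (g s0).
Proof.
move=> cg h0 h1 av [K [K1 K2 K3 K4]].
exists ([set ofC (g s) | s in `[a, b]] `|` K); split.
- by left; exists s0 => //=; rewrite in_itv.
- move=> q [[s /=]|]; last exact: K2.
  by rewrite in_itv /= => hs <-; rewrite ofCK; exact: av.
- apply: connectedU => //.
    by exists (ofC (g s1)); split => //; exists s1 => //=; rewrite in_itv.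
  apply: ccont_image_connected => //; exact: interval_is_interval.
- by move=> M; have [q [q1 q2]] := K4 M; exists q; split => //; right.
Qed.

Lemma ccont_affine (z d : C) : ccont (fun s => z + s%:C * d).
Proof.
split=> s.
  have -> : (fun s => re (z + s%:C * d)) = (fun s => re z + s * re d).
    by apply/funext => x; rewrite !reimE /=; ring.
  apply: cvgD; first exact: cvg_cst.
  by apply: cvgM; [exact: cvg_id|exact: cvg_cst].
have -> : (fun s => im (z + s%:C * d)) = (fun s => im z + s * im d).
  by apply/funext => x; rewrite !reimE /=; ring.
apply: cvgD; first exact: cvg_cst.
by apply: cvgM; [exact: cvg_id|exact: cvg_cst].
Qed.

Lemma ccont_circle (z w : C) : ccont (fun s => z + w * expi s).
Proof.
split=> s.
  have -> : (fun s => re (z + w * expi s)) = (fun s => re z + (re w * cos s - im w * sin s)).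
    by apply/funext => x; rewrite !reimE /=.
  apply: cvgD; first exact: cvg_cst.
  by apply: cvgB; (apply: cvgM; [exact: cvg_cst|]); [exact: continuous_cos|exact: continuous_sin].
have -> : (fun s => im (z + w * expi s)) = (fun s => im z + (re w * sin s + im w * cos s)).
  by apply/funext => x; rewrite !reimE /=.
apply: cvgD; first exact: cvg_cst.
by apply: cvgD; (apply: cvgM; [exact: cvg_cst|]); [exact: continuous_sin|exact: continuous_cos].
Qed.

(** The Moebius image of a vertical line that misses the pole; it is the way out from a cycle vertex
    other than the root. *)
Lemma ccont_inv_line (z c : C) (x : R) : x != 0 -> ccont (fun s => z + c / (x +i* s)).
Proof.
move=> x0.
have n0 s : x ^+ 2 + s ^+ 2 != 0.
  by rewrite paddr_eq0 ?sqr_ge0 // !sqrf_eq0 (negPf x0).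
have nc (s : R) : {for s, continuous (fun y : R => (x ^+ 2 + y ^+ 2)^-1 : R)}.
  apply: cvgV => //; apply: cvgD; first exact: cvg_cst.
  by apply: cvgM; exact: cvg_id.
split=> s.
  have -> : (fun s => re (z + c / (x +i* s))) =
    (fun s => re z + (re c * x + im c * s) * (x ^+ 2 + s ^+ 2)^-1).
    by apply/funext => t; rewrite !reimE /=; field; rewrite n0.
  apply: cvgD; first exact: cvg_cst.
  apply: cvgM; last exact: nc.
  by apply: cvgD; [exact: cvg_cst|apply: cvgM; [exact: cvg_cst|exact: cvg_id]].
have -> : (fun s => im (z + c / (x +i* s))) =
    (fun s => im z + (im c * x - re c * s) * (x ^+ 2 + s ^+ 2)^-1).
  by apply/funext => t; rewrite !reimE /=; field; rewrite n0.
apply: cvgD; first exact: cvg_cst.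
apply: cvgM; last exact: nc.
by apply: cvgB; [exact: cvg_cst|apply: cvgM; [exact: cvg_cst|exact: cvg_id]].
Qed.

Lemma escapes_ray (X : C -> Prop) (z d : C) : d != 0 ->
  (forall s : R, 0 <= s -> ~ X (z + s%:C * d)) -> escapes X z.
Proof.
move=> d0 av; exists [set ofC (z + s%:C * d) | s in `[0, +oo[]; split.
- by exists 0; rewrite /= ?in_itv /= ?lexx // mul0r addr0.
- by move=> q [s /=]; rewrite in_itv /= andbT => hs <-; rewrite ofCK; exact: av.
- apply: ccont_image_connected; first exact: ccont_affine.
  exact: interval_is_interval.
- move=> M; have nd : 0 < nrm d by rewrite nrm_gt0.
  pose s := (2 * `|M| + nrm z + 1) / nrm d.
  have s0 : 0 <= s.
    by rewrite divr_ge0 ?nrm_ge0 // !addr_ge0 ?mulr_ge0 ?nrm_ge0 ?normr_ge0.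
  exists (ofC (z + s%:C * d)); split.
    by exists s => //=; rewrite in_itv /= s0.
  have h1 : 2 * `|M| + 1 <= nrm (z + s%:C * d).
    have := nrm_sub (s%:C * d) (- z); rewrite opprK addrC nrmN nrmM nrm_real.
    rewrite ger0_norm // /s divfK ?gt_eqF // (addrC _ z); lra.
  have h2 := nrm_le (z + s%:C * d); have h3 := ler_norm M.
  rewrite /ofC /= lt_max; apply/orP.
  have [h|h] := ltP M `|re (z + s%:C * d)|; first by left.
  by right; lra.
Qed.

Lemma escapes_sub (X Y : C -> Prop) (z : C) : (forall q, Y q -> X q) ->
  escapes X z -> escapes Y z.
Proof.
by move=> h [K [K1 K2 K3 K4]]; exists K; split => // q /K2 n /h.
Qed.

End Escape.

(** * Rotation systems and tangent directions *)

Section Rotation.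
Variables (R : realType) (V : finType) (adj : rel V) (rt : V -> V -> V).
Hypothesis (rsys : rotation_system adj rt).
Local Notation C := R[i].
Local Notation D := (deg adj).

Lemma rt_adj v w : adj v w -> adj v (rt v w).
Proof. by have [h _] := rsys v; exact: h. Qed.

Lemma iter_rt_adj v w k : adj v w -> adj v (iter k (rt v) w).
Proof. by move=> h; elim: k => //= k; exact: rt_adj. Qed.

Lemma rt_order v w : adj v w -> order (rt v) w = D v.
Proof.
move=> vw; rewrite /order /deg cardsE; apply: eq_card => x.
rewrite [LHS]unfold_in [RHS]unfold_in.
apply/idP/idP => [/iter_findex <-|vx]; first exact: iter_rt_adj.
have [_ [_ h]] := rsys v; have [k <-] := h _ _ vw vx; exact: fconnect_iter.
Qed.

Lemma deg_gt0 v w : adj v w -> (0 < D v)%N.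
Proof. by move=> /rt_order <-; exact: order_gt0. Qed.

Lemma rt_reach v w x : adj v w -> adj v x ->
  exists2 k, (k < D v)%N & iter k (rt v) w = x.
Proof.
move=> vw vx; have [_ [_ h]] := rsys v; have [k e] := h _ _ vw vx.
have c : fconnect (rt v) w x by rewrite -e fconnect_iter.
by exists (findex (rt v) w x); [rewrite -(rt_order vw) findex_max|rewrite iter_findex].
Qed.

Lemma rt_iter_deg v w : adj v w -> iter (D v) (rt v) w = w.
Proof.
move=> vw; rewrite -(rt_order vw).
have [h1 [h2 _]] := rsys v.
by apply: (@iter_order_in _ (rt v) [pred x | adj v x]).
Qed.

(** An arbitrary neighbour from which the others are counted; v itself only if there is none. *)
Definition ref_nbr (v : V) : V := odflt v [pick w | adj v w].

Lemma ref_nbr_adj v w : adj v w -> adj v (ref_nbr v).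
Proof. by rewrite /ref_nbr; case: pickP => [x //|-> //]. Qed.

Definition rt_idx (v w : V) : nat := findex (rt v) (ref_nbr v) w.

Definition theta (v : V) : R := 2 * pi / (D v)%:R.

Definition ang (B : V -> R) (v w : V) : R := B v + (rt_idx v w)%:R * theta v.
Definition dirn (B : V -> R) (v w : V) : C := expi (ang B v w).

Lemma theta_deg v w : adj v w -> (D v)%:R * theta v = 2 * pi.
Proof.
by move=> vw; rewrite /theta mulrCA divff ?mulr1 // pnatr_eq0 -lt0n (deg_gt0 vw).
Qed.

Lemma theta_gt0 v w : adj v w -> 0 < theta v.
Proof. by move=> /deg_gt0 h; rewrite divr_gt0 ?mulr_gt0 ?pi_gt0 // ltr0n. Qed.

Lemma dirn_rt B v w : adj v w -> dirn B v (rt v w) = dirn B v w * expi (theta v).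
Proof.
move=> vw; have vr := ref_nbr_adj vw.
have [i hi e] := rt_reach vr vw.
have hw : rt_idx v w = i.
  by rewrite /rt_idx -e findex_iter // rt_order.
rewrite /dirn /ang -expiD hw; have [h|h] := ltnP i.+1 (D v).
  have -> : rt_idx v (rt v w) = i.+1.
    by rewrite /rt_idx -e -iterS findex_iter // rt_order.
  by congr expi; rewrite -addrA -[i.+1]addn1 natrD mulrDl mul1r.
(* At the last neighbour the index falls back to 0, which deg * theta = 2 pi compensates. *)
have ei : i.+1 = D v by apply/eqP; rewrite eqn_leq hi h.
have -> : rt_idx v (rt v w) = 0%N.
  by rewrite /rt_idx -e -iterS ei rt_iter_deg // findex0.
rewrite mul0r addr0 -[LHS]expiD2pi -(theta_deg vw) -ei.
by congr expi; rewrite -addrA -[i.+1]addn1 natrD mulrDl mul1r.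
Qed.

Lemma dirn_iter B v w k : adj v w ->
  dirn B v (iter k (rt v) w) = dirn B v w * expi (k%:R * theta v).
Proof.
move=> vw; elim: k => [|k IH] /=; first by rewrite mul0r expi0 mulr1.
rewrite dirn_rt ?iter_rt_adj // IH -mulrA -expiD; congr (_ * expi _).
by rewrite -[k.+1]addn1 natrD mulrDl mul1r.
Qed.

Lemma lombardi_ang B : lombardi_for adj rt (ang B).
Proof.
move=> v w vw /=.
have : expi (ang B v (rt v w)) = expi (ang B v w + 2 * pi / (D v)%:R).
  by rewrite expiD; exact: dirn_rt.
by case.
Qed.
End Rotation.

(** * Partial drawings and gluing at a cut vertex *)

Section Drawing.
Variables (R : realType) (V : finType) (adj : rel V) (rt : V -> V -> V).
Hypothesis (sg : simple_graph adj) (rsys : rotation_system adj rt).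
Local Notation C := R[i].
Local Notation D := (deg adj).
Local Notation th := (theta R adj).
Implicit Types (P : V -> C) (B : V -> R) (S N : {set V}) (s : seq V).
Local Notation dirn := (dirn adj rt).

Definition edgeC P B (x y : V) (z : C) : bool := arcC (P x) (P y) (dirn B x y) z.

Definition ptsC P B S (z : C) : Prop :=
  (exists x y, [/\ x \in S, y \in S, adj x y & edgeC P B x y z]) \/
  (exists2 x, x \in S & z = P x).

Definition curveC P B s (z : C) : Prop := exists2 x, x \in s & edgeC P B x (next s x) z.

Definition ccw s : Prop := forall x, x \in s -> rt x (next s x) = prev s x.

(* [cs] lists the counterclockwise cycles drawn so far.  [dk_sec] is what allows later blocks to be
   attached at a cycle vertex: some points arbitrarily close to it, in the outer sector and a quarter
   of the angular gap away from the two cycle edges, are connected to infinity off the cycle. *)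
Record drawok P B S (cs : seq (seq V)) : Prop := Drawok {
  dk_inj : {in S &, injective P};
  dk_good : forall x y, x \in S -> y \in S -> adj x y ->
    goodC (P x) (P y) (dirn B x y);
  dk_sym : forall x y, x \in S -> y \in S -> adj x y ->
    forall z, edgeC P B x y z -> edgeC P B y x z;
  dk_pl : forall u v x y z, u \in S -> v \in S -> x \in S -> y \in S ->
    adj u v -> adj x y -> edgeC P B u v z -> edgeC P B x y z ->
    [set u; v] = [set x; y] \/
    exists2 w, w \in [set u; v] :&: [set x; y] & z = P w;
  dk_vx : forall u v w, u \in S -> v \in S -> w \in S -> adj u v ->
    edgeC P B u v (P w) -> w = u \/ w = v;
  dk_cyc : forall s, s \in cs -> [/\ is_cycle adj s, {subset s <= S} & ccw s];
  dk_out : forall s z, s \in cs -> ptsC P B S z -> ~ curveC P B s z ->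
    escapes (curveC P B s) z;
  dk_sec : forall s x (rho : R), s \in cs -> x \in s -> (2 < D x)%N -> 0 < rho ->
    exists r psi : R, [/\ 0 < r < rho, 5 / 4 * th x <= psi <= 2 * pi - th x / 4 &
      escapes (curveC P B s) (P x + r%:C * (dirn B x (next s x) * expi psi))]
}.

Lemma adjC x y : adj x y = adj y x. Proof. by case: sg. Qed.
Lemma adj_neq x y : adj x y -> x != y.
Proof. by move=> h; apply: contraTneq h => ->; case: sg. Qed.

Lemma cycle_adj_next s x : is_cycle adj s -> x \in s -> adj x (next s x).
Proof. by case/and3P => _ _ c /(next_cycle c). Qed.

Lemma ray_clash (r1 r2 a b : R) : 0 < r1 -> 0 < r2 ->
  r1%:C * expi a = r2%:C * expi b -> b < a < b + 2 * pi -> False.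
Proof.
move=> h1 h2 e; apply: expi_inj_period.
have := congr1 (@nrm R) e; rewrite !nrmM !nrm_expi !nrm_real !gtr0_norm // !mulr1.
move=> er; move: e; rewrite er; apply: mulfI; rewrite realC_neq0 gt_eqF //.
Qed.

Section Glue.
Variables (P : V -> C) (B : V -> R) (S N : {set V}) (cs cs' : seq (seq V)).
(** The block fills the wedge from the direction of w through j further steps of the rotation: j = 0
    for a bridge, j = 1 for a cycle. *)
Variables (v w : V) (rho : R) (j : nat).
Hypothesis (vS : v \in S) (dSN : [disjoint S & N]).
Hypothesis (sep : forall x y, x \in S -> y \in N -> adj x y -> x = v).
Hypothesis (ok1 : drawok P B S cs) (ok2 : drawok P B (v |: N) cs').
Hypothesis (rho0 : 0 < rho).
Hypothesis (loc1 : forall y z, y \in S -> adj v y -> edgeC P B v y z -> z != P v ->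
  nrm (z - P v) < rho -> exists r phi : R, [/\ 0 < r, - (th v / 4) < phi < th v / 4 &
    z = P v + r%:C * (dirn B v y * expi phi)]).
Hypothesis (loc2 : forall x y z, x \in S -> y \in S -> adj x y -> x != v -> y != v ->
  edgeC P B x y z -> rho <= nrm (z - P v)).
Hypothesis (loc3 : forall x, x \in S -> x != v -> rho <= nrm (P x - P v)).
Hypothesis (j1 : (j <= 1)%N) (wN : w \in N) (vw : adj v w).
Hypothesis (rwN : j = 1%N -> rt v w \in N).
Hypothesis (block : forall z, ptsC P B (v |: N) z -> z != P v ->
  exists r phi : R, [/\ 0 < r < rho, - (th v / 4) <= phi <= j%:R * th v + th v / 4 &
    z = P v + r%:C * (dirn B v w * expi phi)]).

Let SN x : x \in S -> x \in N -> False.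
Proof. by move=> xS; apply/negP; rewrite (disjointFr dSN). Qed.

Let vN : v \notin N. Proof. by apply/negP => /(SN vS). Qed.

Let th0 : 0 < th v. Proof. exact: (theta_gt0 R rsys vw). Qed.
Let thD : (D v)%:R * th v = 2 * pi. Proof. exact: (theta_deg R rsys vw). Qed.

Let mul_gap (m n : nat) : (m < n)%N -> m%:R * th v + th v <= n%:R * th v.
Proof. by move=> mn; rewrite -{2}[th v]mul1r -mulrDl natr1 ler_pM2r // ler_nat. Qed.

(** Counted from w, positions 0 to j in the rotation at v belong to the block, so old neighbours
    come strictly later. *)
Let nbr y : y \in S -> adj v y -> exists2 k, (j < k < D v)%N & iter k (rt v) w = y.
Proof.
move=> yS vy; have [k hk e] := rt_reach rsys vw vy; exists k => //.
rewrite hk andbT ltnNge; apply/negP => hj; apply: (SN yS); rewrite -e.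
case: k hk e hj => [//|k] _ _ hj.
have := leq_trans hj j1; rewrite ltnS leqn0 => /eqP k0.
by move: hj; rewrite k0 => hj; apply: rwN; apply/eqP; rewrite eqn_leq j1 hj.
Qed.

(** An old cone reaches theta / 4 around k * theta with j < k < D, so on either side it keeps an
    angle of at least theta / 2 from the wedge of the block. *)
Let clash y (r1 r2 a b : R) : y \in S -> adj v y -> 0 < r1 -> 0 < r2 ->
  - (th v / 4) <= a <= j%:R * th v + th v / 4 ->
  - (th v / 4) < b < th v / 4 ->
  r1%:C * (dirn B v w * expi a) = r2%:C * (dirn B v y * expi b) -> False.
Proof.
move=> yS vy r10 r20 ha hb; have [k hk <-] := nbr yS vy.
rewrite (dirn_iter rsys) // -(mulrA (dirn B v w)) -expiD !(mulrCA _ (dirn B v w)).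
move/(mulfI (expi_neq0 _)) => e'; apply: (ray_clash r20 r10 (esym e')).
case/andP: hk => hk1 hk2; have := mul_gap hk1; have := mul_gap hk2.
by rewrite thD => h1 h2; lra.
Qed.

Let edge_near x y z : x \in S -> y \in S -> adj x y -> edgeC P B x y z ->
  z != P v -> nrm (z - P v) < rho -> exists2 y', y' \in S /\ adj v y' &
  exists r phi : R, [/\ 0 < r, - (th v / 4) < phi < th v / 4 &
    z = P v + r%:C * (dirn B v y' * expi phi)].
Proof.
move=> xS yS xy e zv zr; have [xv|xv] := eqVneq x v.
  by rewrite xv in xy e; exists y => //; exact: (loc1 yS xy e zv zr).
have [yv|yv] := eqVneq y v.
  have e' := dk_sym ok1 xS yS xy e; rewrite yv in xy e'; rewrite adjC in xy.
  by exists x => //; exact: (loc1 xS xy e' zv zr).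
by have := loc2 xS yS xy xv yv e; lra.
Qed.

Let block_near z : ptsC P B (v |: N) z -> z != P v -> nrm (z - P v) < rho.
Proof.
move=> h1 h2; have [r [phi [/andP[r0 r1] _ ->]]] := block h1 h2.
by rewrite addrAC subrr add0r !nrmM !nrm_expi !mulr1 nrm_real gtr0_norm.
Qed.

Let block_off x y z : x \in S -> y \in S -> adj x y -> ptsC P B (v |: N) z ->
  z != P v -> ~ edgeC P B x y z.
Proof.
move=> xS yS xy hz zv e.
have [y' [y'S vy'] [r' [phi' [r'0 h' e']]]] := edge_near xS yS xy e zv (block_near hz zv).
have [r [phi [/andP[r0 r1] h e2]]] := block hz zv.
apply: (clash y'S vy' r0 r'0 h h'); apply: (addrI (P v)); by rewrite -e2.
Qed.

Let edge_cases x y : x \in S :|: N -> y \in S :|: N -> adj x y ->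
  (x \in S /\ y \in S) \/ (x \in v |: N /\ y \in v |: N).
Proof.
rewrite !inE => /orP[xS|xN] /orP[yS|yN] xy; [by left| | |].
- by right; rewrite (sep xS yN xy) eqxx yN orbT.
- by right; rewrite adjC in xy; rewrite (sep yS xN xy) eqxx xN orbT.
- by right; rewrite xN yN !orbT.
Qed.

Let pts_edge x y z S' : x \in S' -> y \in S' -> adj x y -> edgeC P B x y z -> ptsC P B S' z.
Proof. by move=> *; left; exists x, y. Qed.

Let vvN : v \in v |: N. Proof. by rewrite !inE eqxx. Qed.

Let cross u x a b z : u \in S -> x \in S -> a \in v |: N -> b \in v |: N ->
  adj u x -> adj a b -> edgeC P B u x z -> edgeC P B a b z ->
  z = P v /\ v \in [set u; x] :&: [set a; b].
Proof.
move=> uS xS aN bN ux ab e1 e2; have [ez|zv] := eqVneq z (P v); last first.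
  by have := block_off uS xS ux (pts_edge aN bN ab e2) zv e1.
rewrite ez in e1 e2; split => //; rewrite !inE.
have [h1|h1] := dk_vx ok1 uS xS vS ux e1;
have [h2|h2] := dk_vx ok2 aN bN vvN ab e2; by rewrite -h1 -h2 !eqxx ?orbT.
Qed.

Let PvN x : x \in N -> P x != P v.
Proof.
move=> xN; apply/eqP => /(dk_inj ok2); rewrite !inE eqxx xN orbT => /(_ isT isT) e.
by move: vN; rewrite -e xN.
Qed.

Let pts_vx x : x \in N -> ptsC P B (v |: N) (P x).
Proof. by move=> xN; right; exists x; rewrite // !inE xN orbT. Qed.

Let glue_inj : {in S :|: N &, injective P}.
Proof.
have main x y : x \in S -> y \in N -> P x = P y -> False.
  move=> xS yN e; have h := block_near (pts_vx yN) (PvN yN).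
  have [xv|xv] := eqVneq x v; last by have := loc3 xS xv; rewrite e leNgt h.
  by have := PvN yN; rewrite -e xv eqxx.
move=> x y; rewrite !inE => /orP[xS|xN] /orP[yS|yN] e.
- exact: (dk_inj ok1).
- by case: (main _ _ xS yN e).
- by case: (main _ _ yS xN (esym e)).
- by apply: (dk_inj ok2) => //; rewrite !inE ?xN ?yN orbT.
Qed.

Let glue_vx u x y : u \in S :|: N -> x \in S :|: N -> y \in S :|: N -> adj u x ->
    edgeC P B u x (P y) -> y = u \/ y = x.
Proof.
move=> uS xS yS ux e; have [[{}uS {}xS]|[uN xN]] := edge_cases uS xS ux.
  move: yS; rewrite inE => /orP[yS|yN]; first exact: (dk_vx ok1).
  by have := block_off uS xS ux (pts_vx yN) (PvN yN) e.
have [yN|] := boolP (y \in v |: N); first exact: (dk_vx ok2).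
rewrite !inE negb_or => /andP[yv yN].
move: yS; rewrite inE (negPf yN) orbF => yS.
have h : P y != P v by apply: contra yv => /eqP /(dk_inj ok1) -> //.
by have := le_lt_trans (loc3 yS yv) (block_near (pts_edge uN xN ux e) h); rewrite ltxx.
Qed.

Let glue_pl u u' x y z : u \in S :|: N -> u' \in S :|: N -> x \in S :|: N -> y \in S :|: N ->
    adj u u' -> adj x y -> edgeC P B u u' z -> edgeC P B x y z ->
    [set u; u'] = [set x; y] \/
    exists2 w, w \in [set u; u'] :&: [set x; y] & z = P w.
Proof.
move=> uS u'S xS yS uu xy e1 e2.
have [[{}uS {}u'S]|[{}uS {}u'S]] := edge_cases uS u'S uu;
have [[{}xS {}yS]|[{}xS {}yS]] := edge_cases xS yS xy.
- exact: (dk_pl ok1).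
- by right; exists v; have [] := cross uS u'S xS yS uu xy e1 e2.
- by right; exists v; have [] := cross xS yS uS u'S xy uu e2 e1; rewrite // finset.setIC.
- exact: (dk_pl ok2).
Qed.

Let ptsSN z : ptsC P B (S :|: N) z -> ptsC P B S z \/ ptsC P B (v |: N) z.
Proof.
case=> [[x [y [xS yS xy e]]]|[x]].
  by case: (edge_cases xS yS xy) => -[h1 h2]; [left|right]; apply: pts_edge e.
by rewrite inE => /orP[xS|xN] e; [left|right; rewrite e; exact: pts_vx]; right; exists x.
Qed.

Let cyc_edge s x : s \in cs -> x \in s -> [/\ x \in S, next s x \in S & adj x (next s x)].
Proof.
move=> /(dk_cyc ok1)[c sub _] xs; split; [exact: sub|by apply: sub; rewrite mem_next|].
exact: cycle_adj_next.
Qed.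

Let cyc_edge' s x : s \in cs' -> x \in s ->
  [/\ x \in v |: N, next s x \in v |: N & adj x (next s x)].
Proof.
move=> /(dk_cyc ok2)[c sub _] xs; split; [exact: sub|by apply: sub; rewrite mem_next|].
exact: cycle_adj_next.
Qed.

(** The segment from P v to z stays inside the disc of radius rho, which this cycle avoids, and P v
    itself escapes by the old drawing. *)
Let out_old_off s z : s \in cs -> v \notin s -> ptsC P B (v |: N) z -> z != P v ->
  escapes (curveC P B s) z.
Proof.
move=> hs vs hz zv; have nx x : x \in s -> x != v by move=> xs; apply: contraNneq vs => <-.
have off : ~ curveC P B s (P v).
  case=> x xs e; have [xS nS a] := cyc_edge hs xs.
  case: (dk_vx ok1 xS nS vS a e) => ev; move: vs; rewrite ev ?mem_next xs //.
have := dk_out ok1 hs (or_intror (ex_intro2 _ _ v vS erefl)) off.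
pose g (t : R) : C := P v + t%:C * (z - P v).
have {1}-> : P v = g 0 by rewrite /g mul0r addr0.
have -> : z = g 1 by rewrite /g mul1r addrCA subrr addr0.
apply: (@escapes_path _ _ g 0 1) => //; rewrite ?lexx ?ler01 //.
  exact: ccont_affine.
move=> t /andP[t0 t1] [x xs e]; have [xS nS a] := cyc_edge hs xs.
have := loc2 xS nS a (nx _ xs) _ e; rewrite nx ?mem_next // => /(_ isT).
rewrite addrAC subrr add0r nrmM nrm_real ger0_norm // => h.
have := block_near hz zv; have := nrm_ge0 (z - P v); nra.
Qed.

Let sector_off s (r al : R) : s \in cs -> v \in s -> 0 < r < rho ->
  5 / 4 * th v <= al <= 2 * pi - th v / 4 ->
  ~ curveC P B s (P v + r%:C * (dirn B v (next s v) * expi al)).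
Proof.
move=> hs vs /andP[r0 r1] hal [x xs e].
set q := _ + _ in e; have [xS nS a] := cyc_edge hs xs.
have [vS' avS av] := cyc_edge hs vs.
have [c sub cc] := dk_cyc ok1 hs.
have d0 : dirn B v (next s v) * expi al != 0 by rewrite mulf_neq0 ?expi_neq0.
have qv : q != P v.
  rewrite -subr_eq0 /q addrAC subrr add0r mulf_neq0 // realC_neq0 gt_eqF //.
have qr : nrm (q - P v) < rho.
  by rewrite /q addrAC subrr add0r !nrmM !nrm_expi !mulr1 nrm_real gtr0_norm.
have fin (r' b : R) : 0 < r' -> b < al < b + 2 * pi ->
  q = P v + r'%:C * (dirn B v (next s v) * expi b) -> False.
  move=> r'0 hb; rewrite /q => /addrI; rewrite !(mulrCA _ (dirn _ _ _)).
  by move/(mulfI (expi_neq0 _)) => e'; apply: (ray_clash r0 r'0 e').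
have [xv|xv] := eqVneq x v.
  rewrite xv in e; have [r' [b [r'0 hb eq]]] := loc1 avS av e qv qr.
  by apply: (fin r' b r'0 _ eq); lra.
have [nv|nv] := eqVneq (next s x) v; last by have := loc2 xS nS a xv nv e; lra.
have ex : x = rt v (next s v).
  rewrite (cc _ vs) -nv prev_next //; by case/and3P: c.
have e' := dk_sym ok1 xS nS a e; rewrite nv in e'.
have ax : adj v x by rewrite adjC -nv.
have [r' [b [r'0 hb eq]]] := loc1 xS ax e' qv qr.
apply: (fin r' (th v + b) r'0); first lra.
by rewrite eq ex (dirn_rt rsys) // -mulrA -expiD.
Qed.

Let out_old_on s z : s \in cs -> v \in s -> ptsC P B (v |: N) z -> z != P v ->
  escapes (curveC P B s) z.
Proof.
move=> hs vs hz zv; have [_ aS va] := cyc_edge hs vs.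
have [c sub cc] := dk_cyc ok1 hs.
have [k /andP[jk kD] ek] := nbr aS va.
(* Both cycle neighbours of v are old and have positions k and k + 1 counted from w. Position D is w
   again, so k + 1 < D, and the block lies in the outer sector of the cycle. *)
have kD1 : (k.+1 < D v)%N.
  rewrite ltn_neqAle kD andbT; apply/eqP => e.
  have : rt v (next s v) \in S by rewrite (cc _ vs) sub // mem_prev.
  by rewrite -ek -iterS e (rt_iter_deg rsys) // => /SN; apply.
have D2 : (2 < D v)%N by apply: leq_ltn_trans kD1; rewrite ltnS; exact: leq_ltn_trans (leq0n j) jk.
have [r [phi [hr hphi ez]]] := block hz zv.
have [r1 [psi [hr1 hpsi esc]]] := dk_sec ok1 hs vs D2 rho0.
(* The direction of z, measured from the edge to [next s v] and lifted by a full turn into the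
   window of [dk_sec]. *)
pose al := phi + (2 * pi - k%:R * th v).
have ez' : z = P v + r%:C * (dirn B v (next s v) * expi al).
  rewrite ez -ek (dirn_iter rsys) // -(mulrA (dirn B v w)) -expiD.
  have -> : k%:R * th v + al = phi + 2 * pi by rewrite /al; ring.
  by rewrite expiD2pi.
have h1 := mul_gap jk; have h2 := mul_gap (ltnSn k); have h3 := mul_gap kD1.
rewrite thD in h3; have th1 := th0.
have hal : 5 / 4 * th v <= al <= 2 * pi - th v / 4 by rewrite /al; lra.
rewrite ez'; set d := dirn B v (next s v).
pose g1 (t : R) : C := P v + (r%:C * d) * expi t.
have -> : P v + r%:C * (d * expi al) = g1 al by rewrite /g1 mulrA.
apply: (@escapes_path _ _ g1 _ _ al psi _ hal hpsi).
- exact: ccont_circle.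
- by move=> t ht; rewrite /g1 -mulrA; apply: sector_off.
pose g2 (t : R) : C := P v + t%:C * (d * expi psi).
have -> : g1 psi = g2 r by rewrite /g1 /g2 mulrA.
apply: (@escapes_path _ _ g2 (Num.min r r1) (Num.max r r1) r r1) => //.
- exact: ccont_affine.
- by rewrite ge_min lexx le_max lexx.
- by rewrite ge_min lexx le_max lexx !orbT.
move=> t /andP[t1 t2]; apply: sector_off => //.
move: hr hr1 => /andP[a1 a2] /andP[b1 b2].
rewrite (lt_le_trans _ t1) ?lt_min ?a1 // (le_lt_trans t2) // gt_max a2 //.
Qed.

(** If the ray from z away from P v hit the block, then z, being nearer to P v, would lie in the
    disc of radius rho and so in an old cone, yet in a direction of the wedge of the block. *)
Let out_new s z : s \in cs' -> ptsC P B S z -> z != P v -> escapes (curveC P B s) z.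
Proof.
move=> hs hz zv; apply: (@escapes_ray _ _ _ (z - P v)); first by rewrite subr_eq0.
move=> t t0 [x xs e]; have [xN nN a] := cyc_edge' hs xs.
set q := _ + _ in e.
have eq : q - P v = (1 + t)%:C * (z - P v).
  rewrite /q rmorphD /= mulrDl mul1r; ring.
have t1 : 0 < 1 + t by lra.
have zv0 : z - P v != 0 by rewrite subr_eq0.
have qv : q != P v by rewrite -subr_eq0 eq mulf_neq0 // realC_neq0 gt_eqF.
have hq := pts_edge xN nN a e.
have zr : nrm (z - P v) < rho.
  have := block_near hq qv; rewrite eq nrmM nrm_real gtr0_norm //.
  have := nrm_ge0 (z - P v); nra.
case: hz => [[x1 [y1 [xS yS xy e1]]]|[x1 xS ez]]; last first.
  have x1v : x1 != v by apply: contraNneq zv => <-; rewrite ez.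
  by have := loc3 xS x1v; rewrite -ez; lra.
have [y' [y'S vy'] [r' [phi' [r'0 h' e']]]] := edge_near xS yS xy e1 zv zr.
have [r [phi [/andP[r0 r1] h e2]]] := block hq qv.
apply: (clash (r2 := (1 + t) * r') y'S vy' r0 _ h h'); first by rewrite mulr_gt0.
apply: (addrI (P v)); rewrite -e2 rmorphM /= -mulrA.
have -> : r'%:C * (dirn B v y' * expi phi') = z - P v by rewrite e' addrAC subrr add0r.
by rewrite -eq addrCA subrr addr0.
Qed.

Lemma drawok_glue : drawok P B (S :|: N) (cs ++ cs').
Proof.
split.
- exact: glue_inj.
- move=> x y xS yS xy; have [[h1 h2]|[h1 h2]] := edge_cases xS yS xy.
    exact: (dk_good ok1).
  exact: (dk_good ok2).
- move=> x y xS yS xy; have [[h1 h2]|[h1 h2]] := edge_cases xS yS xy.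
    exact: (dk_sym ok1).
  exact: (dk_sym ok2).
- exact: glue_pl.
- exact: glue_vx.
- move=> s; rewrite mem_cat => /orP[/(dk_cyc ok1)|/(dk_cyc ok2)] [h1 h2 h3]; split => // x /h2.
    by rewrite inE => ->.
  by rewrite !inE => /orP[/eqP -> | ->]; rewrite ?vS ?orbT.
- move=> s z; rewrite mem_cat => /orP[hs|hs] hz off.
    case: (ptsSN hz) => {}hz; first exact: (dk_out ok1).
    have [ez|zv] := eqVneq z (P v).
      by apply: (dk_out ok1) => //; right; exists v.
    have [vs|vs] := boolP (v \in s); first exact: out_old_on.
    exact: out_old_off.
  case: (ptsSN hz) => {}hz; last exact: (dk_out ok2).
  have [ez|zv] := eqVneq z (P v); last exact: out_new.
  by apply: (dk_out ok2) => //; right; exists v.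
- move=> s x r; rewrite mem_cat => /orP[hs|hs]; first exact: (dk_sec ok1).
  exact: (dk_sec ok2).
Qed.

End Glue.
End Drawing.

(** * Isolating a vertex of a drawing *)

Section LocalRadius.
Variables (R : realType) (V : finType) (adj : rel V) (rt : V -> V -> V).
Hypothesis (sg : simple_graph adj) (rsys : rotation_system adj rt).
Local Notation C := R[i].
Local Notation D := (deg adj).
Local Notation th := (theta R adj).
Local Notation dirn := (dirn adj rt).
Local Notation edgeC := (edgeC adj rt).

Lemma uniform_radius (I : finType) (Q : I -> R -> Prop) :
  (forall i r r', 0 < r' <= r -> Q i r -> Q i r') ->
  (forall i, exists2 r, 0 < r & Q i r) ->
  exists2 r : R, 0 < r & forall i, Q i r.
Proof.
move=> mono ex; suff [r r0 h] : exists2 r : R, 0 < r & forall i, i \in enum I -> Q i r.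
  by exists r => // i; apply: h; rewrite mem_enum.
elim: (enum I) => [|i l [r r0 IH]]; first by exists 1.
have [r' r'0 h'] := ex i; exists (Num.min r r'); first by rewrite lt_min r0.
have m0 : 0 < Num.min r r' by rewrite lt_min r0.
move=> k; rewrite inE => /orP[/eqP -> | kl].
  by apply: mono h'; rewrite m0 ge_min lexx orbT.
by apply: mono (IH _ kl); rewrite m0 ge_min lexx.
Qed.

Lemma drawok_local_radius (P : V -> C) (B : V -> R) (S : {set V}) cs v :
  drawok adj rt P B S cs -> v \in S -> exists2 rho : R, 0 < rho &
  [/\ forall y z, y \in S -> adj v y -> edgeC P B v y z -> z != P v ->
        nrm (z - P v) < rho -> exists r phi : R,
        [/\ 0 < r, - (th v / 4) < phi < th v / 4 &
            z = P v + r%:C * (dirn B v y * expi phi)],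
      forall x y z, x \in S -> y \in S -> adj x y -> x != v -> y != v ->
        edgeC P B x y z -> rho <= nrm (z - P v)
    & forall x, x \in S -> x != v -> rho <= nrm (P x - P v)].
Proof.
move=> ok vS.
have Pn x y : x \in S -> y \in S -> adj x y -> P x != P y.
  move=> xS yS xy; apply/eqP => /(dk_inj ok xS yS) e.
  by have := adj_neq sg xy; rewrite e eqxx.
pose Q1 (y : V) (rho : R) := y \in S -> adj v y ->
    forall z, edgeC P B v y z -> z != P v -> nrm (z - P v) < rho ->
    exists r phi : R, [/\ 0 < r, - (th v / 4) < phi < th v / 4 &
            z = P v + r%:C * (dirn B v y * expi phi)].
have [r1 r10 h1] : exists2 r : R, 0 < r & forall y, Q1 y r.
  apply: uniform_radius => [y r r' /andP[_ hr] q yS vy z e zv zr|y].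
    exact: (q yS vy z e zv (lt_le_trans zr hr)).
  rewrite /Q1; have [yS|yS] := boolP (y \in S); last by exists 1.
  have [vy|vy] := boolP (adj v y); last by exists 1.
  have t0 : 0 < th v / 4 <= pi.
    have t0 := theta_gt0 R rsys vy; rewrite divr_gt0 //=.
    have : th v <= (D v)%:R * th v.
      by rewrite ler_peMl ?ler1n ?(deg_gt0 rsys vy) // ltW.
    by rewrite (theta_deg R rsys vy); have := pi_gt0 R; lra.
  have [rho rho0 h] := arcC_thin_cone (ang adj rt B v y) (Pn _ _ vS yS vy) t0.
  exists rho => // _ _ z e zv zr; have [r [phi [r0 hphi ->]]] := h z e zv zr.
  by exists r, phi; rewrite expiD.
pose Q2 (p : V * V) (rho : R) := p.1 \in S -> p.2 \in S ->
    adj p.1 p.2 -> p.1 != v -> p.2 != v -> forall z, edgeC P B p.1 p.2 z ->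
    rho <= nrm (z - P v).
have [r2 r20 h2] : exists2 r : R, 0 < r & forall p, Q2 p r.
  apply: uniform_radius => [p r r' /andP[_ hr] q a1 a2 a3 a4 a5 z e|[x y]].
    exact: (le_trans hr (q a1 a2 a3 a4 a5 z e)).
  rewrite /Q2 /=; have [xS|xS] := boolP (x \in S); last by exists 1.
  have [yS|yS] := boolP (y \in S); last by exists 1.
  have [xy|xy] := boolP (adj x y); last by exists 1.
  have [xv|xv] := eqVneq x v; first by exists 1.
  have [yv|yv] := eqVneq y v; first by exists 1.
  have off : ~~ edgeC P B x y (P v).
    apply/negP => /(dk_vx ok xS yS vS xy) [] e.
      by move: xv; rewrite e eqxx.
    by move: yv; rewrite e eqxx.
  have [r r0 h] := arcC_away (Pn _ _ xS yS xy) (expi_neq0 _) off.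
  by exists r.
pose Q3 (x : V) (rho : R) := x \in S -> x != v -> rho <= nrm (P x - P v).
have [r3 r30 h3] : exists2 r : R, 0 < r & forall x, Q3 x r.
  apply: uniform_radius => [x r r' /andP[_ hr] q a1 a2|x].
    exact: (le_trans hr (q a1 a2)).
  rewrite /Q3; have [xS|xS] := boolP (x \in S); last by exists 1.
  have [xv|xv] := eqVneq x v; first by exists 1.
  exists (nrm (P x - P v)) => //; rewrite nrm_gt0 subr_eq0.
  by apply: contra xv => /eqP /(dk_inj ok xS vS) ->.
exists (Num.min r1 (Num.min r2 r3)); first by rewrite !lt_min r10 r20.
split.
- by move=> y z yS vy e zv; rewrite lt_min => /andP[zr _]; exact: h1.
- move=> x y z xS yS xy xv yv e; rewrite !ge_min.
  by rewrite (h2 (x, y) xS yS xy xv yv z e) orbT.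
- by move=> x xS xv; rewrite !ge_min (h3 x xS xv) !orbT.
Qed.

Lemma ptsC_bounded (P : V -> C) (B : V -> R) (S : {set V}) cs :
  drawok adj rt P B S cs -> exists M : R, forall z, ptsC adj rt P B S z -> nrm z <= M.
Proof.
move=> ok.
(* Bounds are encoded as inverse radii, so that the minimum provided by [uniform_radius] becomes a
   maximum. *)
pose Q (p : V * V) (rho : R) := forall z,
  (p.1 \in S -> p.2 \in S -> adj p.1 p.2 -> edgeC P B p.1 p.2 z -> nrm z <= rho^-1) /\
  (p.1 \in S -> nrm (P p.1) <= rho^-1).
suff [r r0 h] : exists2 r : R, 0 < r & forall p, Q p r.
  exists r^-1 => z [[x [y [xS yS xy e]]]|[x xS ->]].
    by have [h1 _] := h (x, y) z; exact: h1.
  by have [_ h1] := h (x, x) 0; exact: h1.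
apply: uniform_radius => [p s s' /andP[s0 ss] q z|[x y]].
  have [q1 q2] := q z.
  have hi : s^-1 <= s'^-1 by rewrite lef_pV2 ?posrE // (lt_le_trans s0).
  by split=> *; apply: le_trans hi; auto.
- rewrite /Q /=.
  have [M1 hM1] : exists M1 : R, forall z, x \in S -> y \in S -> adj x y ->
      edgeC P B x y z -> nrm z <= M1.
    have [xS|xS] := boolP (x \in S); last by exists 1.
    have [yS|yS] := boolP (y \in S); last by exists 1.
    have [xy|xy] := boolP (adj x y); last by exists 1.
    have nxy : P x != P y.
      by apply/eqP => /(dk_inj ok xS yS) e; have := adj_neq sg xy; rewrite e eqxx.
    have [M hM] := arcC_bounded nxy (expi_neq0 _) (dk_good ok xS yS xy).
    by exists M => z _ _ _; exact: hM.
  pose m := `|M1| + nrm (P x) + 1.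
  have m0 : 0 < m by rewrite /m; have := nrm_ge0 (P x); have := normr_ge0 M1; lra.
  exists m^-1; first by rewrite invr_gt0.
  move=> z; rewrite invrK /m; have n1 := nrm_ge0 (P x); have n2 := ler_norm M1.
  split=> [a1 a2 a3 e|_]; last by have := normr_ge0 M1; lra.
  by have := hM1 z a1 a2 a3 e; lra.
Qed.
End LocalRadius.

(** * Attaching bridges and new components *)

Section Attach.
Variables (R : realType) (V : finType) (adj : rel V) (rt : V -> V -> V).
Hypothesis (sg : simple_graph adj) (rsys : rotation_system adj rt).
Local Notation C := R[i].
Local Notation D := (deg adj).
Local Notation th := (theta R adj).
Local Notation dirn := (dirn adj rt).
Local Notation edgeC := (edgeC adj rt).
Local Notation drawok := (drawok adj rt).
Local Notation ptsC := (ptsC adj rt).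
Local Notation curveC := (curveC adj rt).
Implicit Types (P : V -> C) (B : V -> R) (S N : {set V}).

Lemma edgeC_agree P B P' B' S x y : {in S, P =1 P'} -> {in S, B =1 B'} ->
  x \in S -> y \in S -> edgeC P' B' x y =1 edgeC P B x y.
Proof.
by move=> eP eB xS yS z; rewrite /edgeC /dirn /ang -!eP // -!eB.
Qed.

Lemma drawok_agree P B P' B' S cs : {in S, P =1 P'} -> {in S, B =1 B'} ->
  drawok P B S cs -> drawok P' B' S cs.
Proof.
move=> eP eB ok; have eE := edgeC_agree eP eB.
have eD x y : x \in S -> dirn B' x y = dirn B x y.
  by move=> xS; rewrite /dirn /ang -!eB.
have eC s z : s \in cs -> curveC P' B' s z <-> curveC P B s z.
  case/(dk_cyc ok) => _ sub _.
  by split=> -[x xs e]; exists x => //; move: e; rewrite eE // sub // mem_next.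
split.
- by move=> x y xS yS; rewrite -!eP //; exact: (dk_inj ok).
- by move=> x y xS yS xy; rewrite -!eP // eD //; exact: (dk_good ok).
- by move=> x y xS yS xy z; rewrite !eE //; exact: (dk_sym ok).
- move=> u v x y z uS vS xS yS uv xy; rewrite !eE // => e1 e2.
  have [|[w wi ew]] := dk_pl ok uS vS xS yS uv xy e1 e2; first by left.
  right; exists w => //; rewrite -eP //.
  by move: wi; rewrite !inE => /andP[/orP[]/eqP ->].
- by move=> u v w uS vS wS uv; rewrite -!eP // eE //; exact: (dk_vx ok).
- exact: (dk_cyc ok).
- move=> s z hs hz off; apply: escapes_sub (dk_out ok hs (z := z) _ _).
  + by move=> q /eC; apply.
  + case: hz => [[x [y [xS yS xy e]]]|[x xS ->]].
      by left; exists x, y; rewrite -eE.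
    by right; exists x; rewrite // -eP.
  + by move=> /eC h; apply: off; apply: h.
- move=> s x rho hs xs hD rho0; have [_ sub _] := dk_cyc ok hs.
  have [r [psi [h1 h2 h3]]] := dk_sec ok hs xs hD rho0.
  exists r, psi; split => //; rewrite -eP ?sub // eD ?sub //.
  by apply: escapes_sub h3 => q /eC; apply.
Qed.

(** The order of quantifiers matters: rho depends on the old drawing alone, and the block is scaled
    to it afterwards. The new maps have to agree with the old ones on S only. *)
Lemma drawok_attach P B S cs v : drawok P B S cs -> v \in S ->
  exists2 rho : R, 0 < rho & forall P' B' N cs' w j,
  {in S, P =1 P'} -> {in S, B =1 B'} -> [disjoint S & N] ->
  (forall x y, x \in S -> y \in N -> adj x y -> x = v) ->
  drawok P' B' (v |: N) cs' -> (j <= 1)%N -> w \in N -> adj v w ->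
  (j = 1%N -> rt v w \in N) ->
  (forall z, ptsC P' B' (v |: N) z -> z != P' v ->
    exists r phi : R, [/\ 0 < r < rho, - (th v / 4) <= phi <= j%:R * th v + th v / 4 &
    z = P' v + r%:C * (dirn B' v w * expi phi)]) ->
  drawok P' B' (S :|: N) (cs ++ cs').
Proof.
move=> ok vS; have [rho rho0 [l1 l2 l3]] := drawok_local_radius sg rsys ok vS.
exists rho => // P' B' N cs' w j eP eB dSN sep ok2 j1 wN vw rwN block.
have eE := edgeC_agree eP eB.
apply: (drawok_glue sg rsys vS dSN sep (drawok_agree eP eB ok) ok2 rho0) block => //.
- move=> y z yS vy; rewrite eE // -eP // => e zv zr.
  have [r [phi [r0 h ->]]] := l1 y z yS vy e zv zr.
  by exists r, phi; split => //; rewrite /dirn /ang -eB.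
- by move=> x y z xS yS xy xv yv; rewrite eE // -eP //; exact: l2.
- by move=> x xS xv; rewrite -!eP //; exact: l3.
Qed.

(** Starts a new component. On the real axis beyond a bound for the drawing, w can escape along the
    half-line to the right. *)
Lemma drawok_isolated P B S cs w : drawok P B S cs -> w \notin S ->
  (forall x, x \in S -> ~~ adj x w) -> exists P', drawok P' B (w |: S) cs.
Proof.
move=> ok wS na; have [M hM] := ptsC_bounded sg ok.
pose m := `|M| + 1; pose P' x : C := if x == w then m%:C else P x.
have m0 : 0 < m by rewrite /m; have := normr_ge0 M; lra.
have Mm : M < m by rewrite /m; have := ler_norm M; lra.
have eP : {in S, P =1 P'} by move=> x xS; rewrite /P'; case: eqP xS wS => // -> ->.
have Pw : P' w = m%:C by rewrite /P' eqxx.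
have {}ok := drawok_agree eP (fun _ _ => erefl) ok.
have {}hM z : ptsC P' B S z -> nrm z <= M.
  case=> [[x [y [xS yS xy]]]|[x xS ->]].
    rewrite (edgeC_agree eP (B := B)) // => e; apply: hM; left; exists x, y => //.
  by rewrite -eP //; apply: hM; right; exists x.
have off (s : R) : 0 <= s -> ~ ptsC P' B S (m%:C + s%:C * 1).
  move=> s0 /hM; rewrite mulr1 -rmorphD nrm_real ger0_norm; lra.
have eS x y : x \in w |: S -> y \in w |: S -> adj x y -> x \in S /\ y \in S.
  rewrite !inE => /orP[/eqP -> |xS] /orP[/eqP -> |yS] //.
  - by move=> h; have := adj_neq sg h; rewrite eqxx.
  - by rewrite (adjC sg) (negPf (na _ yS)).
  - by rewrite (negPf (na _ xS)).
have cS s z : s \in cs -> curveC P' B s z -> ptsC P' B S z.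
  move=> /(dk_cyc ok)[c sub _] [x xs e]; left; exists x, (next s x).
  by rewrite !sub ?mem_next // (cycle_adj_next c).
have wP x : x \in S -> P' x != P' w.
  move=> xS; apply/eqP => e; apply: (off 0) => //.
  by rewrite mul0r addr0 -Pw -e; right; exists x.
exists P'; split.
- move=> x y; rewrite !inE => /orP[/eqP -> |xS] /orP[/eqP -> |yS] // e.
  + by have := wP _ yS; rewrite e eqxx.
  + by have := wP _ xS; rewrite e eqxx.
  + exact: (dk_inj ok).
- by move=> x y hx hy xy; have [xS yS] := eS _ _ hx hy xy; exact: (dk_good ok).
- by move=> x y hx hy xy; have [xS yS] := eS _ _ hx hy xy; exact: (dk_sym ok).
- move=> u v x y z hu hv hx hy uv xy.
  have [xS yS] := eS _ _ hx hy xy; have [uS vS] := eS _ _ hu hv uv.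
  exact: (dk_pl ok).
- move=> u v y hu hv hy uv; have [uS vS] := eS _ _ hu hv uv.
  move: hy; rewrite !inE => /orP[/eqP -> e|yS]; last exact: (dk_vx ok).
  case: (off 0) => //; rewrite mul0r addr0 -Pw; left; exists u, v => //.
- by move=> s /(dk_cyc ok)[c sub cc]; split => // x /sub; rewrite !inE => ->; rewrite orbT.
- move=> s z hs hz hoff; case: (pselect (z = P' w)) => [ez|zw].
    apply: (@escapes_ray _ _ _ 1); first exact: oner_neq0.
    by move=> t t0; rewrite ez Pw => /(cS _ _ hs); exact: off.
  apply: (dk_out ok) => //; case: hz => [[x [y [hx hy xy e]]]|[x hx ez]].
    by have [xS yS] := eS _ _ hx hy xy; left; exists x, y.
  right; exists x => //; move: hx; rewrite !inE => /orP[/eqP xw|//].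
  by case: zw; rewrite ez xw.
- exact: (dk_sec ok).
Qed.

Lemma drawok_bridge P B S cs v w : drawok P B S cs -> v \in S -> w \notin S ->
  adj v w -> (forall x, x \in S -> adj x w -> x = v) ->
  exists P' B', drawok P' B' (w |: S) cs.
Proof.
move=> ok vS wS vw sep; have [rho rho0 att] := drawok_attach ok vS.
have [r r0 rr] : exists2 r, 0 < r & r < rho by exists (rho / 2); lra.
have [u eu] : exists u, u = dirn B v w by exists (dirn B v w).
have u0 : u != 0 by rewrite eu; exact: expi_neq0.
have rC0 : r%:C != 0 :> C by rewrite realC_neq0 gt_eqF.
pose P' x : C := if x == w then P v + r%:C * u else P x.
(* The base angle at w is the one that makes the edge back to v leave in the direction opposite to
   u. *)
pose B' x : R := if x == w then ang adj rt B v w + pi - (rt_idx adj rt w v)%:R * th w else B x.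
have eP : {in S, P =1 P'} by move=> x xS; rewrite /P'; case: eqP xS wS => // -> ->.
have eB : {in S, B =1 B'} by move=> x xS; rewrite /B'; case: eqP xS wS => // -> ->.
have Pw : P' w = P v + r%:C * u by rewrite /P' eqxx.
have dv : dirn B' v w = u by rewrite eu /dirn /ang -eB.
have dw : dirn B' w v = - u.
  by rewrite eu /dirn /ang /B' eqxx subrK expiDpi.
have vwn : v == w = false by apply/negbTE; exact: (adj_neq sg vw).
have Pv : P' v = P v by rewrite -eP.
have sb : P' w - P' v = r%:C * u by rewrite Pw Pv addrAC subrr add0r.
have nvw : P' v != P' w by rewrite eq_sym -subr_eq0 sb mulf_neq0.
have eS x y : x \in v |: [set w] -> y \in v |: [set w] -> adj x y ->
    (x = v /\ y = w) \/ (x = w /\ y = v).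
  rewrite !inE => /orP[]/eqP -> /orP[]/eqP -> h; [|by left|by right|].
    by have := adj_neq sg h; rewrite eqxx.
  by have := adj_neq sg h; rewrite eqxx.
have gt1 : 0 < - ((P' w - P' v) ^+ 2 / (u * - u)).
  have -> : - ((P' w - P' v) ^+ 2 / (u * - u)) = (r ^+ 2)%:C.
    by rewrite sb rmorphXn /=; field; rewrite ?oppr_eq0 ?u0.
  by rewrite ltcR exprn_gt0.
have gt2 : 0 < - ((P' v - P' w) ^+ 2 / (- u * u)).
  by rewrite -(opprB (P' w)) sqrrN (mulrC (- u)).
have nu0 : - u != 0 by rewrite oppr_eq0.
exists P', B'; rewrite finset.setUC -[cs]cats0; apply: (att _ _ _ _ w 0%N) => //.
- by rewrite disjoint_sym disjoints1.
- by move=> x y xS; rewrite inE => /eqP ->; exact: sep.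
- split=> //.
  + move=> x y; rewrite !inE => /orP[]/eqP -> /orP[]/eqP -> // e.
      by move: nvw; rewrite e eqxx.
    by move: nvw; rewrite e eqxx.
  + move=> x y hx hy /(eS _ _ hx hy) [[-> ->]|[-> ->]]; rewrite /goodC.
      rewrite dv sb; have -> : u / (r%:C * u) = (r^-1)%:C.
        by rewrite fmorphV; field; nz.
      by rewrite lecR -ltNge invr_gt0.
    rewrite dw -opprB sb; have -> : - u / - (r%:C * u) = (r^-1)%:C.
      by rewrite fmorphV; field; nz.
    by rewrite lecR -ltNge invr_gt0.
  + move=> x y hx hy /(eS _ _ hx hy) [[-> ->]|[-> ->]] z; rewrite /edgeC dv dw.
      exact: arcC_sym.
    by apply: arcC_sym => //; rewrite eq_sym.
  + move=> x y x' y' z hx hy hx' hy' /(eS _ _ hx hy) h1 /(eS _ _ hx' hy') h2 _ _; left.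
    case: h1 => [][-> ->]; case: h2 => [][-> ->] //; exact: finset.setUC.
  + move=> x y z hx hy hz /(eS _ _ hx hy); move: hz; rewrite !inE.
    by move=> /orP[]/eqP -> [][-> ->]; auto.
- by rewrite inE.
move=> z hz zv; have hth := theta_gt0 R rsys vw.
have e : edgeC P' B' v w z.
  case: hz => [[x [y [hx hy /(eS _ _ hx hy)[][-> ->]]]]|[x]] //.
    move=> e; move: e; rewrite /edgeC dv dw; by apply: arcC_sym => //; rewrite eq_sym.
  by rewrite !inE => /orP[]/eqP -> ez; [rewrite ez eqxx in zv|rewrite ez; exact: arcC_right].
move: e; rewrite /edgeC dv; case/(arcC_invP nvw u0 zv) => t t0 et.
(* The inverted ray gives z - P v = u / (r^-1 + t): all of the segment lies at angle 0 and within
   distance r. *)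
have ri0 : 0 < r^-1 + t by rewrite ltr_wpDr // invr_gt0.
exists (r^-1 + t)^-1, 0; split.
- rewrite invr_gt0 ri0 /=; apply: (@le_lt_trans _ _ r); last exact: rr.
  by rewrite -[leRHS]invrK lef_pV2 ?posrE ?invr_gt0 // lerDl.
- by rewrite mul0r add0r; lra.
rewrite expi0 mulr1; apply/eqP; rewrite addrC -subr_eq; apply/eqP.
have -> : ((r^-1 + t)^-1)%:C = (r%:C^-1 + t%:C)^-1 :> C.
  by rewrite fmorphV /= rmorphD /= fmorphV.
by apply: invr_inj; rewrite et sb !invfM invrK mulrDl.
Qed.
End Attach.

(** * A cycle with one vertex at infinity *)

Section ConeSums.
Variable R : realType.
Local Notation C := R[i].
Local Notation re := (@complex.Re R).
Local Notation im := (@complex.Im R).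

(** Along the bisector and across it the sum has components (x + y) cos d and (y - x) sin d, with d
    the half-angle; a quarter turn puts them in the form of [upper_polarP]. *)
Lemma cone_sum (x y lo hi : R) : 0 <= x -> 0 <= y -> 0 < x + y -> lo <= hi < lo + pi ->
  exists r phi : R, [/\ 0 < r, lo <= phi <= hi &
    x%:C * expi lo + y%:C * expi hi = r%:C * expi phi].
Proof.
move=> x0 y0 xy /andP[h1 h2]; pose c := (lo + hi) / 2; pose d := (hi - lo) / 2.
have pi0 := pi_gt0 R.
have cd : 0 < cos d by apply: cos_gt0_pihalf; rewrite /d; lra.
have sd : 0 <= sin d by apply: sin_ge0_pi; rewrite /d; lra.
have [|||r [t [r0 ht e]]] := @upper_polarP R ((x - y) * sin d) ((x + y) * cos d) d.
- by rewrite mulr_gt0.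
- by rewrite /d; lra.
- rewrite normrM (ger0_norm sd) -!mulrA (mulrC (cos d)).
  rewrite ler_wpM2r ?mulr_ge0 ?(ltW cd) //.
  by apply: le_trans (ler_normB _ _) _; rewrite !ger0_norm.
exists r, (c + t); split => //; first by rewrite /c; rewrite /d in ht; lra.
have -> : lo = c - d by rewrite /c /d; lra.
have -> : hi = c + d by rewrite /c /d; lra.
rewrite !expiD !(mulrCA _ (expi c)) -mulrDr; congr (_ * _).
apply: (mulfI (expi_neq0 (pi / 2))); rewrite mulrCA -expiD -e.
by apply: complex_eq; rewrite ?reimE /= cos_pihalf sin_pihalf cosN sinN; ring.
Qed.

Lemma re_inv_gt0 (z : C) : (0 < re z^-1) = (0 < re z).
Proof.
have [->|z0] := eqVneq z 0; first by rewrite invr0.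
case: z z0 => a b z0 /=; rewrite pmulr_lgt0 // invr_gt0.
rewrite lt0r addr_ge0 ?sqr_ge0 // andbT paddr_eq0 ?sqr_ge0 // !sqrf_eq0.
by apply: contra z0 => /andP[/eqP -> /eqP ->].
Qed.

Lemma re_inv_ge0 (z : C) : 0 <= re z -> 0 <= re z^-1.
Proof.
by case: z => a b /= a0; rewrite divr_ge0 // addr_ge0 // sqr_ge0.
Qed.

(** Inversion preserves the right half-plane, and 1 / (z - a) is 1 / (b - a) plus a nonnegative
    multiple of 1 / u. *)
Lemma arcC_halfplane (a b u z : C) : a != b -> u != 0 -> 0 < re (b - a) -> 0 <= re u ->
  arcC a b u z -> z = a \/ re a < re z.
Proof.
move=> ab u0 h1 h2 hz; have [->|za] := eqVneq z a; [by left|right].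
case/(arcC_invP ab u0 za): hz => s s0 e.
rewrite -subr_gt0 -reB -re_inv_gt0 e reD ltr_pwDl ?re_inv_gt0 //.
by rewrite reM /= mul0r subr0 mulr_ge0 // re_inv_ge0.
Qed.

Lemma arcC_halfplaneN (a b u z : C) : a != b -> u != 0 -> re (b - a) < 0 -> re u <= 0 ->
  arcC a b u z -> z = a \/ re z < re a.
Proof.
move=> ab u0 h1 h2 hz; have [->|za] := eqVneq z a; [by left|right].
case/(arcC_invP ab u0 za): hz => s s0 e.
rewrite -subr_gt0 -reB -re_inv_gt0 -(opprB z) invrN e opprD reD ltr_pwDl //.
  by rewrite -invrN re_inv_gt0 reN oppr_gt0.
by rewrite -mulrN -invrN reM /= mul0r subr0 mulr_ge0 // re_inv_ge0 // reN oppr_ge0.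
Qed.

(** Since 1 / (z - a) is a nonnegative combination of the inverses of chord and tangent, the arc is
    seen from a within the angle between tangent and chord; the bounds on s place the ray outside
    this angle. *)
Lemma arcC_off_ray (a z : C) (L kap t rho s : R) : 0 < L -> 0 < rho ->
  `|t - kap| < pi -> Num.max t kap < s -> s < Num.min t kap + 2 * pi ->
  arcC a (a + L%:C * expi kap) (expi t) z -> z = a + rho%:C * expi s -> False.
Proof.
move=> L0 rho0 htk h1 h2 hz ez.
have nn (r x : R) : 0 < r -> r%:C * expi x != 0.
  by move=> r0; rewrite mulf_neq0 ?expi_neq0 // realC_neq0 gt_eqF.
have za : z != a by rewrite ez -subr_eq0 addrAC subrr add0r nn.
have ab : a != a + L%:C * expi kap by rewrite eq_sym -subr_eq0 addrAC subrr add0r nn.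
case/(arcC_invP ab (expi_neq0 _) za): hz => sg s0.
have e0 (x : C) : a + x - a = x by rewrite addrAC subrr add0r.
rewrite ez !e0 !invfM -!expiN -!fmorphV /= => e.
have Li : 0 < L^-1 by rewrite invr_gt0.
have fin (r phi : R) : 0 < r -> - (Num.max t kap) <= phi <= - Num.min t kap ->
    (L^-1)%:C * expi (- kap) + sg%:C * expi (- t) = r%:C * expi phi -> False.
  move=> r0 hphi; rewrite -e => e2.
  have := congr1 (@nrm R) e2; rewrite !nrmM !nrm_expi !nrm_real !gtr0_norm ?invr_gt0 // !mulr1.
  move=> er; move: e2; rewrite er => /(mulfI _) e2.
  have {}e2 : expi phi = expi (- s) by rewrite e2 // realC_neq0 gt_eqF.
  by apply: (expi_inj_period e2); lra.
move: htk; rewrite ltr_norml => htk.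
have [tk|kt] := leP t kap.
  have [|| r [phi [r0 hphi e2]]] := @cone_sum L^-1 sg (- kap) (- t) (ltW Li) s0; [lra|lra|].
  by apply: (fin r phi) => //; rewrite (max_idPr tk) (min_idPl tk).
have {}kt := ltW kt.
have [|| r [phi [r0 hphi e2]]] := @cone_sum sg L^-1 (- t) (- kap) s0 (ltW Li); [lra|lra|].
by apply: (fin r phi); rewrite // ?(max_idPl kt) ?(min_idPr kt) // addrC.
Qed.

Lemma goodC_expi (a : C) (L kap t : R) : 0 < L -> `|t - kap| < pi ->
  goodC a (a + L%:C * expi kap) (expi t).
Proof.
move=> L0 h; rewrite /goodC addrAC subrr add0r.
have -> : expi t / (L%:C * expi kap) = (L^-1)%:C * expi (t - kap).
  by rewrite expiB fmorphV invfM mulrCA.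
rewrite pmulr_rle0 ?ltcR ?invr_gt0 // lecE /=; apply/negP => /andP[/eqP s0 c0].
set d := t - kap in h s0 c0; have pi0 := pi_gt0 R.
have [d0|d0|d0] := ltgtP d 0.
- have : 0 < sin (- d) by apply: sin_gt0_pi; rewrite ltr_norml in h; lra.
  by rewrite sinN -s0 oppr0 ltxx.
- have : 0 < sin d by apply: sin_gt0_pi; rewrite ltr_norml in h; lra.
  by rewrite -s0 ltxx.
- by rewrite d0 cos0 in c0; lra.
Qed.
End ConeSums.

(** * The chain of arcs between two rays *)

Section Chain.
Variables (R : realType) (m : nat) (th : nat -> R).
Hypothesis (m2 : (2 <= m)%N) (thP : forall i, (i <= m)%N -> 0 < th i <= pi).
Local Notation C := R[i].
Local Notation re := (@complex.Re R).
Local Notation im := (@complex.Im R).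

Lemma re_scale (r : R) (x : C) : re (r%:C * x) = r * re x.
Proof. by rewrite reM /= mul0r subr0. Qed.

Lemma im_scale (r : R) (x : C) : im (r%:C * x) = r * im x.
Proof. by rewrite imM /= mul0r addr0. Qed.

(* [hin i] and [hout i] are the headings of the curve on reaching and leaving vertex i, where it turns
   left by [gap i].  At inner vertices they are symmetric about the horizontal; the headings of the two
   rays to vertex 0, at infinity, differ by the turn [gap 0] that remains. *)
Definition gap (i : nat) : R := pi - th i.
Definition hin (i : nat) : R :=
  if i == 1%N then - (gap 0 / 2) else if i == m then gap 0 / 2 - gap m else - (gap i / 2).
Definition hout (i : nat) : R := hin i + gap i.
Definition chord (i : nat) : R := (hout i + hin i.+1) / 2.
(** Chords have length 1, and as on any circular arc the direction of the chord is the mean of the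
    headings at its ends. The chain starts at 1 rather than 0 so that its vertices have real part at
    least 1: the vertical lines through them then avoid the pole, which lies on the imaginary axis.
    [wv 0] is a dummy value. *)
Fixpoint wv (i : nat) : C :=
  if i is j.+1 then (if j == 0%N then 1 else wv j + (1 : R)%:C * expi (chord j)) else 0.

(* [link i] joins vertex i to vertex i+1, the vertices 0 and m+1 being the point at infinity. *)
Definition link (i : nat) (z : C) : Prop :=
  if i == 0%N then exists2 r : R, 0 <= r & z = wv 1 + r%:C * expi (hin 1 + pi)
  else if i == m then exists2 r : R, 0 <= r & z = wv m + r%:C * expi (hout m)
  else arcC (wv i) (wv i.+1) (expi (hout i)) z.

Let gapP i : (i <= m)%N -> 0 <= gap i < pi.
Proof. by move=> /thP; rewrite /gap; lra. Qed.

Let m0 : (0 < m)%N. Proof. exact: leq_trans m2. Qed.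
Let m1 : (m == 1)%N = false. Proof. by case: m m2 => [|[|]]. Qed.
Let mn0 : (m == 0)%N = false. Proof. by case: m m2. Qed.

Lemma hin_lt i : (0 < i)%N -> (i < m)%N -> - (pi / 2) < hin i <= 0.
Proof.
move=> i0 im; have := gapP (leq0n m); have := gapP (ltnW im).
by rewrite /hin (ltn_eqF im); case: eqP => _; lra.
Qed.

Lemma hin_bound i : (0 < i)%N -> (i <= m)%N -> - pi < hin i < pi / 2.
Proof.
move=> i0 im; have := gapP (leq0n m); have := gapP im; have := gapP (leqnn m).
have := pi_gt0 R.
by rewrite /hin; case: eqP => _; [|case: eqP => [->|_]]; lra.
Qed.

Lemma hout_lt i : (1 < i)%N -> (i <= m)%N -> 0 <= hout i < pi / 2.
Proof.
move=> i0 im; have := gapP (leq0n m); have := gapP im.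
rewrite /hout /hin (gtn_eqF i0); case: eqP => [->|_]; lra.
Qed.

Lemma hout_bound i : (0 < i)%N -> (i <= m)%N -> - (pi / 2) < hout i < pi.
Proof.
move=> i0 im; have := gapP (leq0n m); have := gapP im.
have := pi_gt0 R.
rewrite /hout /hin; case: eqP => [->|_]; [lra|case: eqP => [->|_]; lra].
Qed.

Lemma hout_last : hout m = gap 0 / 2.
Proof. by rewrite /hout /hin m1 eqxx; lra. Qed.

Lemma chordP i : (0 < i)%N -> (i < m)%N ->
  - (pi / 2) < chord i < pi / 2 /\ - (pi / 2) < hout i - chord i < pi.
Proof.
move=> i0 im; have h1 := hout_bound i0 (ltnW im); have h2 := hin_bound (ltn0Sn i) im.
rewrite /chord; split; last by lra.
have := gapP (leq0n m); have := gapP (ltnW im); have := gapP im; have := pi_gt0 R.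
rewrite /hout /hin eqSS (gtn_eqF i0) (ltn_eqF im).
case: (eqVneq i 1%N) => [->|_]; case: eqP => [e|_]; rewrite -?e; lra.
Qed.

Lemma cos_hout i : (1 < i)%N -> (i <= m)%N -> 0 < cos (hout i).
Proof. by move=> i1 im; apply: cos_gt0_pihalf; have := hout_lt i1 im; have := pi_gt0 R; lra. Qed.

Lemma cos_hin i : (0 < i)%N -> (i < m)%N -> 0 < cos (hin i).
Proof. by move=> i1 im; apply: cos_gt0_pihalf; have := hin_lt i1 im; have := pi_gt0 R; lra. Qed.

Lemma cos_chord i : (0 < i)%N -> (i < m)%N -> 0 < cos (chord i).
Proof. by move=> i1 im; apply: cos_gt0_pihalf; have [] := chordP i1 im. Qed.

Lemma wvS i : (0 < i)%N -> wv i.+1 = wv i + (1 : R)%:C * expi (chord i).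
Proof. by case: i. Qed.

Lemma wv_sub i : (0 < i)%N -> wv i.+1 - wv i = expi (chord i).
Proof. by move=> i0; rewrite wvS // addrAC subrr add0r mul1r. Qed.

Lemma wv_neq i : (0 < i)%N -> wv i != wv i.+1.
Proof. by move=> i0; rewrite eq_sym -subr_eq0 wv_sub // expi_neq0. Qed.

Lemma re_wv_lt i j : (0 < i)%N -> (i < j)%N -> (j <= m)%N -> re (wv i) < re (wv j).
Proof.
move=> i0; elim: j => // j IH; rewrite ltnS leq_eqVlt => /orP[/eqP <-|ij] jm.
  by rewrite wvS // reD re_scale mul1r ltrDl cos_chord.
apply: (lt_trans (IH ij (ltnW jm))).
have j0 : (0 < j)%N by exact: leq_ltn_trans ij.
by rewrite (wvS j0) reD re_scale mul1r ltrDl cos_chord.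
Qed.

Lemma re_wv_ge1 i : (0 < i)%N -> (i <= m)%N -> 1 <= re (wv i).
Proof.
case: i => // -[|i] _ im; first by rewrite /=.
by apply/ltW/(@re_wv_lt 1 i.+2).
Qed.

Lemma link_mid i z : (0 < i)%N -> (i < m)%N -> link i z -> arcC (wv i) (wv i.+1) (expi (hout i)) z.
Proof. by move=> i0 im; rewrite /link (gtn_eqF i0) (ltn_eqF im). Qed.

Lemma link_sym i z : (0 < i)%N -> (i < m)%N -> link i z ->
  arcC (wv i.+1) (wv i) (expi (hin i.+1 + pi)) z.
Proof.
move=> i0 im /(link_mid i0 im); apply: arcC_sym; rewrite ?expi_neq0 // ?wv_neq //.
rewrite wv_sub // -expiD -mulrN expr2 -expiD -invrN -expiDpi -expiB.
have -> : chord i + chord i - (hout i + (hin i.+1 + pi) + pi) = - (2 * pi).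
  by rewrite /chord; lra.
by rewrite expiN expi2pi invr1.
Qed.

Lemma link_left i z : (i.+1 < m)%N -> link i z -> z = wv i.+1 \/ re z < re (wv i.+1).
Proof.
move=> im; case: (posnP i) => [->|i0].
  rewrite /link eqxx => -[r]; rewrite le_eqVlt => /orP[/eqP <-|r0] ->.
    by left; rewrite mul0r addr0.
  right; rewrite reD re_scale expiDpi reN mulrN gtrDl.
  by rewrite oppr_lt0 mulr_gt0 // cos_hin.
move=> /(link_sym i0 (ltnW im)); apply: arcC_halfplaneN; rewrite ?expi_neq0 //.
- by rewrite eq_sym wv_neq.
- by rewrite -opprB wv_sub // reN oppr_lt0 cos_chord // ltnW.
- by rewrite expiDpi reN oppr_le0 ltW // cos_hin.
Qed.

Lemma link_right j z : (1 < j)%N -> (j <= m)%N -> link j z -> z = wv j \/ re (wv j) < re z.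
Proof.
move=> j1; have j0 := ltnW j1; rewrite leq_eqVlt => /orP[/eqP ->|jm].
  rewrite /link mn0 eqxx => -[r]; rewrite le_eqVlt => /orP[/eqP <-|r0] ->.
    by left; rewrite mul0r addr0.
  right; rewrite reD re_scale ltrDl.
  by rewrite mulr_gt0 // cos_hout.
move=> /(link_mid j0 jm); apply: arcC_halfplane; rewrite ?expi_neq0 //.
- exact: wv_neq.
- by rewrite wv_sub // cos_chord.
- by rewrite ltW // cos_hout // ltnW.
Qed.

(** The first arc may leave its vertex to the left, where vertical strips fail; the angle under
    which the arc is seen from [wv 1] replaces them. *)
Let first_off (r s : R) z : 0 < r -> Num.max (hout 1) (chord 1) < s ->
  s < Num.min (hout 1) (chord 1) + 2 * pi -> z = wv 1 + r%:C * expi s -> link 1 z -> False.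
Proof.
move=> r0 h1 h2 ez /(link_mid (isT : (0 < 1)%N) m2); rewrite (wvS (isT : (0 < 1)%N)) => hz.
apply: (arcC_off_ray ltr01 r0 _ h1 h2 hz ez).
by have [_ h] := chordP (isT : (0 < 1)%N) m2; have := pi_gt0 R; rewrite ltr_norml; lra.
Qed.

(** The same at the last vertex. Looking back along the arc adds pi to its headings, hence the
    shifted window for s. *)
Let last_off (r s : R) z : 0 < r -> Num.max (hin m) (chord m.-1) + pi < s ->
  s < Num.min (hin m) (chord m.-1) + 3 * pi -> z = wv m + r%:C * expi s -> link m.-1 z -> False.
Proof.
have m3 : (0 < m.-1)%N by rewrite -subn1 subn_gt0.
have m4 : (m.-1 < m)%N by rewrite prednK.
move=> r0 h1 h2 ez /(link_sym m3 m4); rewrite (prednK m0).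
have -> : wv m.-1 = wv m + (1 : R)%:C * expi (chord m.-1 + pi).
  rewrite expiDpi mulrN -{2}(prednK m0) (wvS m3) addrK //.
move=> hz; apply: (arcC_off_ray ltr01 r0 _ _ _ hz ez).
- have [_ h] := chordP m3 m4; have := pi_gt0 R; rewrite ltr_norml /chord (prednK m0) in h *; lra.
- by rewrite -addr_maxl.
- by rewrite -addr_minl; lra.
Qed.

(** A vertical line separates the two links, touching them at most in a common vertex, unless they
    are the first ray and first arc or the last arc and last ray. These two pairs are treated by
    angles. *)
Lemma link_planar i j z : (i < j)%N -> (j <= m)%N -> link i z -> link j z ->
  j = i.+1 /\ z = wv j.
Proof.
move=> ij jm hi hj.
have [im|im] := ltnP i.+1 m; last first.
  have ei : i.+1 = m by apply/eqP; rewrite eqn_leq im (leq_trans ij jm).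
  have ej : j = m by apply/eqP; rewrite eqn_leq jm -ei ij.
  split; first by rewrite ej ei.
  move: hj; rewrite ej /link mn0 eqxx => -[r]; rewrite le_eqVlt => /orP[/eqP <-|r0] ez.
    by rewrite ez mul0r addr0.
  have em : i = m.-1 by rewrite -ei.
  have m3 : (0 < m.-1)%N by rewrite -subn1 subn_gt0.
  have m4 : (m.-1 < m)%N by rewrite prednK.
  have [_ h] := chordP m3 m4.
  (* The full turn moves the heading of the last ray into the window of [last_off]. *)
  case: (@last_off r (hout m + 2 * pi) z) => //; last by rewrite -em.
  - have := hout_bound m3 (ltnW m4); have := hin_bound m0 (leqnn m); have := gapP (leqnn m).
    have e : hout m = hin m + gap m by [].
    rewrite /chord (prednK m0) in h *.
    by move=> *; rewrite -ltrBrDr gt_max e; apply/andP; split; lra.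
  - have := hout_bound m3 (ltnW m4); have := hin_bound m0 (leqnn m); have := gapP (leqnn m).
    have e : hout m = hin m + gap m by [].
    have e2 : hin m = gap 0 / 2 - gap m by rewrite /hin m1 eqxx.
    have := gapP (leq0n m); rewrite /chord (prednK m0) in h *.
    by move=> *; rewrite -ltrBlDr lt_min e; apply/andP; split; lra.
  - by rewrite expiD2pi.
have [j1|j1] := leqP j 1.
  have ej : j = 1%N by apply/eqP; rewrite eqn_leq j1 (leq_ltn_trans _ ij).
  have ei : i = 0%N by move: ij; rewrite ej; case: i {hi im}.
  rewrite ej ei; split => //; move: hi; rewrite ei /link eqxx => -[r].
  rewrite le_eqVlt => /orP[/eqP <-|r0] ez; first by rewrite ez mul0r addr0.
  have [_ h] := chordP (isT : (0 < 1)%N) m2.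
  case: (@first_off r (hin 1 + pi) z) => //; last by rewrite -ej.
  - have := hin_bound (ltn0Sn 1) m2; have := gapP (leq0n m); have := gapP m0.
    have e1 : hin 1 = - (gap 0 / 2) by rewrite /hin eqxx.
    rewrite /chord /hout e1 in h *.
    by move=> *; rewrite gt_max; apply/andP; split; lra.
  - have := hin_bound (ltn0Sn 1) m2; have := gapP (leq0n m); have := gapP m0.
    have e1 : hin 1 = - (gap 0 / 2) by rewrite /hin eqxx.
    rewrite /chord /hout e1 in h *.
    by move=> *; rewrite -ltrBlDr lt_min; apply/andP; split; lra.
have [ei|ei] := link_left im hi; have [ej|ej] := link_right j1 jm hj.
- split => //; apply/eqP; rewrite eqn_leq ij andbT leqNgt; apply/negP => lt.
  by have := re_wv_lt (ltn0Sn i) lt jm; rewrite -ei ej ltxx.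
- have : re (wv i.+1) <= re (wv j).
    by move: ij; rewrite leq_eqVlt => /orP[/eqP -> //|lt]; apply/ltW/re_wv_lt.
  by rewrite -ei leNgt ej.
- have : re (wv i.+1) <= re (wv j).
    by move: ij; rewrite leq_eqVlt => /orP[/eqP -> //|lt]; apply/ltW/re_wv_lt.
  by rewrite -ej leNgt ei.
- have : re (wv i.+1) <= re (wv j).
    by move: ij; rewrite leq_eqVlt => /orP[/eqP -> //|lt]; apply/ltW/re_wv_lt.
  by rewrite leNgt (lt_trans ej ei).
Qed.

Lemma link_wv i k : (i <= m)%N -> (0 < k <= m)%N -> link i (wv k) -> k = i \/ k = i.+1.
Proof.
move=> im /andP[k0 km] h; have [ki|ki|->] := ltngtP k i; [| |by left].
  have [e|e] := link_right (leq_ltn_trans k0 ki) im h.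
    by have := re_wv_lt k0 ki im; rewrite e ltxx.
  by have := re_wv_lt k0 ki im; rewrite ltNge (ltW e).
right; apply/eqP; rewrite eqn_leq ki andbT leqNgt; apply/negP => lt.
have := re_wv_lt (ltn0Sn i) lt km.
have [e|e] := link_left (leq_trans lt km) h; first by rewrite e ltxx.
by rewrite ltNge (ltW e).
Qed.

Lemma link_start i : (0 < i)%N -> (i <= m)%N -> link i (wv i).
Proof.
move=> i0 im; rewrite /link (gtn_eqF i0); case: eqP => [->|_].
  by exists 0; rewrite // mul0r addr0.
exact: arcC_left.
Qed.

(** Provides the free half-line by which blocks attached later at vertex k reach infinity. *)
Lemma link_below i k (s : R) : (i <= m)%N -> (0 < k <= m)%N -> 0 < s ->
  ~ link i (wv k + s%:C * expi (- (pi / 2))).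
Proof.
move=> im /andP[k0 km] s0 h; set z := wv k + _ in h.
have rz : re z = re (wv k).
  have e0 : re (expi (- (pi / 2))) = 0 by rewrite /= cosN cos_pihalf.
  by rewrite reD re_scale e0 mulr0 addr0.
have zk : z <> wv k.
  move=> e; have : s%:C * expi (- (pi / 2)) != 0.
    by rewrite mulf_neq0 ?expi_neq0 // realC_neq0 gt_eqF.
  by apply/negP; rewrite negbK; apply/eqP/(addrI (wv k)); rewrite addr0.
have pi0 := pi_gt0 R.
have [ki|ik] := leqP k i.
  have [i1|i1] := leqP i 1.
    have i1' : i = 1%N by apply/eqP; rewrite eqn_leq i1 (leq_trans k0 ki).
    have k1 : k = 1%N by apply/eqP; rewrite eqn_leq k0 andbT (leq_trans ki i1).
    have [g1 g2] := chordP (isT : (0 < 1)%N) m2.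
    have g3 := hout_bound (isT : (0 < 1)%N) m0.
    apply: (@first_off s (2 * pi - pi / 2) z) => //; last by rewrite -i1'.
    - by rewrite gt_max; apply/andP; split; lra.
    - by rewrite -ltrBlDr lt_min; apply/andP; split; lra.
    - by rewrite /z k1 [2 * pi - _]addrC expiD2pi.
  have [e|e] := link_right i1 im h.
    case: (ltngtP k i) ki => // [lt|ee] _.
      by have := re_wv_lt k0 lt im; rewrite -e rz ltxx.
    by apply: zk; rewrite e ee.
  case: (ltngtP k i) ki => // [lt|ee] _.
    by have := re_wv_lt k0 lt im; rewrite ltNge ltW // -rz.
  by move: e; rewrite rz ee ltxx.
have [im1|im1] := ltnP i.+1 m; last first.
  have ei : i.+1 = m by apply/eqP; rewrite eqn_leq im1 (leq_trans ik km).
  have ek : k = m by apply/eqP; rewrite eqn_leq km -ei ik.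
  have em : i = m.-1 by rewrite -ei.
  have m3 : (0 < m.-1)%N by rewrite -subn1 subn_gt0.
  have m4 : (m.-1 < m)%N by rewrite prednK.
  have [g1 g2] := chordP m3 m4.
  have g3 := hin_bound m0 (leqnn m).
  apply: (@last_off s (2 * pi - pi / 2) z) => //; last by rewrite -em.
  - by rewrite -ltrBrDr gt_max; apply/andP; split; lra.
  - by rewrite -ltrBlDr lt_min; apply/andP; split; lra.
  - by rewrite /z ek [2 * pi - _]addrC expiD2pi.
have le : re (wv i.+1) <= re (wv k).
  by move: ik; rewrite leq_eqVlt => /orP[/eqP -> //|lt]; apply/ltW/re_wv_lt.
have [e|e] := link_left im1 h; last by move: e; rewrite rz ltNge le.
move: ik; rewrite leq_eqVlt => /orP[/eqP ee|lt]; first by apply: zk; rewrite e ee.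
by have := re_wv_lt (ltn0Sn i) lt km; rewrite -e rz ltxx.
Qed.

Lemma link_good i : (0 < i)%N -> (i < m)%N -> goodC (wv i) (wv i.+1) (expi (hout i)).
Proof.
move=> i0 im; rewrite wvS //; apply: goodC_expi; first exact: ltr01.
by have [_ h] := chordP i0 im; have := pi_gt0 R; rewrite ltr_norml; lra.
Qed.

Lemma chain_bound : exists b : R, [/\ 1 <= b,
  forall i z, (0 < i)%N -> (i < m)%N -> link i z -> nrm z <= b &
  forall i, (i <= m)%N -> nrm (wv i) <= b].
Proof.
suff h n : (n <= m)%N -> exists b : R, [/\ 1 <= b,
  forall i z, (0 < i)%N -> (i < n)%N -> link i z -> nrm z <= b &
  forall i, (i <= n)%N -> nrm (wv i) <= b] by exact: h.
elim: n => [_|n IH nm].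
  by exists 1; split=> // i; rewrite leqn0 => /eqP ->; rewrite nrm0.
have [b [b1 h1 h2]] := IH (ltnW nm).
have [b' hb'] : exists b' : R, forall z, (0 < n)%N -> link n z -> nrm z <= b'.
  have [n0|n0] := posnP n; first by exists 0.
  have [M hM] := arcC_bounded (wv_neq n0) (expi_neq0 _) (link_good n0 nm).
  by exists M => z _ /(link_mid n0 nm); exact: hM.
exists (Num.max b (Num.max b' (nrm (wv n.+1)))); split.
- by rewrite le_max b1.
- move=> i z i0; rewrite ltnS leq_eqVlt => /orP[/eqP ei|lt] hz.
    by rewrite !le_max (hb' z) ?orbT // -ei.
  by rewrite le_max (h1 i z).
move=> i; rewrite leq_eqVlt => /orP[/eqP ->|]; first by rewrite !le_max lexx !orbT.
by rewrite ltnS => /h2 h; rewrite le_max h.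
Qed.

(* Seen from -iM, the curve lies in the wedge of half-angle [h] around the upward vertical. *)
Lemma chain_wedge (h : R) : th 0 / 2 <= h -> h < pi ->
  exists2 M : R, 1 <= M & forall i z, (i <= m)%N -> link i z ->
    1 <= im z + M /\ `|re z| * cos h <= (im z + M) * sin h.
Proof.
move=> h1 h2; have [b [b1 hb1 hb2]] := chain_bound.
have t0 := thP (leq0n m); have sh : 0 < sin h by apply: sin_gt0_pi; lra.
have bs : 0 <= b / sin h by rewrite divr_ge0 ?(ltW sh) //; lra.
(* Here b bounds the arcs and the origins of the rays. The summand b + 1 lifts everything to height
   at least 1 above the pole, and b / sin h makes up for a horizontal offset of up to b. *)
pose M := b + 1 + b / sin h; have M1 : b + 1 <= M by rewrite /M; lra.
have key (x y r : R) : `|x| <= b + r * sin (th 0 / 2) -> - b + r * cos (th 0 / 2) <= y ->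
    0 <= r -> 1 <= y + M /\ `|x| * cos h <= (y + M) * sin h.
  move=> hx hy r0; have cn : 0 <= cos (th 0 / 2) by apply: cos_ge0_pihalf; lra.
  have rc := mulr_ge0 r0 cn; have yM : 1 <= y + M by lra.
  split => //; have [c0|c0] := leP (cos h) 0.
    apply: (@le_trans _ _ 0); first by rewrite mulr_ge0_le0.
    by rewrite mulr_ge0 ?(ltW sh) //; lra.
  apply: (@le_trans _ _ ((b + r * sin (th 0 / 2)) * cos h)); first by rewrite ler_wpM2r // ltW.
  apply: (@le_trans _ _ ((r * cos (th 0 / 2) + b / sin h) * sin h)); last first.
    by rewrite ler_wpM2r ?(ltW sh) // /M; lra.
  rewrite !mulrDl divfK ?gt_eqF // addrC lerD //; last first.
    by rewrite ler_piMr ?cos_le1 //; lra.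
  rewrite -!mulrA ler_wpM2l //.
  have : 0 <= sin (h - th 0 / 2) by apply: sin_ge0_pi; lra.
  by rewrite sinB; lra.
have sN : cos (gap 0 / 2) = sin (th 0 / 2).
  have -> : gap 0 / 2 = - (th 0 / 2) + pi / 2 by rewrite /gap; lra.
  by rewrite cosDpihalf sinN opprK.
have cN : sin (gap 0 / 2) = cos (th 0 / 2).
  have -> : gap 0 / 2 = - (th 0 / 2) + pi / 2 by rewrite /gap; lra.
  by rewrite sinDpihalf cosN.
have sp : 0 <= sin (th 0 / 2) by apply: sin_ge0_pi; lra.
have wb i : (i <= m)%N -> `|re (wv i)| <= b /\ - b <= im (wv i).
  move=> /hb2 hw; split; first exact: le_trans (re_nrm _) hw.
  have := im_nrm (wv i); have := ler_norm (- im (wv i)); rewrite normrN; lra.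
exists M => [|i z hi]; first lra.
have [->|i0] := posnP i.
  rewrite /link eqxx => -[r r0 ->]; have [w1 w2] := wb 1%N m0.
  apply: (key _ _ r) => //; rewrite ?reD ?imD ?re_scale ?im_scale expiDpi ?reN ?imN /= /hin eqxx.
    rewrite cosN sN; apply: le_trans (ler_normD _ _) _.
    by rewrite lerD // mulrN normrN ger0_norm ?mulr_ge0.
  by rewrite sinN cN opprK lerD2r.
have [->|im'] := eqVneq i m.
  rewrite /link mn0 eqxx => -[r r0 ->]; have [w1 w2] := wb m (leqnn m).
  apply: (key _ _ r) => //; rewrite ?reD ?imD ?re_scale ?im_scale hout_last /=.
    by rewrite sN; apply: le_trans (ler_normD _ _) _; rewrite lerD // ger0_norm ?mulr_ge0.
  by rewrite cN lerD2r.
have im2 : (i < m)%N by rewrite ltn_neqAle im' hi.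
move=> hz; have hn := hb1 i z i0 im2 hz.
apply: (key _ _ 0); rewrite ?mul0r ?addr0 //; first exact: le_trans (re_nrm _) hn.
have := im_nrm z; have := ler_norm (- im z); rewrite normrN; lra.
Qed.

End Chain.

(** * Computations with the map w |-> c / (w - o) *)

Lemma goodC_sym (R : realType) (a b u v : R[i]) : a != b -> u != 0 -> v != 0 ->
  0 < - ((b - a) ^+ 2 / (u * v)) -> goodC a b u -> goodC b a v.
Proof.
move=> ab u0 v0 k0; rewrite /goodC; apply: contraNN => h.
have ba0 : b - a != 0 by rewrite subr_eq0 eq_sym.
have ab0 : a - b != 0 by rewrite subr_eq0.
have -> : u / (b - a) = (- ((b - a) ^+ 2 / (u * v)))^-1 * (v / (a - b))^-1.
  by field; rewrite ?u0 ?v0 ?ab0 ?ba0.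
by rewrite pmulr_rle0 ?invr_gt0 // invr_le0.
Qed.

Lemma realCM (R : realType) (a b : R) : (a * b)%:C = a%:C * b%:C :> R[i].
Proof. exact: rmorphM. Qed.

(** This and the next two identities verify the reflection condition of [arcC_sym] on the image
    cycle, for its first, last and inner edges. W is a vertex minus the pole, l and r are positive
    moduli, e is a unit direction; over an abstract field, [field] meets only atoms. *)
Lemma reflect_root (F : fieldType) (c W l r e : F) :
  c != 0 -> W != 0 -> l != 0 -> r != 0 -> e != 0 ->
  - ((c / W) ^+ 2 / (c / l / e * (- c / W ^+ 2 / r * e))) = l * r.
Proof. move=> c0 W0 l0 r0 e0; field; nz. Qed.

Lemma reflect_last (F : fieldType) (c W l r e : F) :
  c != 0 -> W != 0 -> l != 0 -> r != 0 -> e != 0 ->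
  - ((- (c / W)) ^+ 2 / (- c / W ^+ 2 / r * e * (c / l / e))) = l * r.
Proof. move=> c0 W0 l0 r0 e0; field; nz. Qed.

Lemma reflect_mid (F : fieldType) (c W W' r r' e e' : F) :
  c != 0 -> W != 0 -> W' != 0 -> r != 0 -> r' != 0 -> e != 0 -> e' != 0 -> W' = W + e ->
  - ((c / W' - c / W) ^+ 2 / (- c / W ^+ 2 / r * (e ^+ 2 / e') *
     (- c / W' ^+ 2 / r' * (e' * -1)))) = r * r'.
Proof.
move=> c0 W0 W0' r0 r0' e0 e0' eW; subst W'; field.
by nz; rewrite ?oner_eq0.
Qed.

(** 0 is the image of infinity. The quotient that tests whether the image arc passes through 0 is
    minus the inverse of tangent over chord of the original arc; so [goodC] on the chain keeps inner
    edges away from v. *)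
Lemma mobius_at_pole (F : fieldType) (k a b u : F) :
  k != 0 -> a != 0 -> b != 0 -> u != 0 -> a + b != 0 ->
  u / b = - ((0 - k / a) * (k / (a + b) - k / a) / ((k / (a + b) - 0) * (- k / a ^+ 2 * u)))^-1.
Proof.
move=> k0 a0 b0 u0 ab0; field.
have -> : k * a + - k * (a + b) = - (k * b) by ring.
by nz; rewrite mulf_neq0.
Qed.

(** The dual statement: the image arc fails to be good exactly when the original arc passes through
    the pole. *)
Lemma mobius_chord (F : fieldType) (k a b u : F) :
  k != 0 -> a != 0 -> b != 0 -> u != 0 -> a + b != 0 ->
  - k / a ^+ 2 * u / (k / (a + b) - k / a) = - (- a * b / ((a + b) * u))^-1.
Proof.
move=> k0 a0 b0 u0 ab0; field.
have -> : k * a + - k * (a + b) = - (k * b) by ring.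
by nz; rewrite ?mulf_neq0 ?oner_eq0.
Qed.

Lemma small_perturb (R : realType) (d : R[i]) (e : R) : 0 < e <= pi / 2 ->
  nrm d <= sin e / 2 ->
  exists r t : R, [/\ 0 < r, - e <= t <= e & 1 + d = r%:C * expi t].
Proof.
move=> he hd; have pi0 := pi_gt0 R; have s1 := sin_le1 e.
have sp : 0 < sin e by apply: sin_gt0_pi; lra.
have r1 := le_trans (re_nrm d) hd; have i1 := le_trans (im_nrm d) hd.
rewrite ler_norml in r1.
have [|||r [t [r0 ht E]]] := @upper_polarP R (- complex.Im d) (1 + complex.Re d) e.
- lra.
- lra.
- rewrite normrN; apply: (@le_trans _ _ (sin e / 2)).
    by apply: le_trans i1; rewrite ler_piMr // cos_le1.
  by rewrite mulrC ler_wpM2r ?(ltW sp) //; lra.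
exists r, t; split => //; apply: (mulIf (expi_neq0 (pi / 2))).
rewrite -mulrA -expiD (addrC t) -E.
by apply: complex_eq; rewrite ?reimE /= cos_pihalf sin_pihalf; ring.
Qed.

(** The displacement is the derivative times b, up to the factor 1 / (1 + b / a), whose argument
    [small_perturb] controls. *)
Lemma small_step (F : fieldType) (c a b : F) : a != 0 -> a + b != 0 ->
  c / (a + b) - c / a = - c / a ^+ 2 * b / (1 + b / a).
Proof.
move=> a0 ab0; have h : 1 + b / a != 0.
  by rewrite (_ : 1 + b / a = (a + b) / a) ?mulf_neq0 ?invr_neq0 // mulrDl divff.
have e : 1 + b / a = (a + b) / a by rewrite mulrDl divff.
by rewrite e; field; nz.
Qed.

Lemma small_step2 (F : fieldType) (c a b : F) : a != 0 -> a + b != 0 ->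
  c / (a + b) - c / a = - c * b / (a * (a + b)).
Proof. by move=> a0 ab0; field; nz. Qed.

(** * Carrying the chain to a cycle through v *)

Section CycleGadget.
Variables (R : realType) (V : finType) (adj : rel V) (rt : V -> V -> V).
Hypothesis (sg : simple_graph adj) (rsys : rotation_system adj rt).
Local Notation C := R[i].
Local Notation D := (deg adj).
Local Notation re := (@complex.Re R).
Local Notation im := (@complex.Im R).
Local Notation dirn := (dirn adj rt).
Local Notation edgeC := (edgeC adj rt).
Local Notation drawok := (drawok adj rt).
Local Notation ptsC := (ptsC adj rt).
Local Notation curveC := (curveC adj rt).
Local Notation theta := (theta R adj).

Variables (v : V) (s' : seq V) (P0 : V -> C) (B0 : V -> R) (rho : R).
Let s := v :: s'.
Hypothesis (cyc : is_cycle adj s) (ccws : ccw rt s) (rho0 : 0 < rho).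
Hypothesis (chordless : forall x y, x \in s -> y \in s -> adj x y ->
  y = next s x \/ x = next s y).

Let m := size s'.
(** The default value v makes [x m.+1] the root again, so that edge m closes the cycle. *)
Let x (i : nat) := nth v s i.
Let th (i : nat) := theta (x i).

Let m2 : (2 <= m)%N. Proof. by case/and3P: cyc. Qed.
Let m0 : (0 < m)%N. Proof. exact: ltnW. Qed.
Let us : uniq s. Proof. by case/and3P: cyc. Qed.
Let xs i : x i \in s.
Proof.
have [h|h] := ltnP i (size s); first exact: mem_nth.
by rewrite /x nth_default // mem_head.
Qed.
Let x0 : x 0 = v. Proof. by []. Qed.
Let xm1 : x m.+1 = v. Proof. by rewrite /x nth_default. Qed.
Let idx_x i : (i <= m)%N -> index (x i) s = i.
Proof. by move=> im; rewrite index_uniq. Qed.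
Let x_idx y : y \in s -> x (index y s) = y.
Proof. by move=> ys; rewrite /x nth_index. Qed.
Let idx_le y : y \in s -> (index y s <= m)%N.
Proof. by rewrite -index_mem. Qed.
Let next_x i : (i <= m)%N -> next s (x i) = x i.+1.
Proof. by move=> im; rewrite next_nth xs idx_x. Qed.
Let rt_next i : (i <= m)%N -> rt (x i.+1) (next s (x i.+1)) = x i.
Proof. by move=> im; rewrite (ccws (xs _)) -(next_x im) prev_next. Qed.
Let adj_x i : (i <= m)%N -> adj (x i) (x i.+1).
Proof. by move=> im; rewrite -next_x //; exact: cycle_adj_next. Qed.

(** Degree one would make the two cycle neighbours coincide, impossible on at least three vertices.
    The bound gives [th i <= pi], as the chain requires. *)
Let deg2 y : y \in s -> (1 < D y)%N.
Proof.
move=> ys; have c : cycle adj s by case/and3P: cyc.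
have h1 := next_cycle c ys; have h2 := prev_cycle c ys.
rewrite ltnNge; apply/negP => d1.
have d : D y = 1%N by apply/eqP; rewrite eqn_leq d1 (deg_gt0 rsys h1).
have e : prev s y = next s y.
  by rewrite -(ccws ys); have := rt_iter_deg rsys h1; rewrite d.
have e1 : next s (next s y) = y by rewrite -{1}e next_prev.
move: e1; rewrite -(x_idx ys); set i := index y s; have im : (i <= m)%N by exact: idx_le.
rewrite next_x //; move: im; rewrite leq_eqVlt => /orP[/eqP ->|im].
  rewrite xm1 -[X in next s X]x0 next_x // => /(congr1 (index^~ s)).
  by rewrite !idx_x // => e1; move: m2; rewrite -e1.
rewrite next_x // => /(congr1 (index^~ s)).
move: (im); rewrite leq_eqVlt => /orP[/eqP em|im2].
  rewrite em xm1 -[X in index X]x0 !idx_x // ?(ltnW im) // => i0.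
  by move: m2; rewrite -em -i0.
by rewrite !idx_x ?(ltnW im) // => /eqP; rewrite eqn_leq ltnNge leqnSn.
Qed.

Let thP i : (i <= m)%N -> 0 < th i <= pi.
Proof.
move=> im; have h := adj_x im; rewrite /th (theta_gt0 R rsys h) /=.
have := theta_deg R rsys h; have h2 := deg2 (xs i); have := theta_gt0 R rsys h => t0 e.
have : 2%:R * theta (x i) <= (D (x i))%:R * theta (x i) by rewrite ler_pM2r // ler_nat.
rewrite e; lra.
Qed.

Let T : C := dirn B0 v (x 1).
(** Half of the angle [th 0] plus an eighth of it, within the tolerance of a quarter allowed by
    gluing. *)
Let h0 : R := 5 / 8 * th 0.
Let wedge : exists M : R, 1 <= M /\ forall i z, (i <= m)%N -> link m th i z ->
    1 <= im z + M /\ `|re z| * cos h0 <= (im z + M) * sin h0.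
Proof.
have t0 := thP (leq0n m); have pi0 := pi_gt0 R.
have [||M M1 h] := @chain_wedge R m th m2 thP h0; rewrite /h0; [lra|lra|].
by exists M.
Qed.
Let M := sval (cid wedge).
Let M1 : 1 <= M. Proof. by have [] := svalP (cid wedge). Qed.
Let M2 i z : (i <= m)%N -> link m th i z ->
    1 <= im z + M /\ `|re z| * cos h0 <= (im z + M) * sin h0.
Proof. by have [_ h] := svalP (cid wedge); exact: h. Qed.

(** The modulus of c. Links keep distance at least 1 from o, so their images stay within [lam < rho]
    of v. *)
Let lam : R := rho / 2.
Let lam0 : 0 < lam. Proof. by rewrite divr_gt0. Qed.
Let o : C := 0 +i* (- M).
(* The phase of [c] makes the image of the first ray leave v in the prescribed direction [T]. *)
Let c : C := lam%:C * T * expi (hin m th 1 + pi).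
Let w i := wv m th i.
Let f (z : C) : C := c / (z - o).

Let c0 : c != 0.
Proof. by rewrite !mulf_neq0 ?expi_neq0 // realC_neq0 gt_eqF. Qed.

Let link_o i z : (i <= m)%N -> link m th i z -> z - o != 0.
Proof.
move=> im /(M2 im) [h _]; rewrite subr_eq0; apply: contraTneq h => ->.
by rewrite /= addNr -ltNge.
Qed.

Let w_o i : (0 < i)%N -> (i <= m)%N -> w i - o != 0.
Proof. by move=> i0 im; apply: (link_o im); exact: link_start. Qed.

Let fw0 i : (0 < i)%N -> (i <= m)%N -> f (w i) != 0.
Proof. by move=> i0 im; rewrite mulf_neq0 // invr_neq0 // w_o. Qed.

(** [A i] is the argument of the derivative at vertex i, i.e. the angle by which the map turns the
    tangents there. *)
Let angles : exists A : nat -> R, exists r : nat -> R, forall i, (0 < i)%N -> (i <= m)%N ->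
  0 < r i /\ - c / (w i - o) ^+ 2 = (r i)%:C * expi (A i).
Proof.
have h i : exists p : R * R, (0 < i)%N -> (i <= m)%N ->
    0 < p.2 /\ - c / (w i - o) ^+ 2 = (p.2)%:C * expi p.1.
  have [i0|i0] := boolP (0 < i)%N; last by exists (0, 0).
  have [im|im] := boolP (i <= m)%N; last by exists (0, 0).
  have n0 : - c / (w i - o) ^+ 2 != 0.
    by rewrite mulf_neq0 ?oppr_eq0 ?invr_neq0 ?expf_neq0 ?w_o.
  have [r [t [r0 _ e _]]] := polarP n0.
  by exists (t, r).
have [g hg] := choice h.
by exists (fun i => (g i).1), (fun i => (g i).2).
Qed.
Let A := sval (cid angles).
Let r := sval (cid (svalP (cid angles))).
Let ArP i : (0 < i)%N -> (i <= m)%N ->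
  0 < r i /\ - c / (w i - o) ^+ 2 = (r i)%:C * expi (A i).
Proof. by move=> i0 im; have h := svalP (cid (svalP (cid angles))); exact: h. Qed.

Definition gadgetP (y : V) : C := if y \in s' then P0 v + f (w (index y s)) else P0 y.
(** Chosen so that the edge to the next vertex leaves in the turned heading [A i + hout i]. The edge
    back is the next one counterclockwise, and its direction then comes out right because the chain
    turns by [pi - th i]; see [dx']. *)
Definition gadgetB (y : V) : R :=
  if y \in s' then A (index y s) + hout m th (index y s) - (rt_idx adj rt y (next s y))%:R * theta y
  else B0 y.
Local Notation P := gadgetP.
Local Notation B := gadgetB.
Local Notation q := (P0 v).

Let vs' : v \notin s'. Proof. by case/andP: us. Qed.
Let xs' i : (0 < i)%N -> (i <= m)%N -> x i \in s'.
Proof. by case: i => // i _ im; rewrite /x /= mem_nth. Qed.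
Let Pv : P v = q. Proof. by rewrite /gadgetP (negPf vs'). Qed.
Let Px i : (0 < i)%N -> (i <= m)%N -> P (x i) = q + f (w i).
Proof. by move=> i0 im; rewrite /gadgetP xs' // idx_x. Qed.
Let dv y : dirn B v y = dirn B0 v y.
Proof. by rewrite /dirn /ang /gadgetB (negPf vs'). Qed.
Let dx i : (0 < i)%N -> (i <= m)%N -> dirn B (x i) (x i.+1) = expi (A i + hout m th i).
Proof. by move=> i0 im; rewrite /dirn /ang /gadgetB xs' // idx_x // next_x // subrK. Qed.
Let dx' i : (i < m)%N -> dirn B (x i.+1) (x i) = expi (A i.+1 + (hin m th i.+1 + pi)).
Proof.
move=> im; rewrite -(rt_next (ltnW im)) (dirn_rt rsys); last first.
  by rewrite next_x //; exact: adj_x.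
rewrite next_x // dx // -expiD; congr expi.
by rewrite /hout /gap /th; lra.
Qed.
Let dv' : dirn B v (x m) = T * expi (th 0).
Proof.
have := rt_next (leqnn m); rewrite xm1 -[X in next s X]x0 next_x // => <-.
by rewrite (dirn_rt rsys) ?dv //; exact: (adj_x (leq0n m)).
Qed.

Let TE : T = c / lam%:C / expi (hin m th 1 + pi).
Proof.
rewrite /c; have l0 : lam%:C != 0 :> C by rewrite realC_neq0 gt_eqF.
by field; rewrite expi_neq0 l0.
Qed.

Let TE' : T * expi (th 0) = c / lam%:C / expi (hout m th m).
Proof.
have e : (expi (hin m th 1 + pi))^-1 * expi (th 0) = (expi (hout m th m))^-1.
  rewrite -!expiN -expiD (hout_last th m2); congr expi.
  by rewrite /hin eqxx /gap; lra.
by rewrite TE -mulrA e.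
Qed.

Let symc i : (i <= m)%N ->
  0 < - ((P (x i.+1) - P (x i)) ^+ 2 / (dirn B (x i) (x i.+1) * dirn B (x i.+1) (x i))).
Proof.
move=> im; have l0 : lam%:C != 0 :> C by rewrite realC_neq0 gt_eqF.
case: (posnP i) => [->|i0].
  have [r0 e] := ArP (isT : (0 < 1)%N) m0.
  rewrite x0 Pv Px // dv -/T dx' // (expiD (A 1)) (addrC q) addrK.
  have -> : expi (A 1) = - c / (w 1 - o) ^+ 2 / (r 1)%:C.
    by rewrite e mulrC mulKf // realC_neq0 gt_eqF.
  have rn : (r 1)%:C != 0 :> C by rewrite realC_neq0 gt_eqF.
  rewrite TE (reflect_root c0 (w_o (isT : (0 < 1)%N) m0) l0 rn (expi_neq0 _)).
  by rewrite mulr_gt0 // ltcR.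
move: im; rewrite leq_eqVlt => /orP[/eqP ei|im].
  have [r0 e] := ArP i0 (eq_leq ei).
  rewrite ei xm1 Pv Px // -[X in dirn B _ X](xm1) dx // dv' TE' (expiD (A m)).
  have -> : expi (A m) = - c / (w m - o) ^+ 2 / (r m)%:C.
    by rewrite -ei e mulrC mulKf // realC_neq0 gt_eqF.
  have -> : q - (q + f (w m)) = - f (w m) by ring.
  rewrite ei in r0; have rn : (r m)%:C != 0 :> C by rewrite realC_neq0 gt_eqF.
  rewrite (reflect_last c0 (w_o m0 (leqnn m)) l0 rn (expi_neq0 _)).
  by rewrite mulr_gt0 // ltcR.
have [r0 e] := ArP i0 (ltnW im); have [r1 e1] := ArP (ltn0Sn i) im.
rewrite !Px // ?(ltnW im) // dx ?(ltnW im) // dx' // (expiD (A i)) (expiD (A i.+1)) expiDpi -(mulrN1 (expi (hin m th i.+1))).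
have -> : expi (A i) = - c / (w i - o) ^+ 2 / (r i)%:C.
  by rewrite e mulrC mulKf // realC_neq0 gt_eqF.
have -> : expi (A i.+1) = - c / (w i.+1 - o) ^+ 2 / (r i.+1)%:C.
  by rewrite e1 mulrC mulKf // realC_neq0 gt_eqF.
have ew : w i.+1 = w i + expi (chord m th i) by rewrite /w wvS // mul1r.
have ee : expi (hout m th i) = expi (chord m th i) ^+ 2 / expi (hin m th i.+1).
  by rewrite expr2 -expiD -expiB; congr expi; rewrite /chord; lra.
have -> : q + f (w i.+1) - (q + f (w i)) = f (w i.+1) - f (w i) by ring.
have [rn rn1] : (r i)%:C != 0 :> C /\ (r i.+1)%:C != 0 :> C.
  by rewrite !realC_neq0 !gt_eqF.
have ewo : w i.+1 - o = w i - o + expi (chord m th i) by rewrite ew addrAC.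
rewrite ee (reflect_mid c0 (w_o i0 (ltnW im)) (w_o (ltn0Sn i) im) rn rn1 (expi_neq0 _) (expi_neq0 _) ewo).
by rewrite mulr_gt0 // ltcR.
Qed.

Let f_inj a b : f a = f b -> a = b.
Proof. by move/(mulfI c0)/invr_inj/addIr. Qed.

Let Pneq i : (i <= m)%N -> P (x i) != P (x i.+1).
Proof.
move=> im; have [->|i0] := posnP i.
  by rewrite x0 Pv Px // -subr_eq0 opprD addrA subrr add0r oppr_eq0 fw0.
move: im; rewrite leq_eqVlt => /orP[/eqP ei|im].
  by rewrite ei xm1 Pv Px // -subr_eq0 addrAC subrr add0r fw0.
rewrite !Px ?(ltnW im) // (inj_eq (addrI q)); apply/eqP => /f_inj /eqP.
by rewrite (negPf (wv_neq m th i0)).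
Qed.

Let edge_sym i z : (i <= m)%N -> edgeC P B (x i) (x i.+1) z = edgeC P B (x i.+1) (x i) z.
Proof.
move=> im; have h := symc im; rewrite /edgeC; apply/idP/idP.
  by apply: arcC_sym; rewrite ?expi_neq0.
apply: arcC_sym; rewrite ?expi_neq0 //.
by rewrite -(opprB (P (x i.+1))) sqrrN (mulrC (dirn B (x i.+1) _)).
Qed.

(* The map w |-> c / (w - o) sends infinity to 0, so arcs leaving v come from rays. *)
Let root_ray y W a : y != 0 -> W - o != 0 ->
  arcC 0 (c / (W - o)) (c / lam%:C / expi a) y <->
  exists2 t : R, 0 <= t & o + c / y = W + t%:C * expi a.
Proof.
move=> y0 W0; have l0 : lam%:C != 0 :> C by rewrite realC_neq0 gt_eqF.
have e0 := expi_neq0 a.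
have u0 : c / lam%:C / expi a != 0.
  by exact: (mulf_neq0 (mulf_neq0 c0 (invr_neq0 l0)) (invr_neq0 e0)).
have b0 : 0 != c / (W - o) by rewrite eq_sym; exact: (mulf_neq0 c0 (invr_neq0 W0)).
rewrite (arcC_invP b0 u0) //; split=> -[t t0].
  rewrite !subr0 invfM invrK => e; exists (t * lam); first by rewrite mulr_ge0 // ltW.
  have -> : c / y = (W - o) + t%:C * lam%:C * expi a.
    by rewrite e; field; rewrite l0 e0 c0.
  by rewrite (realCM t lam); ring.
move=> e; exists (t / lam); first by rewrite divr_ge0 // ltW.
have {}e : c / y = W - o + t%:C * expi a by apply: (addrI o); rewrite e; ring.
rewrite !subr0 (_ : y^-1 = c / y / c); last by rewrite mulrAC divff // mul1r.
by rewrite e (realCM t) fmorphV /=; field; rewrite l0 e0 c0 W0.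
Qed.

(** z |-> o + c / (z - q) inverts the map, so that away from v all incidences can be read off on the
    chain. *)
Let edgeP i z : (i <= m)%N -> z != q ->
  edgeC P B (x i) (x i.+1) z <-> link m th i (o + c / (z - q)).
Proof.
move=> im zq; have zq0 : z - q != 0 by rewrite subr_eq0.
have ez : z = q + (z - q) by rewrite addrCA subrr addr0.
have [->|i0] := posnP i.
  rewrite /edgeC x0 Pv Px // dv -/T TE {1}ez -[X in arcC X _ _ _]addr0.
  by rewrite arcC_translate /f root_ray // w_o.
move: im; rewrite leq_eqVlt => /orP[/eqP ei|im].
  rewrite ei edge_sym // /edgeC xm1 Pv Px // dv' TE' {1}ez -[X in arcC X _ _ _]addr0.
  rewrite arcC_translate /f root_ray ?w_o // /link eqxx.
  by have -> : (m == 0%N) = false by apply: gtn_eqF.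
have [r0 e] := ArP i0 (ltnW im).
rewrite /edgeC !Px ?(ltnW im) // dx ?(ltnW im) // {1}ez arcC_translate.
rewrite -(arcC_scale _ _ _ (k := (r i)%:C)) ?ltcR // expiD mulrA -e.
set W := o + c / (z - q).
have eW : z - q = c / (W - o).
  by rewrite /W (addrC o) addrK; field; rewrite c0 zq0.
have zo : W != o.
  by rewrite -subr_eq0 /W (addrC o) addrK; exact: (mulf_neq0 c0 (invr_neq0 zq0)).
rewrite eW.
have ao : w i != o by rewrite -subr_eq0; exact: (w_o i0 (ltnW im)).
have bo : w i.+1 != o by rewrite -subr_eq0; exact: (w_o (ltn0Sn i) im).
rewrite /f (arcC_mobius (expi_neq0 _) c0 ao bo zo).
rewrite /link (gtn_eqF i0) (ltn_eqF im); exact: iff_refl.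
Qed.

Let edge_root i : (i <= m)%N -> edgeC P B (x i) (x i.+1) q -> i = 0%N \/ i = m.
Proof.
move=> im; have [->|i0] := posnP i; first by left.
move: im; rewrite leq_eqVlt => /orP[/eqP ei|im]; first by right.
have [r0 e] := ArP i0 (ltnW im); have w0 := w_o i0 (ltnW im).
have w1 := w_o (ltn0Sn i) im.
rewrite /edgeC !Px ?(ltnW im) // dx ?(ltnW im) // -{3}(addr0 q) arcC_translate.
rewrite -(arcC_scale _ _ _ (k := (r i)%:C)) ?ltcR // expiD mulrA -e.
rewrite /arcC eq_sym (negPf (fw0 i0 (ltnW im))) eq_sym (negPf (fw0 (ltn0Sn i) im)) /= => h.
have := link_good thP i0 im; case/negP.
have d0 : wv m th i.+1 - wv m th i != 0 by rewrite wv_sub // expi_neq0.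
have -> : expi (hout m th i) / (wv m th i.+1 - wv m th i) =
  - ((0 - f (w i)) * (f (w i.+1) - f (w i)) /
    ((f (w i.+1) - 0) * (- c / (w i - o) ^+ 2 * expi (hout m th i))))^-1.
  have ew : w i.+1 - o = w i - o + (wv m th i.+1 - wv m th i) by rewrite -/(w i) -/(w i.+1); ring.
  by rewrite /f ew; rewrite ew in w1; apply: mobius_at_pole; rewrite ?expi_neq0.
by rewrite oppr_le0 invr_ge0 ltW.
Qed.

(** The pole o lies below every link, hence no image arc runs through infinity. *)
Let good_i i : (i <= m)%N -> goodC (P (x i)) (P (x i.+1)) (dirn B (x i) (x i.+1)) /\
  goodC (P (x i.+1)) (P (x i)) (dirn B (x i.+1) (x i)).
Proof.
have lo j : (j <= m)%N -> ~ link m th j o.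
  by move=> jm /(M2 jm) [h _]; move: h; rewrite /= addNr leNgt ltr01.
have root W a : W - o != 0 -> (forall t : R, 0 <= t -> o <> W + t%:C * expi a) ->
    goodC q (q + f W) (c / lam%:C / expi a).
  move=> W0 h; rewrite /goodC (addrC q) addrK; apply/negP.
  have -> : c / lam%:C / expi a / f W = (W - o) / (lam%:C * expi a).
    by rewrite /f; field; rewrite ?W0 ?c0 ?expi_neq0 ?realC_neq0 ?gt_eqF.
  move=> /le0_realC; set t := re _ => -[e t0].
  apply: (h (- t * lam)); first by rewrite mulr_ge0 ?oppr_ge0 // ltW.
  have -> : (- t * lam)%:C * expi a = - ((W - o) / (lam%:C * expi a)) * (lam%:C * expi a).
    by rewrite e (realCM (- t) lam) rmorphN /= mulrA.
  rewrite mulNr divfK ?mulf_neq0 ?expi_neq0 ?realC_neq0 ?gt_eqF //.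
  by rewrite opprB addrCA subrr addr0.
move=> im; have sc := symc im; have pn := Pneq im.
have sc' : 0 < - ((P (x i) - P (x i.+1)) ^+ 2 / (dirn B (x i.+1) (x i) * dirn B (x i) (x i.+1))).
  by rewrite -(opprB (P (x i.+1))) sqrrN (mulrC (dirn B (x i.+1) _)).
have fwd : goodC (P (x i)) (P (x i.+1)) (dirn B (x i) (x i.+1)) ->
  goodC (P (x i)) (P (x i.+1)) (dirn B (x i) (x i.+1)) /\
  goodC (P (x i.+1)) (P (x i)) (dirn B (x i.+1) (x i)).
  by move=> h; split => //; apply: goodC_sym sc h; rewrite ?expi_neq0.
have bwd : goodC (P (x i.+1)) (P (x i)) (dirn B (x i.+1) (x i)) ->
  goodC (P (x i)) (P (x i.+1)) (dirn B (x i) (x i.+1)) /\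
  goodC (P (x i.+1)) (P (x i)) (dirn B (x i.+1) (x i)).
  by move=> h; split => //; apply: goodC_sym sc' h; rewrite ?expi_neq0 // eq_sym.
have [i00|i0] := posnP i.
  apply: fwd; rewrite i00 x0 Pv Px // dv -/T TE; apply: root; first exact: w_o.
  move=> t t0 e; apply: (lo 0%N) => //; rewrite /link eqxx.
  by exists t.
move: (im); rewrite leq_eqVlt => /orP[/eqP ei|im'].
  apply: bwd; rewrite ei xm1 Pv Px // dv' TE'; apply: root; first exact: w_o.
  move=> t t0 e; apply: (lo m) => //; rewrite /link eqxx.
  have -> : (m == 0%N) = false by apply: gtn_eqF.
  by exists t.
apply: fwd; rewrite !Px ?(ltnW im') // dx ?(ltnW im') //.
have [r0 e] := ArP i0 (ltnW im'); have w0 := w_o i0 (ltnW im').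
have w1 := w_o (ltn0Sn i) im'.
apply/negP => h; apply: (lo i im); rewrite /link (gtn_eqF i0) (ltn_eqF im').
apply/or3P/Or33.
have ew : w i.+1 - o = w i - o + (wv m th i.+1 - wv m th i) by rewrite -/(w i) -/(w i.+1); ring.
have d0 : wv m th i.+1 - wv m th i != 0 by rewrite wv_sub // expi_neq0.
have rc : 0 < (r i)%:C :> C by rewrite ltcR.
have : (r i)%:C * (expi (A i + hout m th i) / (q + f (w i.+1) - (q + f (w i)))) <= 0.
  by rewrite pmulr_rle0.
rewrite expiD mulrA mulrA -e.
have -> : q + f (w i.+1) - (q + f (w i)) = f (w i.+1) - f (w i) by ring.
have -> : - c / (w i - o) ^+ 2 * expi (hout m th i) / (f (w i.+1) - f (w i)) =
  - ((o - wv m th i) * (wv m th i.+1 - wv m th i) /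
     ((wv m th i.+1 - o) * expi (hout m th i)))^-1.
  rewrite -/(w i) -/(w i.+1) -(opprB (w i) o) /f ew; rewrite ew in w1.
  by apply: mobius_chord; rewrite ?expi_neq0.
rewrite oppr_le0 invr_ge0 le_eqVlt => /orP[/eqP z0|//].
exfalso; move: (esym z0) => /eqP; rewrite mulf_eq0 invr_eq0 !mulf_eq0 (negPf (expi_neq0 _)).
by rewrite (negPf d0) -(opprB (wv m th i)) oppr_eq0 (negPf w0) (negPf w1).
Qed.

Let N := [set y | y \in s'].

Let inN y : (y \in v |: N) = (y \in s).
Proof. by rewrite !inE. Qed.

Let edge_index y y' : y \in s -> y' \in s -> adj y y' ->
  exists2 i, (i <= m)%N & (y = x i /\ y' = x i.+1) \/ (y = x i.+1 /\ y' = x i).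
Proof.
move=> ys ys' yy; have [e|e] := chordless ys ys' yy.
  exists (index y s); [exact: idx_le|left].
  by rewrite -next_x ?idx_le // x_idx.
exists (index y' s); [exact: idx_le|right].
by rewrite -next_x ?idx_le // x_idx.
Qed.

Let edge_index' y y' z : y \in s -> y' \in s -> adj y y' -> edgeC P B y y' z ->
  exists i, [/\ (i <= m)%N, edgeC P B (x i) (x i.+1) z & [set y; y'] = [set x i; x i.+1]].
Proof.
move=> ys ys' yy; have [i im [[-> ->]|[-> ->]]] := edge_index ys ys' yy => e; exists i.
  by split.
by split; rewrite // ?edge_sym // finset.setUC.
Qed.

Let pts_index z : ptsC P B (v |: N) z -> exists2 i, (i <= m)%N & edgeC P B (x i) (x i.+1) z.
Proof.
case=> [[y [y' [yN yN' yy e]]]|[y]].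
  rewrite !inN in yN yN'; have [i [im e' _]] := edge_index' yN yN' yy e.
  by exists i.
rewrite inN => ys ->; exists (index y s); first exact: idx_le.
by rewrite x_idx //; exact: arcC_left.
Qed.

Let curve_index z : curveC P B s z -> exists2 i, (i <= m)%N & edgeC P B (x i) (x i.+1) z.
Proof.
case=> y ys; rewrite -(x_idx ys) next_x ?idx_le // => e.
by exists (index y s) => //; exact: idx_le.
Qed.

Let pts_curve z : ptsC P B (v |: N) z -> curveC P B s z.
Proof. by case/pts_index => i im e; exists (x i); rewrite ?xs // next_x. Qed.

(** The extra alternative is the root: edges 0 and m meet in the image of infinity, which
    [link_planar] does not see. *)
Let planar_lt i k z : (i < k)%N -> (k <= m)%N -> edgeC P B (x i) (x i.+1) z ->
  edgeC P B (x k) (x k.+1) z -> (k = i.+1 /\ z = P (x k)) \/ [/\ i = 0%N, k = m & z = P v].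
Proof.
move=> ik km ei ek; have im : (i <= m)%N by exact: leq_trans (ltnW ik) km.
have [ez|zq] := eqVneq z q.
  right; rewrite ez in ei ek; rewrite Pv; split => //.
    have [//|e] := edge_root im ei.
    by move: (leq_trans ik km); rewrite e ltnn.
  by have [e|//] := edge_root km ek; rewrite e in ik.
have [e1 e2] := link_planar m2 thP ik km (iffLR (edgeP im zq) ei) (iffLR (edgeP km zq) ek).
left; split => //; have k0 : (0 < k)%N by rewrite e1.
rewrite Px // /f -/(w k) /w -e2 (addrC o) addrK.
have zq0 : z - q != 0 by rewrite subr_eq0.
by field; rewrite zq0 c0.
Qed.

Let gadget_block i z : (i <= m)%N -> edgeC P B (x i) (x i.+1) z -> z != q ->
  exists r phi : R, [/\ 0 < r < rho, - (th 0 / 8) <= phi <= th 0 + th 0 / 8 &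
    z = q + r%:C * (T * expi phi)].
Proof.
move=> hi e zq; have zq0 : z - q != 0 by rewrite subr_eq0.
have hl := iffLR (edgeP hi zq) e; have [y1 hw] := M2 hi hl.
set W := o + _ in hl y1 hw; have t0 := thP (leq0n m); have pi0 := pi_gt0 R.
have [|||r1 [t [r10 ht E]]] := @upper_polarP R (re W) (im W + M) h0.
- lra.
- by rewrite /h0; lra.
- exact: hw.
have Wo : c / (z - q) = r1%:C * expi (pi / 2 + t).
  rewrite -E; have -> : c / (z - q) = W - o by rewrite /W (addrC o) addrK.
  by apply: complex_eq; rewrite ?reimE /=; ring.
have r1n : 1 <= r1.
  have := congr1 (@nrm R) E; rewrite nrmM nrm_expi mulr1 nrm_real gtr0_norm // => <-.
  by apply: le_trans (im_nrm _); rewrite /= ger0_norm; lra.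
have r1C : r1%:C != 0 :> C by rewrite realC_neq0 gt_eqF.
(* Since hin 1 + pi = pi / 2 + th 0 / 2, dividing c by r1 e^(i (pi / 2 + t)) leaves the angle th 0 /
   2 - t relative to T. *)
exists (lam / r1), (th 0 / 2 - t); split.
- rewrite divr_gt0 //=; apply: (@le_lt_trans _ _ lam).
    by rewrite ler_pdivrMr // ler_peMr // ltW.
  by have := rho0; rewrite /lam; lra.
- by rewrite /h0 in ht; lra.
have -> : z = q + c / (c / (z - q)) by field; rewrite c0 zq0.
rewrite Wo {1}/c; congr (_ + _).
have -> : expi (hin m th 1 + pi) = expi (pi / 2 + t) * expi (th 0 / 2 - t).
  by rewrite -expiD; congr expi; rewrite /hin eqxx /gap; lra.
rewrite (realCM lam) fmorphV /=; field; rewrite r1C expi_neq0 //.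
Qed.

Let sec_root (rho' : R) : 0 < rho' -> exists r psi : R,
  [/\ 0 < r < rho', 5 / 4 * theta v <= psi <= 2 * pi - theta v / 4 &
    escapes (curveC P B s) (P v + r%:C * (dirn B v (next s v) * expi psi))].
Proof.
move=> rho'0; have t0 := thP (leq0n m); have pi0 := pi_gt0 R.
(* The direction opposite to the bisector of the wedge, so that the straight ray from v misses the
   whole block. *)
exists (rho' / 2), (th 0 / 2 + pi); split; [lra|by rewrite -/(th 0); lra|].
have -> : next s v = x 1 by rewrite -next_x.
rewrite Pv dv -/T; set d := T * _.
have d0 : d != 0 by rewrite mulf_neq0 ?expi_neq0.
apply: (escapes_ray d0) => t t1 /curve_index [i im e].
have pos : 0 < rho' / 2 + t by lra.
have ed : q + (rho' / 2)%:C * d + t%:C * d = q + (rho' / 2 + t)%:C * d.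
  by rewrite rmorphD /= mulrDl addrA.
rewrite ed in e.
have zq : q + (rho' / 2 + t)%:C * d != q.
  by rewrite -subr_eq0 (addrC q) addrK mulf_neq0 // realC_neq0 gt_eqF.
have [r1 [phi [/andP[r10 _] hphi e2]]] := gadget_block im e zq.
move/addrI: e2; rewrite /d !(mulrCA _ T) => /(mulfI (expi_neq0 _)) e2.
by apply: (ray_clash pos r10 e2); lra.
Qed.

Let sec_x k (rho' : R) : (0 < k)%N -> (k <= m)%N -> (2 < D (x k))%N -> 0 < rho' ->
  exists r psi : R,
  [/\ 0 < r < rho', 5 / 4 * theta (x k) <= psi <= 2 * pi - theta (x k) / 4 &
    escapes (curveC P B s) (P (x k) + r%:C * (dirn B (x k) (next s (x k)) * expi psi))].
Proof.
move=> k0 km D3 rho'0; have pi0 := pi_gt0 R.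
have tk := thP km; have t0 := thP (leq0n m).
have tk3 : 3 * th k <= 2 * pi.
  rewrite -(theta_deg R rsys (adj_x km)) -/(th k) ler_pM2r ?ler_nat //; lra.
(* As th k <= 2 pi / 3, the downward vertical keeps an angle th k / 2 from both directions of the
   curve at vertex k. The deviation e spends th k / 4 of it and leaves the quarter asked for by
   [dk_sec]. *)
have [b1 b2] : th k / 2 <= pi / 2 + hout m th k /\ th k / 2 <= pi / 2 - hin m th k.
  rewrite /hout /hin /gap; move: tk tk3 t0.
  case: eqP => [->|_]; [lra|case: eqP => [->|_]; lra].
pose e := th k / 4; have se : 0 < sin e by apply: sin_gt0_pi; rewrite /e; lra.
have [y1 _] := M2 km (link_start th k0 km).
have x1 := re_wv_ge1 thP k0 km.
set X := re (wv m th k) in x1; set Y := im (wv m th k) + M in y1.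
have X0 : X != 0 by rewrite gt_eqF //; lra.
have eY : w k - o = X +i* Y by apply: complex_eq; rewrite ?reimE /X /Y /=; ring.
(* The image of the vertical line through vertex k, with t the height above o: the vertex itself is
   at t = Y. *)
pose g (t : R) : C := q + c / (X +i* t).
have nz (t : R) : X +i* t != 0 by rewrite eq_complex /= (negPf X0).
have gq t : g t - q = c / (X +i* t) by rewrite /g (addrC q) addrK.
have gn t : g t != q.
  by rewrite -subr_eq0 gq; exact: (mulf_neq0 c0 (invr_neq0 (nz t))).
have gw t : o + c / (g t - q) = o + (X +i* t).
  by rewrite gq; congr (_ + _); field; rewrite c0 nz.
have off t : t < Y -> ~ curveC P B s (g t).
  move=> tY /curve_index [i hi /(edgeP hi (gn t))]; rewrite gw.
  have -> : o + (X +i* t) = w k + (Y - t)%:C * expi (- (pi / 2)).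
    apply: complex_eq; rewrite ?reimE /= cosN sinN cos_pihalf sin_pihalf /X /Y /w; ring.
  by apply: link_below; rewrite ?k0 // subr_gt0.
(* From the level of o one goes on horizontally towards o. The image of this segment is a straight
   ray in direction c, and no link comes down to that level. *)
have esc0 : escapes (curveC P B s) (g 0).
  apply: (escapes_ray c0) => t t1 /curve_index [i hi].
  have Xt : 0 < X^-1 + t by rewrite ltr_wpDr // invr_gt0; lra.
  have e1 : g 0 + t%:C * c - q = c * (X^-1 + t)%:C.
    rewrite addrAC gq rmorphD fmorphV /= mulrDr; congr (_ + _); exact: mulrC.
  have xtn : (X^-1 + t)%:C != 0 :> C by rewrite realC_neq0 gt_eqF.
  have zn : g 0 + t%:C * c != q by rewrite -subr_eq0 e1 mulf_neq0.
  move=> /(edgeP hi zn); rewrite e1 => /(M2 hi) [h _]; move: h.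
  have -> : c / (c * (X^-1 + t)%:C) = ((X^-1 + t)^-1)%:C.
    by rewrite [RHS]fmorphV /= invfM mulrA divff // mul1r.
  by rewrite imD /= addr0 addNr ler10.
(* The three terms bound the angular deviation by e, keep the point above the level of o, and bring
   its image within rho' of the vertex. *)
pose d := Num.min (sin e / 2) (Num.min (Y / 2) (rho' / (2 * lam))).
have d0 : 0 < d by rewrite !lt_min !divr_gt0 ?mulr_gt0 //; lra.
have [d1 d2 d3] : [/\ d <= sin e / 2, d <= Y / 2 & d <= rho' / (2 * lam)].
  by rewrite !ge_min !lexx !orbT.
have escd : escapes (curveC P B s) (g (Y - d)).
  apply: (@escapes_path _ _ g 0 (Y - d) (Y - d) 0) => //.
  - exact: ccont_inv_line.
  - by apply/andP; split; lra.
  - by apply/andP; split; lra.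
  - by move=> t /andP[_ t1]; apply: off; lra.
have zk1 : 1 <= nrm (w k - o).
  by apply: le_trans (re_nrm _); rewrite eY /= ger0_norm //; lra.
have zk2 : 1 <= nrm (X +i* (Y - d)).
  by apply: le_trans (re_nrm _); rewrite /= ger0_norm //; lra.
pose E : C := expi (- (pi / 2)).
have eE : X +i* (Y - d) = (w k - o) + d%:C * E.
  rewrite eY; apply: complex_eq; rewrite ?reimE /= cosN sinN cos_pihalf sin_pihalf; ring.
have wo := w_o k0 km.
have [||R' [al [R0 hal eR]]] := @small_perturb R (d%:C * E / (w k - o)) e.
- by rewrite /e; lra.
- rewrite !nrmM nrm_expi mulr1 nrm_real gtr0_norm // nrmV; apply: le_trans d1.
  by rewrite ler_piMr ?(ltW d0) // invf_le1 // (lt_le_trans ltr01).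
have [rk0 erk] := ArP k0 km.
have Rn : R'%:C != 0 :> C by rewrite realC_neq0 gt_eqF.
have EN : E != 0 := expi_neq0 _.
have main : g (Y - d) - P (x k) = (r k * d / R')%:C *
    (expi (A k + hout m th k) * expi (- (pi / 2) - hout m th k - al + 2 * pi)).
  rewrite expiD2pi -expiD.
  have -> : A k + hout m th k + (- (pi / 2) - hout m th k - al) = A k + (- (pi / 2) - al) by ring.
  rewrite expiD (expiB (- (pi / 2))) -/E !realCM fmorphV /=.
  have -> : (r k)%:C * d%:C * (R'%:C)^-1 * (expi (A k) * (E / expi al)) =
    ((r k)%:C * expi (A k)) * d%:C * E / (R'%:C * expi al).
    by field; rewrite Rn expi_neq0.
  rewrite -erk -eR Px // /f /g eE.
  have wo2 : w k - o + d%:C * E != 0 by rewrite -eE nz.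
  have -> : q + c / (w k - o + d%:C * E) - (q + c / (w k - o)) =
     c / (w k - o + d%:C * E) - c / (w k - o) by ring.
  by rewrite -[_ * d%:C * E]mulrA; apply: small_step.
have r'0 : 0 < r k * d / R' by rewrite divr_gt0 // mulr_gt0.
exists (r k * d / R'), (- (pi / 2) - hout m th k - al + 2 * pi); split.
- rewrite r'0 /=; have -> : r k * d / R' = nrm (g (Y - d) - P (x k)).
    by rewrite main !nrmM !nrm_expi !mulr1 nrm_real gtr0_norm.
  have -> : g (Y - d) - P (x k) = - c * (d%:C * E) / ((w k - o) * (X +i* (Y - d))).
    have wo2 : w k - o + d%:C * E != 0 by rewrite -eE nz.
    rewrite Px // /f /g eE.
    have -> : q + c / (w k - o + d%:C * E) - (q + c / (w k - o)) =
     c / (w k - o + d%:C * E) - c / (w k - o) by ring.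
    by apply: small_step2.
  rewrite !nrmM nrmN nrm_expi mulr1 nrm_real gtr0_norm // nrmV nrmM.
  have -> : nrm c = lam.
    by rewrite /c !nrmM !nrm_expi !mulr1 nrm_real gtr0_norm.
  apply: (@le_lt_trans _ _ (lam * d)).
    have hh := mulr_ege1 zk1 zk2.
    rewrite ler_pdivrMr ?(lt_le_trans ltr01 hh) // ler_peMr //.
    by rewrite mulr_ge0 // ltW.
  apply: (@le_lt_trans _ _ (lam * (rho' / (2 * lam)))).
    by rewrite ler_pM2l.
  have -> : lam * (rho' / (2 * lam)) = rho' / 2 by field; rewrite gt_eqF.
  lra.
- rewrite -/(th k); rewrite /e in hal; have : hout m th k = hin m th k + (pi - th k) by [].
  lra.
- rewrite next_x // dx // -main addrCA subrr addr0 //.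
Qed.

Lemma gadget_drawok : drawok P B (v |: N) [:: s].
Proof.
have cover y : y \in v |: N -> exists2 i, (i <= m)%N & y = x i.
  by rewrite inN => ys; exists (index y s); rewrite ?x_idx //; exact: idx_le.
have Pinj i k : (i < k)%N -> (k <= m)%N -> P (x i) != P (x k).
  move=> ik km; have k0 : (0 < k)%N by exact: leq_ltn_trans ik.
  have [->|i0] := posnP i.
    by rewrite x0 Pv Px // eq_sym -subr_eq0 (addrC q) addrK fw0.
  rewrite !Px ?(leq_trans (ltnW ik) km) // (inj_eq (addrI q)).
  apply/eqP => /f_inj e; have := re_wv_lt thP i0 ik km.
  by rewrite -/(w i) /w in e *; rewrite e ltxx.
split.
- move=> y y' /cover[i im ->] /cover[k km ->] e.
  have [ik|ki|-> //] := ltngtP i k; first by have := Pinj _ _ ik km; rewrite e eqxx.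
  by have := Pinj _ _ ki im; rewrite e eqxx.
- move=> y y'; rewrite !inN => ys ys' yy.
  by have [i im [[-> ->]|[-> ->]]] := edge_index ys ys' yy; have [] := good_i im.
- move=> y y'; rewrite !inN => ys ys' yy z.
  by have [i im [[-> ->]|[-> ->]]] := edge_index ys ys' yy; rewrite edge_sym.
- have lt i k z : (i < k)%N -> (k <= m)%N -> edgeC P B (x i) (x i.+1) z ->
    edgeC P B (x k) (x k.+1) z ->
    exists2 a, a \in [set x i; x i.+1] :&: [set x k; x k.+1] & z = P a.
    move=> ik km ei ek; have [[e ez]|[ei0 ekm ez]] := planar_lt ik km ei ek.
      by exists (x k); rewrite // !inE e !eqxx orbT.
    by exists v; rewrite // !inE ei0 ekm x0 xm1 !eqxx orbT.
  move=> u u' y y' z; rewrite !inN => us' us'' ys ys' uu yy eu ey.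
  have [i [im ei ->]] := edge_index' us' us'' uu eu.
  have [k [km ek ->]] := edge_index' ys ys' yy ey.
  have [ik|ki|->] := ltngtP i k; [right|right|by left]; first exact: lt.
  by rewrite finset.setIC; exact: lt.
- move=> u u' y; rewrite !inN => us' us'' ys uu.
  suff h i k : (i <= m)%N -> (k <= m)%N -> edgeC P B (x i) (x i.+1) (P (x k)) ->
      x k = x i \/ x k = x i.+1.
    have [i im [[-> ->]|[-> ->]]] := edge_index us' us'' uu; rewrite -?edge_sym // -(x_idx ys).
      exact: h (idx_le ys).
    by move=> /(h _ _ im (idx_le ys)) []; auto.
  move=> im km; have [->|k0] := posnP k.
    by rewrite x0 Pv => /(edge_root im) [->|->]; [left|right; rewrite xm1].
  have zq : P (x k) != q by rewrite Px // -subr_eq0 (addrC q) addrK fw0.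
  move=> /(edgeP im zq); rewrite Px // (addrC q) addrK.
  have -> : o + c / f (w k) = w k.
    have h := w_o k0 km; rewrite /f; have -> : c / (c / (w k - o)) = w k - o.
      by rewrite invfM invrK mulrA divff // mul1r.
    by rewrite addrCA subrr addr0.
  have kk : (0 < k <= m)%N by rewrite k0.
  by move=> /(link_wv m2 thP im kk) [->|->]; auto.
- move=> s0; rewrite inE => /eqP ->; split=> //.
  by move=> y; rewrite inN.
(* The block is its own cycle curve, so no point of it lies off the curve. *)
- move=> s0 z; rewrite inE => /eqP -> hz off.
  by case: (off (pts_curve hz)).
- move=> s0 y rho'; rewrite inE => /eqP -> ys D3 r0.
  rewrite -(x_idx ys) in D3 *; have km := idx_le ys.
  have [e|k0] := posnP (index y s); last exact: sec_x.
  by rewrite e x0; exact: sec_root.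
Qed.

Lemma gadget_wedge z : ptsC P B (v |: N) z -> z != P v ->
  exists r phi : R, [/\ 0 < r < rho, - (theta v / 4) <= phi <= 1%:R * theta v + theta v / 4 &
    z = P v + r%:C * (dirn B v (next s v) * expi phi)].
Proof.
rewrite Pv => /pts_index [i im e] zq.
have [r1 [phi [h1 h2 ->]]] := gadget_block im e zq.
have t0 := thP (leq0n m); exists r1, phi; split => //.
  by rewrite mul1r -/(th 0); lra.
have -> : next s v = x 1 by rewrite -next_x.
by rewrite dv.
Qed.

End CycleGadget.

(** * Growing the drawing block by block *)

Section CactusCycles.
Variables (V : finType) (adj : rel V).
Hypothesis (sg : simple_graph adj) (cac : cactus adj).
Implicit Types (s c p : seq V) (S : {set V}).

Lemma is_cycle_rot n s : is_cycle adj (rot n s) = is_cycle adj s.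
Proof. by rewrite /is_cycle rot_uniq size_rot rot_cycle. Qed.

Lemma is_cycle_rev s : is_cycle adj (rev s) = is_cycle adj s.
Proof.
rewrite /is_cycle rev_uniq size_rev rev_cycle; congr [&& _, _ & _].
by apply: eq_cycle => x y; rewrite (adjC sg).
Qed.

Lemma cycle_edgesP s (x y : V) : [set x; y] \in cycle_edges s ->
  (x \in s /\ y = next s x) \/ (y \in s /\ x = next s y).
Proof.
case/imsetP => a xs e.
have /set2P[ex|ex] : x \in [set a; next s a] by rewrite -e set21.
  have /set2P[ey|ey] : y \in [set a; next s a] by rewrite -e set22.
    have : next s a \in [set x; y] by rewrite e set22.
    by rewrite ex ey !inE orbb => /eqP en; left; split=> //; rewrite en.
  by left; split; rewrite ex // ey.
have /set2P[ey|ey] : y \in [set a; next s a] by rewrite -e set22.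
  by right; split; rewrite ey // ex.
have : a \in [set x; y] by rewrite e set21.
by rewrite ex ey !inE orbb => /eqP en; left; rewrite -{1}en; split=> //; rewrite -en.
Qed.

Lemma cycle_edges_next s x : x \in s -> [set x; next s x] \in cycle_edges s.
Proof. by move=> xs; apply/imsetP; exists x. Qed.

Lemma cycle_edges_mem s x y : [set x; y] \in cycle_edges s -> x \in s /\ y \in s.
Proof. by move=> /cycle_edgesP[][xs ->]; rewrite mem_next. Qed.

Lemma cactus_edge s c x y : is_cycle adj s -> is_cycle adj c -> adj x y ->
  [set x; y] \in cycle_edges s -> [set x; y] \in cycle_edges c ->
  cycle_edges s = cycle_edges c.
Proof. by move=> h1 h2; exact: cac. Qed.

Lemma next_head (x y : V) p : next [:: x, y & p] x = y.
Proof. by rewrite /= eqxx. Qed.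

Lemma uniq_connect (e : rel V) y y' : connect e y y' ->
  exists p, [/\ path e y p, last y p = y' & uniq (y :: p)].
Proof.
case/connectP => p pp ->; case/shortenP: pp => p' pp' up' _ ; by exists p'.
Qed.

(** The ear and one of the two paths of s between x and x' form a second cycle. It shares with s the
    edge of that path at x' but contains y, which is not on s. *)
Lemma cactus_no_ear s x x' y y' p : is_cycle adj s -> x \in s -> x' \in s -> x != x' ->
  path adj y p -> last y p = y' -> uniq (y :: p) -> {in y :: p, forall z, z \notin s} ->
  adj x y -> adj x' y' -> False.
Proof.
move=> cs xs xs' xx py ly up dis xy xy'.
have us : uniq s by case/and3P: cs.
have [n r er] := rot_to xs'.
have cr : is_cycle adj (x' :: r) by rewrite -er is_cycle_rot.
have xr : x \in r by have := xs; rewrite -(mem_rot n) er inE (negPf xx).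
case/splitPr: xr er cr => r1 r2 er cr.
case/and3P: (cr) => ur _ pr.
have dis2 z : z \in x' :: r1 ++ x :: r2 -> z \notin y :: p.
  by rewrite -er mem_rot => zs; apply: contraL zs; exact: dis.
pose c := x' :: rcons r1 x ++ y :: p.
have cc : is_cycle adj c.
  apply/and3P; split.
  - rewrite /c -cat_cons cat_uniq up andbT; apply/andP; split.
      by move: ur; rewrite -cat_rcons -cat_cons cat_uniq => /and3P[].
    apply/hasPn => z zp; apply: contraL zp => zc; apply: dis2.
    move: zc; rewrite !inE mem_rcons mem_cat !inE => /or3P[->|->|->] //; by rewrite ?orbT.
  - by rewrite /c /= size_cat size_rcons /= addnS addSn.
  - move: pr; rewrite /c -cat_rcons /= !rcons_cat !cat_path last_rcons => /andP[-> _] /=.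
    by rewrite xy rcons_path py ly (adjC sg).
(* The common successor of x' in both cycles; it is x itself if nothing lies between. *)
have [h [hn hc]] : exists h, next (x' :: r1 ++ x :: r2) x' = h /\ next c x' = h.
  by rewrite /c; case: (r1) => [|h r1']; eexists; rewrite ?next_head; split.
have e1 : [set x'; h] \in cycle_edges (x' :: r1 ++ x :: r2).
  by rewrite -hn cycle_edges_next // mem_head.
have e2 : [set x'; h] \in cycle_edges c by rewrite -hc cycle_edges_next // mem_head.
have ah : adj x' h by rewrite -hc; apply: cycle_adj_next cc _; rewrite mem_head.
have e := cactus_edge cr cc ah e1 e2.
have yc : y \in c by rewrite /c inE mem_cat mem_head !orbT.
have : [set y; next c y] \in cycle_edges (x' :: r1 ++ x :: r2).
  by rewrite e cycle_edges_next.
by case/cycle_edges_mem => /dis2; rewrite mem_head.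
Qed.

(** The edge closes one of the two paths of s between its ends. If this is a cycle, it shares with s
    the edge at x', hence all edges, among them the given one. *)
Lemma cactus_chordless s x x' : is_cycle adj s -> x \in s -> x' \in s -> adj x x' ->
  x' = next s x \/ x = next s x'.
Proof.
move=> cs xs xs' xx; have nx := adj_neq sg xx.
have us : uniq s by case/and3P: cs.
have [n r er] := rot_to xs'.
have cr : is_cycle adj (x' :: r) by rewrite -er is_cycle_rot.
have xr : x \in r by have := xs; rewrite -(mem_rot n) er inE (negPf nx).
case/splitPr: xr er cr => r1 r2 er cr.
have nr : next s =1 next (x' :: r1 ++ x :: r2) by move=> z; rewrite -er next_rot.
rewrite !nr; case: r1 er cr {nr} => [|h r1] er cr; first by right; rewrite next_head.
case/and3P: (cr) => ur _ pr.
pose c := x' :: h :: rcons r1 x.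
have cc : is_cycle adj c.
  apply/and3P; split.
  - by move: ur; rewrite cat_cons -cat_rcons -2!cat_cons cat_uniq => /and3P[].
  - by rewrite /c /= size_rcons.
  - move: pr; rewrite /c cat_cons -cat_rcons /= rcons_cat cat_path => /and3P[-> pr1 _] /=.
    by rewrite rcons_path pr1 last_rcons xx.
have e1 : [set x'; h] \in cycle_edges (x' :: (h :: r1) ++ x :: r2).
  by rewrite -{1}(next_head x' h (r1 ++ x :: r2)) cycle_edges_next // mem_head.
have e2 : [set x'; h] \in cycle_edges c.
  by rewrite -{1}(next_head x' h (rcons r1 x)) cycle_edges_next // mem_head.
have ah : adj x' h by move: pr => /= /andP[].
have e := cactus_edge cr cc ah e1 e2.
have uc : uniq c by case/and3P: cc.
have ex : next c x = x'.
  have ec : c = rcons [:: x', h & r1] x by [].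
  by rewrite -(next_rotr 1 uc) {1}ec rotr1_rcons next_head.
have : [set x; x'] \in cycle_edges (x' :: (h :: r1) ++ x :: r2).
  have xc : x \in c by rewrite /c !inE mem_rcons mem_head !orbT.
  by rewrite e; have := cycle_edges_next xc; rewrite ex.
by move/cycle_edgesP => [][_ e3]; [left|right].
Qed.

End CactusCycles.

(** * New components and bridges *)

Section Growth.
Variables (R : realType) (V : finType) (adj : rel V) (rt : V -> V -> V).
Hypothesis (sg : simple_graph adj) (cac : cactus adj) (nat_emb : natural_embedding adj rt).
Local Notation C := R[i].
Local Notation D := (deg adj).
Local Notation drawok := (drawok adj rt).
Implicit Types (P : V -> C) (B : V -> R) (S N : {set V}) (s c : seq V).

Let rsys : rotation_system adj rt. Proof. by case: nat_emb. Qed.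

Definition outer S : rel V := [rel a b | [&& adj a b, a \notin S & b \notin S]].

(** Guarantees that a block begun at v meets S nowhere else, the separation hypothesis of gluing.
    Distinct edges into the same component are allowed as long as they start at the same drawn
    vertex, as for a cycle. *)
Definition attached S : Prop := forall x x' y y', x \in S -> x' \in S ->
  y \notin S -> y' \notin S -> adj x y -> adj x' y' -> connect (outer S) y y' -> x = x'.

(** Cycles are matched by edge sets, because [cs] records each with just one starting point and in
    its counterclockwise orientation. *)
Definition drawn S : Prop := attached S /\ exists P B cs, drawok P B S cs /\
  forall s, is_cycle adj s -> {subset s <= S} ->
    exists2 s0, s0 \in cs & cycle_edges s0 = cycle_edges s.

Lemma outer_sub S S' : S \subset S' -> subrel (connect (outer S')) (connect (outer S)).
Proof.
move=> /fintype.subsetP sub; apply: connect_sub => a b /and3P[ab aS bS]; apply: connect1.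
by rewrite /outer /= ab (contra (sub _) aS) (contra (sub _) bS).
Qed.

Lemma outer_sym S : symmetric (connect (outer S)).
Proof.
apply: sym_connect_sym => a b; rewrite /outer /= (adjC sg).
by rewrite (andbC (a \notin S)).
Qed.

Lemma drawn0 : drawn (@finset.set0 V).
Proof.
split; first by move=> x x' y y'; rewrite inE.
exists (fun=> 0), (fun=> 0), [::]; split; last first.
  move=> s cs sub; case: s cs sub => [|x s] //= _ sub.
  by have := sub x (mem_head _ _); rewrite inE.
by split=> // x; rewrite ?inE // => y; rewrite inE.
Qed.

Lemma drawn_isolated S w : drawn S -> w \notin S ->
  (forall x y, x \in S -> y \notin S -> ~~ adj x y) -> drawn (w |: S).
Proof.
move=> [at1 [P [B [cs [ok cov]]]]] wS na; split.
  move=> x x' y y'; rewrite !inE !negb_or => /orP[/eqP ->|xS] /orP[/eqP ->|xS'] // /andP[_ yS] /andP[_ yS'] a1 a2 _.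
  - by have := na _ _ xS' yS'; rewrite a2.
  - by have := na _ _ xS yS; rewrite a1.
  - by have := na _ _ xS yS; rewrite a1.
have [|P' ok'] := drawok_isolated sg ok wS; first by move=> x xS; exact: na.
exists P', B, cs; split=> // s cy sub; apply: cov => // x xs.
have := sub x xs; rewrite !inE => /orP[/eqP ex|//].
have ns : next s x \in s by rewrite mem_next.
have a := cycle_adj_next cy xs; have := sub _ ns; rewrite !inE => /orP[/eqP en|nS].
  by have := adj_neq sg a; rewrite en ex eqxx.
by have := na _ _ nS wS; rewrite (adjC sg) -ex a.
Qed.

Lemma drawn_bridge S v w : drawn S -> v \in S -> w \notin S -> adj v w ->
  (forall s, is_cycle adj s -> [set v; w] \notin cycle_edges s) -> drawn (w |: S).
Proof.
move=> [at1 [P [B [cs [ok cov]]]]] vS wS vw nc.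
have sep x : x \in S -> adj x w -> x = v.
  by move=> xS xw; apply: (at1 _ _ w w).
have sub1 : S \subset w |: S by apply/fintype.subsetP => x xS; rewrite inE xS orbT.
(* A connection outside from w back to v would put the edge v w on a cycle. *)
have no_path y y' : y \notin w |: S -> y' \notin w |: S -> adj w y -> adj v y' ->
    connect (outer (w |: S)) y y' -> False.
  move=> yS yS' wy vy' /uniq_connect[p [pp lp up]].
  have dis z : z \in y :: p -> z \notin w |: S.
    elim: p y yS pp {lp wy up} => [|b p IH] y yS /=; first by rewrite inE => _ /eqP ->.
    case/andP => /and3P[_ _ bS] pp; rewrite inE => /orP[/eqP -> //|]; exact: IH.
  have cc : is_cycle adj [:: v, w, y & p].
    apply/and3P; split => //.
    - rewrite 2!cons_uniq up andbT; apply/andP; split.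
        rewrite inE negb_or (adj_neq sg vw) /=; apply/negP => /dis.
        by rewrite !inE vS orbT.
      by apply/negP => /dis; rewrite !inE eqxx.
    - rewrite /= vw wy rcons_path lp (adjC sg y') vy' andbT.
      by apply: sub_path pp => a b /and3P[].
  by move/negP: (nc _ cc); apply; rewrite -{1}(next_head v w (y :: p)) cycle_edges_next ?mem_head.
have vwS y : y \notin w |: S -> y \notin S.
  by apply: contraNN => yS; rewrite inE yS orbT.
split.
  have half x' y y' : x' \in S -> y \notin w |: S -> y' \notin w |: S -> adj w y ->
      adj x' y' -> connect (outer (w |: S)) y y' -> False.
    move=> xS' yS yS' wy xy' co.
    have co' : connect (outer S) w y'.
      apply: connect_trans (outer_sub sub1 co); apply: connect1.
      by rewrite /outer /= wy wS vwS.
    have ev := at1 v x' w y' vS xS' wS (vwS _ yS') vw xy' co'.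
    by apply: (no_path y y') => //; rewrite ev.
  move=> x x' y y'; rewrite [x \in _]finset.in_setU1 [x' \in _]finset.in_setU1.
  move=> /orP[/eqP ->|xS] /orP[/eqP ->|xS'] // yS yS' a1 a2 co.
  - by case: (half x' y y').
  - have co' : connect (outer (w |: S)) y' y.
      by rewrite outer_sym.
    by case: (half x y' y).
  - by apply: (at1 x x' y y'); rewrite ?vwS //; apply: outer_sub co.
have [P' [B' ok']] := drawok_bridge sg rsys ok vS wS vw sep.
exists P', B', cs; split=> // s cy sub; apply: cov => // x xs.
have := sub x xs; rewrite !inE => /orP[/eqP ex|//].
have ns : next s x \in s by rewrite mem_next.
have a := cycle_adj_next cy xs; have := sub _ ns; rewrite !inE => /orP[/eqP en|nS].
  by have := adj_neq sg a; rewrite en ex eqxx.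
have en : next s x = v by apply: sep => //; rewrite (adjC sg) -ex.
by move/negP: (nc _ cy); case; rewrite finset.setUC -en -ex cycle_edges_next.
Qed.
End Growth.

(** * Adding a whole cycle *)

Section GrowthCycle.
Variables (R : realType) (V : finType) (adj : rel V) (rt : V -> V -> V).
Hypothesis (sg : simple_graph adj) (cac : cactus adj) (nat_emb : natural_embedding adj rt).
Local Notation C := R[i].
Implicit Types (P : V -> C) (B : V -> R) (S N : {set V}) (s c : seq V).

Let rsys : rotation_system adj rt. Proof. by case: nat_emb. Qed.

Lemma ccw_rot n s : uniq s -> ccw rt s -> ccw rt (rot n s).
Proof. by move=> us h x; rewrite mem_rot => xs; rewrite next_rot // prev_rot // h. Qed.

Lemma exists_ccw s : is_cycle adj s -> exists2 s0, is_cycle adj s0 /\ ccw rt s0 &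
  (s0 = s \/ s0 = rev s).
Proof.
move=> cs; have us : uniq s by case/and3P: cs.
case: nat_emb => _ /(_ s cs) [h|h]; first by exists s; auto.
exists (rev s); last by right.
split; first by rewrite is_cycle_rev.
by move=> x; rewrite mem_rev => xs; rewrite next_rev // prev_rev // h.
Qed.

Lemma ccw_cycle_through s v w : is_cycle adj s -> [set v; w] \in cycle_edges s ->
  exists s', [/\ is_cycle adj (v :: s'), ccw rt (v :: s') &
    w = next (v :: s') v \/ w = prev (v :: s') v].
Proof.
move=> cs e; have us : uniq s by case/and3P: cs.
have [s0 [c0 cc0] h] := exists_ccw cs.
have us0 : uniq s0 by case/and3P: c0.
have [vs ws] := cycle_edges_mem e.
have vs0 : v \in s0 by case: h => ->; rewrite ?mem_rev.
have [n s' er] := rot_to vs0.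
exists s'; rewrite -er; split; [by rewrite is_cycle_rot|exact: ccw_rot|].
rewrite next_rot // prev_rot //.
have e2 : w = next s v \/ w = prev s v.
  by case: (cycle_edgesP e) => -[_ ->]; [left|right; rewrite prev_next].
by case: h => ->; rewrite // next_rev // prev_rev //; case: e2; auto.
Qed.

(** By [attached], the path could re-enter S only at v, which it omits. Applied to a cycle through v
    and w, this shows that all its vertices except v are new. *)
Lemma outside_path S v w a p : attached adj S -> v \in S -> w \notin S -> adj v w ->
  path adj a p -> v \notin p -> a \notin S -> connect (outer adj S) w a ->
  {in a :: p, forall y, y \notin S /\ connect (outer adj S) w y}.
Proof.
move=> att vS wS vw; elim: p a => [|b p IH] a /=.
  by move=> _ _ aS wa y; rewrite inE => /eqP ->.
case/andP => ab pp; rewrite inE negb_or => /andP[vb vp] aS wa.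
have bS : b \notin S.
  apply/negP => bS; have e := att v b w a vS bS wS aS vw.
  by rewrite (adjC sg) in ab; have := e ab wa => e'; rewrite e' eqxx in vb.
have wb : connect (outer adj S) w b.
  by apply: connect_trans wa _; apply: connect1; rewrite /outer /= ab aS.
move=> y; rewrite inE => /orP[/eqP -> //|]; exact: IH.
Qed.

Lemma cycle_outside S v w s' : attached adj S -> v \in S -> w \notin S ->
  is_cycle adj (v :: s') -> w = next (v :: s') v \/ w = prev (v :: s') v ->
  {in s', forall y, y \notin S /\ connect (outer adj S) w y}.
Proof.
move=> att vS wS cs.
suff h t : is_cycle adj (v :: t) -> w = next (v :: t) v ->
    {in t, forall y, y \notin S /\ connect (outer adj S) w y}.
  case=> [|ew]; first exact: h.
  have us : uniq (v :: s') by case/and3P: cs.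
  have er : rotr 1 (rev (v :: s')) = v :: rev s' by rewrite rev_cons rotr1_rcons.
  move=> y ys; apply: (h (rev s')); rewrite ?mem_rev //.
    by rewrite -er /rotr is_cycle_rot is_cycle_rev.
  by rewrite -er next_rotr ?rev_uniq // next_rev.
case: t => [|b t]; first by case/and3P.
rewrite next_head => ct ew; rewrite -ew in ct *.
case/and3P: ct => /= /andP[vt _] _ /andP[vw pt].
have pt' : path adj w t by move: pt; rewrite rcons_path => /andP[].
move: vt; rewrite inE negb_or => /andP[_ vt].
exact: (outside_path att vS wS vw pt' vt wS (connect0 _ _)).
Qed.

Lemma drawok_cycle P B S cs v s' : drawok adj rt P B S cs -> v \in S ->
  is_cycle adj (v :: s') -> ccw rt (v :: s') -> {in s', forall y, y \notin S} ->
  (forall x y, x \in S -> y \in s' -> adj x y -> x = v) ->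
  exists P' B', drawok adj rt P' B' (S :|: [set y in s']) (cs ++ [:: v :: s']).
Proof.
move=> ok vS cy cc dis sep.
have [rho rho0 att] := drawok_attach sg rsys ok vS.
have chl := fun x x' => @cactus_chordless V adj sg cac _ x x' cy.
have gd := gadget_drawok rsys P B cy cc rho0 chl.
have gw := @gadget_wedge R V adj rt rsys v s' P B rho cy cc rho0 chl.
have us : uniq (v :: s') by case/and3P: (cy).
have ns : v \notin s' by case/andP: us.
have nS x : x \in S -> x \in s' = false.
  by move=> xS; apply/negP => /dis; rewrite xS.
have vh : v \in v :: s' by rewrite mem_head.
have va := cycle_adj_next cy vh.
have ins y : y \in v :: s' -> y != v -> y \in [set y in s'].
  by rewrite !inE => /orP[/eqP ->|-> //]; rewrite eqxx.
eexists; eexists; apply: (att _ _ _ _ (next (v :: s') v) 1%N _ _ _ _ gd) => //.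
- by move=> x xS; rewrite /gadgetP (nS x xS).
- by move=> x xS; rewrite /gadgetB (nS x xS).
- rewrite disjoint_sym; apply/pred0P => y /=; rewrite inE.
  by case: (boolP (y \in s')) => //= /dis /negPf.
- by move=> x y xS; rewrite inE; exact: sep.
- by apply: ins; rewrite ?mem_next // eq_sym (adj_neq sg va).
- move=> _; rewrite (cc _ vh); apply: ins; first by rewrite mem_prev.
  have := prev_cycle (proj2 (andP (proj2 (andP cy)))) vh.
  by move/(adj_neq sg).
Qed.

Lemma drawn_cycle S v w s : drawn R adj rt S -> v \in S -> w \notin S ->
  is_cycle adj s -> [set v; w] \in cycle_edges s -> exists2 S' : {set V}, S \proper S' & drawn R adj rt S'.
Proof.
move=> [at1 [P [B [cs [ok cov]]]]] vS wS cs0 e0.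
have [s' [cy cc ew]] := ccw_cycle_through cs0 e0.
have hout := cycle_outside at1 vS wS cy ew.
have us : uniq (v :: s') by case/and3P: (cy).
have vs : v \in v :: s' by rewrite mem_head.
have vw : adj v w.
  case: ew => ->; first exact: cycle_adj_next cy vs.
  by rewrite (adjC sg); apply: (prev_cycle _ vs); case/and3P: cy.
have ws : w \in s'.
  have : w \in v :: s' by case: ew => ->; rewrite ?mem_next ?mem_prev.
  by rewrite inE => /orP[/eqP wv|//]; rewrite wv vS in wS.
have dis : {in s', forall y, y \notin S} by move=> y /hout[].
have sep x y : x \in S -> y \in s' -> adj x y -> x = v.
  by move=> xS /hout[yS wy] xy; rewrite (at1 v x w y).
have chl := fun x x' => @cactus_chordless V adj sg cac _ x x' cy.
have [P' [B' ok']] := drawok_cycle ok vS cy cc dis sep.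
exists (S :|: [set y in s']).
  apply/properP; split; first exact: finset.subsetUl.
  by exists w; rewrite // !inE ws orbT.
split; last first.
  exists P', B', (cs ++ [:: v :: s']); split=> // c cyc sub.
  (* At a new vertex y, the next vertex of c also lies on the new cycle, since v is the only old
     vertex adjacent to y. Having no chords, the new cycle contains this edge, and the cactus
     property identifies the two cycles. *)
  have [/hasP[y yc ys]|/hasPn no] := boolP (has (mem s') c); last first.
    have [|s0 h1 h2] := cov c cyc; last by exists s0; rewrite // mem_cat h1.
    move=> x xc; have := sub x xc; rewrite !inE => /orP[//|xs].
    by have := no x xc; rewrite /= xs.
  exists (v :: s'); first by rewrite mem_cat mem_head orbT.
  have a := cycle_adj_next cyc yc.
  have ns : next c y \in v :: s'.
    have : next c y \in S :|: [set y in s'] by apply: sub; rewrite mem_next.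
    rewrite !inE => /orP[nS|->]; last by rewrite orbT.
    by rewrite (sep _ _ nS ys) ?eqxx // (adjC sg).
  have ys' : y \in v :: s' by rewrite inE (ys : y \in s') orbT.
  apply: (cactus_edge cac cy cyc a); last exact: cycle_edges_next.
  have [->|e] := chl _ _ ys' ns a; first exact: cycle_edges_next.
  by rewrite {1}e finset.setUC cycle_edges_next.
have sub1 : S \subset S :|: [set y in s'] by exact: finset.subsetUl.
have nS y : y \notin S :|: [set y in s'] -> y \notin S /\ y \notin v :: s'.
  rewrite !inE !negb_or => /andP[yS ys]; split=> //; rewrite ys andbT.
  by apply: contraNneq yS => ->.
(* A component that touches the new cycle in two vertices would contain an ear of it. *)
have ear x x' y y' : x \in v :: s' -> x' \in v :: s' -> y \notin S :|: [set y in s'] ->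
    y' \notin S :|: [set y in s'] -> adj x y -> adj x' y' ->
    connect (outer adj (S :|: [set y in s'])) y y' -> x = x'.
  move=> xs xs' yS yS' xy xy' /uniq_connect[p [pp lp up]].
  apply/eqP; apply/negP => /negP xx.
  apply: (cactus_no_ear sg cac cy xs xs' xx _ lp up _ xy xy').
    by apply: sub_path pp => a b /and3P[].
  move=> z zp; suff /nS[] : z \notin S :|: [set y in s'] by [].
  elim: p y yS pp zp {lp up xy} => [|b p IH] y yS /=; first by rewrite inE => _ /eqP ->.
  case/andP => /and3P[_ _ bS] pp; rewrite inE => /orP[/eqP -> //|]; exact: IH.
(* A component touching both s' and S was, together with s', part of one old outer component, which
   hung on v. *)
have half x x' y y' : x \in s' -> x' \in S -> y \notin S :|: [set y in s'] ->
    y' \notin S :|: [set y in s'] -> adj x y -> adj x' y' ->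
    connect (outer adj (S :|: [set y in s'])) y y' -> x' = v.
  move=> xs xS' /nS[yS _] /nS[yS' _] xy xy' co.
  have [xS wx] := hout x xs.
  have co' : connect (outer adj S) w y'.
    apply: connect_trans (outer_sub sub1 co); apply: connect_trans wx _.
    by apply: connect1; rewrite /outer /= xy xS.
  by rewrite (at1 v x' w y').
move=> x x' y y' xS xS' yS yS' xy xy' co.
have co' : connect (outer adj (S :|: [set y in s'])) y' y by rewrite outer_sym.
have cases z : z \in S :|: [set y in s'] -> z \in S \/ z \in s' by rewrite !inE => /orP.
have vin y0 : y0 \in s' -> y0 \in v :: s' by rewrite inE => ->; rewrite orbT.
have [{}xS|xs] := cases _ xS; have [{}xS'|xs'] := cases _ xS'.
- have [[y1 _] [y2 _]] := (nS _ yS, nS _ yS').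
  by apply: (at1 x x' y y') => //; apply: outer_sub co.
- have xv := half x' x y' y xs' xS yS' yS xy' xy co'.
  by apply: (ear x x' y y') => //; [rewrite xv|exact: vin].
- have xv := half x x' y y' xs xS' yS yS' xy xy' co.
  by apply: (ear x x' y y') => //; [exact: vin|rewrite xv].
- by apply: (ear x x' y y') => //; exact: vin.
Qed.

Lemma drawn_setT : drawn R adj rt [set: V]%SET.
Proof.
suff h n S : (#|~: S| <= n)%N -> drawn R adj rt S -> drawn R adj rt [set: V]%SET.
  exact: (h #|~: (@finset.set0 V)| finset.set0) (leqnn _) (drawn0 R adj rt).
elim: n S => [|n IH] S hn dS.
  have : ~: S = finset.set0 by apply/eqP; rewrite -cards_eq0 -leqn0.
  by move/(congr1 (@finset.setC V)); rewrite finset.setCK finset.setC0 => <-.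
have [ST|] := eqVneq (~: S) finset.set0.
  by apply: (IH S) => //; rewrite ST cards0.
case/set0Pn => w0; rewrite inE => w0S.
have next_step S' : S \proper S' -> drawn R adj rt S' -> drawn R adj rt [set: V]%SET.
  move=> pS; apply: IH; rewrite -ltnS; apply: leq_trans hn.
  by apply: proper_card; rewrite properC.
have addw w : w \notin S -> S \proper w |: S.
  move=> wS; apply/properP; split; first by apply/fintype.subsetP => z zS; rewrite inE zS orbT.
  by exists w; rewrite // !inE eqxx.
(* An edge leaving S determines the next block: its cycle if it lies on one, else the edge as a
   bridge. If none leaves, a new component is begun. *)
have [[v [w [vS wS vw]]]|no] := pselect (exists v w, [/\ v \in S, w \notin S & adj v w]); last first.
  apply: (next_step _ (addw _ w0S)); apply: drawn_isolated => // x y xS yS.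
  by apply/negP => xy; apply: no; exists x, y.
have [[s [cs e]]|nc] := pselect (exists s, is_cycle adj s /\ [set v; w] \in cycle_edges s).
  have [S' pS dS'] := drawn_cycle dS vS wS cs e.
  exact: next_step pS dS'.
apply: (next_step _ (addw _ wS)); apply: (drawn_bridge sg nat_emb dS vS wS vw) => s cs.
by apply/negP => e; apply: nc; exists s.
Qed.

End GrowthCycle.

Theorem mainTheorem13 (R : realType) (V : finType) (adj : rel V) (rot : V -> V -> V) :
  simple_graph adj -> cactus adj -> natural_embedding adj rot ->
  exists (p : V -> pt R) (t : V -> V -> R), planar_lombardi_drawing_for adj rot p t.
Proof.
move=> sg cac emb; have rsys := emb.1.
have [_ [P [B [cs [ok cov]]]]] := drawn_setT R sg cac emb.
pose p v := ofC (P v).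
have eE u v z : edge_arc p (ang adj rot B) u v z <-> edgeC adj rot P B u v (toC z).
  by rewrite /edge_arc arcP /p !ofCK.
have T v : v \in [set: V]%SET by rewrite inE.
have esym u v z : adj u v -> edgeC adj rot P B u v z -> edgeC adj rot P B v u z.
  by move=> uv; apply: (dk_sym ok).
have inj : injective p.
  by move=> u v /(can_inj (@ofCK R)) /(dk_inj ok); apply.
exists p, (ang adj rot B); split.
- split=> // u v uv; split.
    apply: good_dirP.
      by move/inj => e; have := adj_neq sg uv; rewrite e eqxx.
    by rewrite !ofCK; apply: (dk_good ok).
  apply/seteqP; split=> z /eE e; apply/eE; apply: esym => //.
  by rewrite (adjC sg).
- exact: lombardi_ang.
- split.
    move=> u v x y z uv xy /eE e1 /eE e2.
    have [|[w wi ez]] := dk_pl ok (T u) (T v) (T x) (T y) uv xy e1 e2; first by left.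
    by right; exists w; split; rewrite // /p -ez toCK.
  by move=> u v w uv /eE; rewrite /p ofCK; apply: (dk_vx ok).
move=> s cy z hz off.
have [//|s0 hs0 es] := cov s cy.
(* s and s0 have the same edges but may run in opposite directions; the symmetry of the arcs makes
   their curves agree. *)
have curve q : curveC adj rot P B s0 q -> cycle_curve p (ang adj rot B) s (ofC q).
  have [cy0 _ _] := dk_cyc ok hs0.
  case=> x xs e; have a := cycle_adj_next cy0 xs.
  have : [set x; next s0 x] \in cycle_edges s by rewrite -es cycle_edges_next.
  case/cycle_edgesP => -[ys en]; last first.
    exists (next s0 x); split => //; apply/eE; rewrite ofCK -en.
    by apply: esym.
  by exists x; split => //; apply/eE; rewrite ofCK -en.
have hz' : ptsC adj rot P B [set: V]%SET (toC z).
  case: hz => [[u [v [uv /eE e]]]|[w ->]]; first by left; exists u, v.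
  by right; exists w; rewrite // /p ofCK.
have [|K [K1 K2 K3 K4]] := dk_out ok hs0 hz'.
  by move/curve; rewrite toCK.
exists K; split; first by rewrite toCK in K1.
split=> // q Kq qc; apply: (K2 q Kq).
have [x [xs /eE e]] := qc.
have a := cycle_adj_next cy xs.
have : [set x; next s x] \in cycle_edges s0 by rewrite es cycle_edges_next.
case/cycle_edgesP => -[ys en]; first by exists x; rewrite -?en.
by exists (next s x); rewrite // -en; apply: esym.
Qed.
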